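(* Let $N\ge1$, let $L_1\le L_2\le\dots\le L_N$ be the ordered eigenvalues of an $N$-GOE matrix and let $q_N^k$ denote the probability density of $L_k$. Then for $\ell\in\mathbb R$ and $k=1,\dots,N$, $$q_N^k(\ell)=k_N\,N!\,(-1)^{k-1}\exp\Big(-\frac{\ell^2}{2}\Big)\sum_{I\in\mathcal F_{k-1}(N-1)}\operatorname{Pf}\big(\mathcal A^1(I,\ell)\big),$$ where $\mathcal A^1(I,\ell)$ is the matrix $\mathcal A^\alpha(I,\ell)$ defined below with $n=N-1$ and $\alpha=1$.
   Context: An $n$-GOE matrix is symmetric with independent centred Gaussian entries on and above the diagonal, variance 1 on the diagonal and $1/2$ off it. $k_N:=(2\pi)^{-N/2}(\Gamma(3/2))^N\big(\prod_{i=1}^N\Gamma(1+i/2)\big)^{-1}$. $\mathcal F_p(n)$ is the set of subsets of $\{1,\dots,n\}$ of size $p$. For $I\in\mathcal F_p(n)$ and $\ell\in\mathbb R$, set $\mathcal D_i^I(\ell)=(-\infty,\ell)$ if $i\in I$ and $\mathcal D_i^I(\ell)=(\ell,+\infty)$ if $i\notin I$. Let $\mathbf s$ be the sign function. For $\alpha\in\{1,2\}$ define, for $i,j=1,\dots,n$, $$a^\alpha_{i,j}(I,\ell)=\int_{\mathcal D_i^I(\ell)}dx\int_{\mathcal D_j^I(\ell)}dy\ \mathbf s(y-x)\,x^{i-1}y^{j-1}(x-\ell)^\alpha(y-\ell)^\alpha\exp\Big(-\frac{x^2+y^2}{2}\Big).$$ If $n$ is even, $\mathcal A^\alpha(I,\ell)$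 is the $n\times n$ skew-symmetric matrix $(a^\alpha_{i,j}(I,\ell))$. If $n$ is odd, $\mathcal A^\alpha(I,\ell)$ is the $(n+1)\times(n+1)$ skew-symmetric matrix with these entries for $i,j\le n$ and in addition $a^\alpha_{i,n+1}(I,\ell)=-a^\alpha_{n+1,i}(I,\ell)=\int_{\mathcal D_i^I(\ell)}x^{i-1}(x-\ell)^\alpha e^{-x^2/2}dx$ for $i\le n$, $a^\alpha_{n+1,n+1}=0$. $\operatorname{Pf}$ denotes the Pfaffian. (For $n=0$ the Pfaffian of the empty matrix is $1$.) *)

(* Defs.v *)
From HB Require Import structures.
From mathcomp Require Import all_boot all_order all_algebra all_fingroup.
From mathcomp Require Import all_classical all_reals all_analysis.
Set Implicit Arguments. Unset Strict Implicit. Unset Printing Implicit Defensive.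
Import Order.TTheory GRing.Theory Num.Theory Num.Def.
Local Open Scope classical_set_scope.
Local Open Scope ring_scope.

Section GOE.
Variable R : realType.

Definition Gammaf (s : R) : R :=
  Rintegral lebesgue_measure [set` `]0, +oo[] (fun t => t `^ (s - 1) * expR (- t)).

Definition kN (N : nat) : R :=
  (2 * pi) `^ (- (N%:R / 2)) * Gammaf (3 / 2) ^+ N
  / \prod_(1 <= i < N.+1) Gammaf (1 + i%:R / 2).

(** Pfaffian of an n x n matrix (n = 2m even):
    Pf A = 1/(2^m m!) sum_(s in S_2m) sgn s prod_(i<m) A_(s(2i), s(2i+1)).
    The empty matrix has Pfaffian 1. *)
Definition pfaffian (n : nat) (A : 'M[R]_n) : R :=
  (\sum_(s : 'S_n) (-1) ^+ s *
     \prod_(i < n | ~~ odd i) \prod_(j < n | val j == (val i).+1)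
        A (s i) (s j))
  / (2 ^+ n./2 * (n./2)`!%:R).

(** Domain D_i^I(l), indices 0-based: row i (0-based) corresponds to i+1. *)
Definition dom_I (n : nat) (I : {set 'I_n}) (i : nat) (l : R) : set R :=
  if [exists t in I, nat_of_ord t == i] then [set` `]-oo, l[] else [set` `]l, +oo[].

(** a^alpha_{i,j}(I,l) with 0-based i, j (so x^(i-1) becomes x^i). *)
Definition a_ent (alpha n : nat) (I : {set 'I_n}) (l : R) (i j : nat) : R :=
  Rintegral lebesgue_measure (dom_I I i l) (fun x =>
    Rintegral lebesgue_measure (dom_I I j l) (fun y =>
      Num.sg (y - x) * x ^+ i * y ^+ j * (x - l) ^+ alpha * (y - l) ^+ alpha
      * expR (- (x ^+ 2 + y ^+ 2) / 2))).

(** a^alpha_{i,n+1}(I,l) with 0-based i. *)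
Definition b_ent (alpha n : nat) (I : {set 'I_n}) (l : R) (i : nat) : R :=
  Rintegral lebesgue_measure (dom_I I i l) (fun x =>
    x ^+ i * (x - l) ^+ alpha * expR (- x ^+ 2 / 2)).

Definition Amat (alpha n : nat) (I : {set 'I_n}) (l : R) :
    'M[R]_(n + odd n) :=
  \matrix_(i < n + odd n, j < n + odd n)
    if (i < n)%N && (j < n)%N then a_ent alpha I l i j
    else if (i < n)%N then b_ent alpha I l i
    else if (j < n)%N then - b_ent alpha I l j
    else 0.

Definition eigs (N : nat) (M : 'M[R]_N) : seq R :=
  xget [::] (fun s : seq R => sorted <=%R s /\
      char_poly M = \prod_(x <- s) ('X - x%:P)).

Definition Lk (N k : nat) (M : 'M[R]_N) : R := nth 0 (eigs M) k.-1.

(** Iterated Lebesgue integral over the coordinates listed in s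
    (coordinates not listed are set to 0). *)
Fixpoint iint (T : eqType) (s : seq T) (f : (T -> R) -> \bar R) : \bar R :=
  match s with
  | [::] => f (fun _ => 0)
  | t :: s' => (\int[lebesgue_measure]_x
                 iint s' (fun v => f (fun u => if u == t then x else v u)))%E
  end.

(** Independent coordinates of an N-GOE matrix: entries (i,j) with i <= j. *)
Definition goe_idx (N : nat) : seq ('I_N * 'I_N) :=
  [seq p <- enum {: 'I_N * 'I_N} | (val p.1 <= val p.2)%N].

Definition goe_mat (N : nat) (v : 'I_N * 'I_N -> R) : 'M[R]_N :=
  \matrix_(i, j) if (val i <= val j)%N then v (i, j) else v (j, i).

(** Joint density of the independent entries: N(0,1) on the diagonal,
    N(0,1/2) (standard deviation sqrt(1/2)) above the diagonal. *)
Definition goe_density (N : nat) (v : 'I_N * 'I_N -> R) : R :=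
  \prod_(p <- goe_idx N)
     (if val p.1 == val p.2 then normal_pdf 0 1 (v p)
      else normal_pdf 0 (Num.sqrt (1 / 2)) (v p)).

Definition goe_prob (N : nat) (E : set 'M[R]_N) : \bar R :=
  iint (goe_idx N) (fun v =>
    ((if `[< E (goe_mat v) >] then goe_density v else 0)%:E)).

Definition qNk (N k : nat) (l : R) : R :=
  kN N * N`!%:R * (-1) ^+ k.-1 * expR (- l ^+ 2 / 2) *
  \sum_(I : {set 'I_N.-1} | #|I| == k.-1) pfaffian (Amat 1 I l).

End GOE.

(* Main.v *)
(** Write an (1+n)x(1+n) symmetric matrix as M = [[a, v^T], [v, A]]. For generic
    (A, v), the equation a = l + v^T (A - l)^-1 v maps each gap of the spectrum
    of A increasingly onto the line, so the eigenvalue l of M with exactly k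
    eigenvalues below it can replace the coordinate a. Substituting
    v = - (A - l) w and then A - l = Q^-1 (B - l) Q^-T, where Q^T Q = 1 + w w^T,
    turns M into a matrix with the characteristic polynomial of the direct sum of
    l and B: the Jacobian is |det (B - l)| times a function of w alone. This gives
    the law of the k-th eigenvalue in terms of a symmetric matrix B of size n with
    k eigenvalues below l and, summed over k and iterated, the density
    |Vandermonde| of unordered eigenvalues. The constants are evaluated through
    Gaussian integrals.

    The remaining integral over the eigenvalues y_1, ..., y_n of B becomes a sum
    of Pfaffians because the Pfaffian of sign(y_j - y_i) is the sign of the
    Vandermonde determinant: by Fubini, Pf(A^1(I, l)) is the integral of that sign
    against a product of one-variable weights, the sum over I restores the
    condition that exactly k - 1 of the y_j are below l, and antisymmetrization
    turns the monomial y_1^0 ... y_n^(n-1) into the Vandermonde determinant. *)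

Require Import Defs.
From HB Require Import structures.
From mathcomp Require Import all_boot all_order all_algebra all_fingroup.
From mathcomp Require Import all_classical all_reals all_analysis measurable_realfun real_interval.
From mathcomp Require Import spectral complex.
From mathcomp Require Import ring lra zify.
Set Implicit Arguments. Unset Strict Implicit. Unset Printing Implicit Defensive.
Import Order.TTheory GRing.Theory Num.Theory Num.Def.
Import numFieldNormedType.Exports.
Local Open Scope classical_set_scope.
Local Open Scope ring_scope.

(** * Lebesgue measure on vectors and symmetric matrices *)

(** Every change of variables is a one-variable substitution or a triangular linear map, so Tonelli
    along the recursive measures [vecm] and [symm] carries it out. For this reason [Q] is a
    triangular factor of [1 + w w^T]: its action on symmetric matrices can be computed block by
    block. The rank of the chosen eigenvalue survives all substitutions by strict interlacing: an
    eigenvalue of [M] in gap [k] of the spectrum of [A] has exactly [k] eigenvalues of [M] below it,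
    and since [M] is isospectral to the direct sum of [l] and [B], the condition becomes
    [cnt B l = k].

    Two obstacles shape the rest. [eigs] is a list picked by choice, so its measurability has to be
    earned: the counting function [cnt] is a pointwise limit of traces of matrix polynomials, and
    single eigenvalues are measurable because [cnt] is. And the secular equation degenerates when
    [A] has a multiple eigenvalue or a spectral component of [v] vanishes. Multiple eigenvalues are
    shown to be negligible by induction on the size, through the same bordering; the bad vectors [v]
    lie in finitely many hyperplanes. *)

Definition mx_display : measure_display. Proof. exact: default_measure_display. Qed.

Section matrix_measurable.
Variables (R : realType) (m n : nat).

(** Cylinders over a single entry: they generate the product sigma-algebra, so measurability of a
    matrix-valued map can be tested entry by entry. *)
Definition mx_sets : set (set 'M[R]_(m, n)) :=
  [set A | exists i j, exists2 B : set R, measurable B & A = [set M : 'M[R]_(m, n) | B (M i j)]].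

Let mx_set0 : <<s mx_sets >> set0. Proof. exact: sigma_algebra0. Qed.
Let mx_setC A : <<s mx_sets >> A -> <<s mx_sets >> (~` A).
Proof. exact: sigma_algebraC. Qed.
Let mx_bigcup (F : _^nat) : (forall i, <<s mx_sets >> (F i)) ->
  <<s mx_sets >> (\bigcup_i (F i)).
Proof. exact: sigma_algebra_bigcup. Qed.

HB.instance Definition _ := @isMeasurable.Build mx_display
  'M[R]_(m, n) <<s mx_sets >> mx_set0 mx_setC mx_bigcup.

Lemma measurable_entry i j : measurable_fun [set: 'M[R]_(m, n)] (fun M => M i j).
Proof.
move=> _ B mB; rewrite setTI; apply: sub_sigma_algebra.
by exists i, j, B.
Qed.

Lemma measurable_mxP d (T : measurableType d) (f : T -> 'M[R]_(m, n)) :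
  (forall i j, measurable_fun [set: T] (fun x => f x i j)) ->
  measurable_fun [set: T] f.
Proof.
move=> mf; apply: (@measurability _ _ _ _ _ _ mx_sets) => //.
move=> _ [_ [i [j [B mB ->]]] <-].
exact: mf.
Qed.

End matrix_measurable.

Section pushforward_sigma_finite.
Local Open Scope ereal_scope.
Context d d' (X : measurableType d) (Y : measurableType d') (R : realType).
Variables (m : {sigma_finite_measure set X -> \bar R}) (f : X -> Y) (g : Y -> X).
Hypotheses (mf : measurable_fun [set: X] f) (mg : measurable_fun [set: Y] g).
Hypothesis fK : cancel f g.

(** The proofs are arguments so that a sigma-finite instance can be attached to the term: preimages
    under the measurable left inverse [g] of an exhaustion of [X] exhaust [Y]. *)
Definition pushm of measurable_fun [set: X] f & measurable_fun [set: Y] g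
  & cancel f g := pushforward m f.

Let nu : {measure set Y -> \bar R} := measure_function_pushforward__canonical__measure_function_Measure m mf.

Let pushforward_sigma_finite : sigma_finite [set: Y] nu.
Proof.
have /sigma_finiteP[F [TF ndF Foo]] := sigma_finiteT m.
exists (fun n => g @^-1` F n).
  by rewrite -preimage_bigcup -TF preimage_setT.
move=> i; have [mFi Fi] := Foo i; split.
  by rewrite -[X in measurable X]setTI; exact: mg.
rewrite /= /pushforward -comp_preimage.
suff -> : g \o f = id by [].
by apply/funext => x /=; rewrite fK.
Qed.

HB.instance Definition _ := Measure.copy (pushm mf mg fK) nu.
HB.instance Definition _ := Measure_isSigmaFinite.Build _ _ _ (pushm mf mg fK)
  pushforward_sigma_finite.

Lemma ge0_integral_pushm (h : Y -> \bar R) : measurable_fun [set: Y] h ->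
  (forall y, 0 <= h y) ->
  \int[pushm mf mg fK]_y h y = \int[m]_x h (f x).
Proof.
move=> mh h0; rewrite (ge0_integral_pushforward mf) //.
Qed.

End pushforward_sigma_finite.

Section product_sigma_finite.
Local Open Scope ereal_scope.
Context d1 d2 (T1 : measurableType d1) (T2 : measurableType d2) (R : realType).
Variable m1 : {sigma_finite_measure set T1 -> \bar R}.
Variable m2 : {sigma_finite_measure set T2 -> \bar R}.

(** The product measure under its own name, to carry a sigma-finite structure; products can then be
    nested. *)
Definition prodm : set (T1 * T2) -> \bar R := m1 \x m2.

HB.instance Definition _ := Measure.copy prodm (m1 \x m2).

Let prodm_sigma_finite : sigma_finite [set: T1 * T2] prodm.
Proof.
have [F TF Ffin] := sigma_finiteT m1; have [G TG Gfin] := sigma_finiteT m2.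
have [g [_ gsurj]] : exists g : nat -> nat * nat, True /\ forall p, exists n, g n = p.
  exists (fun n => odflt (0, 0)%N (unpickle n)); split => // p.
  by exists (pickle p); rewrite pickleK.
exists (fun n => F (g n).1 `*` G (g n).2).
  apply/seteqP; split=> [[x y] _|]//.
  have [i _ Fx] : (\bigcup_i F i) x by rewrite -TF.
  have [j _ Gy] : (\bigcup_j G j) y by rewrite -TG.
  by have [n gn] := gsurj (i, j); exists n; rewrite //= gn.
move=> n; have [mF Foo] := Ffin (g n).1; have [mG Goo] := Gfin (g n).2.
split; first exact: measurableX.
by rewrite /prodm product_measure1E // lte_mul_pinfty // ge0_fin_numE.
Qed.

HB.instance Definition _ :=
  Measure_isSigmaFinite.Build _ _ _ prodm prodm_sigma_finite.

End product_sigma_finite.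

Section matrix_measures.
Variable R : realType.
Local Open Scope ereal_scope.

Lemma measurable_fun_entry d (T : measurableType d) m n (f : T -> 'M[R]_(m, n)) i j :
  measurable_fun [set: T] f -> measurable_fun [set: T] (fun x => f x i j).
Proof.
by move=> mf; apply: (@measurableT_comp _ _ _ _ _ _ (fun M : 'M[R]_(m, n) => M i j));
  [exact: measurable_entry|].
Qed.

Lemma measurable_col_mx d (T : measurableType d) m1 m2 n
    (f : T -> 'M[R]_(m1, n)) (g : T -> 'M[R]_(m2, n)) :
  measurable_fun [set: T] f -> measurable_fun [set: T] g ->
  measurable_fun [set: T] (fun x => col_mx (f x) (g x)).
Proof.
move=> mf mg; apply: measurable_mxP => i j.
case: (split_ordP i) => k ->.
  by under eq_fun do rewrite col_mxEu; exact: measurable_fun_entry.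
by under eq_fun do rewrite col_mxEd; exact: measurable_fun_entry.
Qed.

Lemma measurable_row_mx d (T : measurableType d) m n1 n2
    (f : T -> 'M[R]_(m, n1)) (g : T -> 'M[R]_(m, n2)) :
  measurable_fun [set: T] f -> measurable_fun [set: T] g ->
  measurable_fun [set: T] (fun x => row_mx (f x) (g x)).
Proof.
move=> mf mg; apply: measurable_mxP => i j.
case: (split_ordP j) => k ->.
  by under eq_fun do rewrite row_mxEl; exact: measurable_fun_entry.
by under eq_fun do rewrite row_mxEr; exact: measurable_fun_entry.
Qed.

Lemma measurable_trmx d (T : measurableType d) m n (f : T -> 'M[R]_(m, n)) :
  measurable_fun [set: T] f -> measurable_fun [set: T] (fun x => (f x)^T)%R.
Proof.
move=> mf; apply: measurable_mxP => i j.
by under eq_fun do rewrite mxE; exact: measurable_fun_entry.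
Qed.

Lemma measurable_scalar_mx d (T : measurableType d) n (f : T -> R) :
  measurable_fun [set: T] f -> measurable_fun [set: T] (fun x => (f x)%:M : 'M[R]_n)%R.
Proof.
move=> mf; apply: measurable_mxP => i j; under eq_fun do rewrite !mxE.
by case: (i == j) => /=; [exact: mf | exact: measurable_cst].
Qed.

Lemma measurable_block_mx d (T : measurableType d) m1 m2 n1 n2
    (f11 : T -> 'M[R]_(m1, n1)) (f12 : T -> 'M[R]_(m1, n2))
    (f21 : T -> 'M[R]_(m2, n1)) (f22 : T -> 'M[R]_(m2, n2)) :
  measurable_fun [set: T] f11 -> measurable_fun [set: T] f12 ->
  measurable_fun [set: T] f21 -> measurable_fun [set: T] f22 ->
  measurable_fun [set: T] (fun x => block_mx (f11 x) (f12 x) (f21 x) (f22 x)).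
Proof. by move=> *; apply: measurable_col_mx; exact: measurable_row_mx. Qed.

Lemma measurable_mulmx d (T : measurableType d) m n p
    (f : T -> 'M[R]_(m, n)) (g : T -> 'M[R]_(n, p)) :
  measurable_fun [set: T] f -> measurable_fun [set: T] g ->
  measurable_fun [set: T] (fun x => f x *m g x)%R.
Proof.
move=> mf mg; apply: measurable_mxP => i j; under eq_fun do rewrite mxE.
by apply: measurable_sum => k; apply: measurable_funM; exact: measurable_fun_entry.
Qed.

Lemma measurable_addmx d (T : measurableType d) m n
    (f g : T -> 'M[R]_(m, n)) :
  measurable_fun [set: T] f -> measurable_fun [set: T] g ->
  measurable_fun [set: T] (fun x => f x + g x)%R.
Proof.
move=> mf mg; apply: measurable_mxP => i j; under eq_fun do rewrite mxE.
by apply: measurable_funD; exact: measurable_fun_entry.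
Qed.

Lemma measurable_oppmx d (T : measurableType d) m n (f : T -> 'M[R]_(m, n)) :
  measurable_fun [set: T] f -> measurable_fun [set: T] (fun x => - f x)%R.
Proof.
move=> mf; apply: measurable_mxP => i j; under eq_fun do rewrite !mxE.
by apply: measurableT_comp => //; exact: measurable_fun_entry.
Qed.

Lemma measurable_scalemx d (T : measurableType d) m n (c : T -> R)
    (f : T -> 'M[R]_(m, n)) :
  measurable_fun [set: T] c ->
  measurable_fun [set: T] f -> measurable_fun [set: T] (fun x => c x *: f x)%R.
Proof.
move=> mc mf; apply: measurable_mxP => i j; under eq_fun do rewrite mxE.
by apply: measurable_funM => //; exact: measurable_fun_entry.
Qed.

Lemma measurable_det d (T : measurableType d) n (f : T -> 'M[R]_n) :
  measurable_fun [set: T] f -> measurable_fun [set: T] (fun x => \det (f x))%R.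
Proof.
move=> mf; rewrite /determinant; apply: measurable_sum => s.
apply: measurable_funM => //; apply: measurable_prod => i _.
exact: measurable_fun_entry.
Qed.

Lemma measurable_mxtrace d (T : measurableType d) n (f : T -> 'M[R]_n) :
  measurable_fun [set: T] f -> measurable_fun [set: T] (fun x => \tr (f x))%R.
Proof.
by move=> mf; rewrite /mxtrace; apply: measurable_sum => i; exact: measurable_fun_entry.
Qed.

Section cons.
Variable n : nat.
Let X := (measurableTypeR R * 'cV[R]_n)%type.

Definition consv (p : X) : 'cV[R]_(1 + n) := col_mx (p.1)%:M p.2.
Definition unconsv (y : 'cV[R]_(1 + n)) : X := (y 0%R 0%R, dsubmx y).

Lemma measurable_consv : measurable_fun [set: X] consv.
Proof.
apply: measurable_col_mx; last exact: measurable_snd.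
by apply: measurable_scalar_mx; exact: measurable_fst.
Qed.

Lemma measurable_unconsv : measurable_fun [set: 'cV[R]_(1 + n)] unconsv.
Proof.
apply: measurable_fun_pair; first exact: measurable_entry.
by apply: measurable_mxP => i j; under eq_fun do rewrite mxE; exact: measurable_entry.
Qed.

Lemma consvK : cancel consv unconsv.
Proof.
move=> [x y]; rewrite /unconsv /consv /= col_mxKd.
by rewrite mxE; case: splitP => // j _; rewrite ord1 mxE.
Qed.

Let Y := (measurableTypeR R * ('cV[R]_n * 'M[R]_n))%type.

Definition consm (p : Y) : 'M[R]_(1 + n) := block_mx (p.1)%:M (p.2.1)^T p.2.1 p.2.2.
Definition unconsm (M : 'M[R]_(1 + n)) : Y := (M 0%R 0%R, (dlsubmx M, drsubmx M)).

Lemma measurable_consm : measurable_fun [set: Y] consm.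
Proof.
have m2 : measurable_fun [set: Y] (fun p => p.2.1).
  by apply: (@measurableT_comp _ _ _ _ _ _ fst) => //; exact: measurable_snd.
apply: measurable_block_mx => //.
- by apply: measurable_scalar_mx; exact: measurable_fst.
- exact: measurable_trmx.
- by apply: (@measurableT_comp _ _ _ _ _ _ snd) => //; exact: measurable_snd.
Qed.

Lemma measurable_unconsm : measurable_fun [set: 'M[R]_(1 + n)] unconsm.
Proof.
apply: measurable_fun_pair; first exact: measurable_entry.
apply: measurable_fun_pair; apply: measurable_mxP => i j;
  under eq_fun do rewrite !mxE; exact: measurable_entry.
Qed.

Lemma consmK : cancel consm unconsm.
Proof.
move=> [x [y A]]; rewrite /unconsm /consm /= block_mxKdl block_mxKdr.
by congr pair; rewrite mxE; case: splitP => // j _; rewrite mxE; case: splitP => // k _; rewrite !ord1 mxE.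
Qed.

End cons.

Definition vecm_cons n (m : {sigma_finite_measure set 'cV[R]_n -> \bar R}) :
    {sigma_finite_measure set 'cV[R]_(1 + n) -> \bar R} :=
  pushm (prodm lebesgue_measure m)
     (@measurable_consv n) (@measurable_unconsv n) (@consvK n).

Definition symm_cons n (m : {sigma_finite_measure set 'cV[R]_n -> \bar R})
    (s : {sigma_finite_measure set 'M[R]_n -> \bar R}) :
    {sigma_finite_measure set 'M[R]_(1 + n) -> \bar R} :=
  pushm (prodm lebesgue_measure (prodm m s))
     (@measurable_consm n) (@measurable_unconsm n) (@consmK n).

Fixpoint vecm n : {sigma_finite_measure set 'cV[R]_n -> \bar R} :=
  match n with
  | 0 => dirac (0%R : 'cV[R]_0)
  | n'.+1 => vecm_cons (vecm n')
  end.

(** Lebesgue measure in the [n (n + 1) / 2] free entries of a symmetric matrix, as a measure on all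
    of ['M_n] that is carried by the symmetric matrices. *)
Fixpoint symm n : {sigma_finite_measure set 'M[R]_n -> \bar R} :=
  match n with
  | 0 => dirac (0%R : 'M[R]_0)
  | n'.+1 => symm_cons (vecm n') (symm n')
  end.

Lemma integral_vecm0 (f : 'cV[R]_0 -> \bar R) : (forall y, 0 <= f y) ->
  \int[vecm 0]_y f y = f 0%R.
Proof.
move=> f0; rewrite /= integral_dirac ?diracT ?mul1e //.
apply: (eq_measurable_fun (cst (f 0%R))) => // x _.
by rewrite (_ : x = 0%R) //; apply/matrixP => -[].
Qed.

Lemma integral_vecmS n (f : 'cV[R]_(1 + n) -> \bar R) :
  measurable_fun [set: 'cV[R]_(1 + n)] f -> (forall y, 0 <= f y) ->
  \int[vecm n.+1]_y f y =
  \int[lebesgue_measure]_x \int[vecm n]_y f (col_mx x%:M y).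
Proof.
move=> mf f0; rewrite [LHS]ge0_integral_pushm // fubini_tonelli1 //.
by apply: measurableT_comp => //; exact: measurable_consv.
Qed.

Lemma integral_symm0 (f : 'M[R]_0 -> \bar R) : (forall y, 0 <= f y) ->
  \int[symm 0]_y f y = f 0%R.
Proof.
move=> f0; rewrite /= integral_dirac ?diracT ?mul1e //.
apply: (eq_measurable_fun (cst (f 0%R))) => // x _.
by rewrite (_ : x = 0%R) //; apply/matrixP => -[].
Qed.

Lemma integral_symmS n (f : 'M[R]_(1 + n) -> \bar R) :
  measurable_fun [set: 'M[R]_(1 + n)] f -> (forall y, 0 <= f y) ->
  \int[symm n.+1]_y f y =
  \int[lebesgue_measure]_x \int[vecm n]_v \int[symm n]_A f (block_mx x%:M v^T v A).
Proof.
move=> mf f0; rewrite [LHS]ge0_integral_pushm // fubini_tonelli1 //; last first.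
  by apply: measurableT_comp => //; exact: measurable_consm.
apply: eq_integral => x _; rewrite /fubini_F fubini_tonelli1 //.
apply: measurableT_comp => //.
apply: (@measurableT_comp _ _ _ _ _ _ (@consm n) _ (fun p => (x, p))).
  exact: measurable_consm.
by apply: measurable_fun_pair => //; exact: measurable_cst.
Qed.

End matrix_measures.

(** * Changes of variables *)

Section tonelli.
Local Open Scope ereal_scope.
Context d d' (X : measurableType d) (Y : measurableType d') (R : realType).
Variables (m1 : {sigma_finite_measure set X -> \bar R})
  (m2 : {sigma_finite_measure set Y -> \bar R}) (f : X -> Y -> \bar R).
Hypotheses (mf : measurable_fun [set: X * Y] (fun z => f z.1 z.2))
  (f0 : forall x y, 0 <= f x y).

Lemma tonelli_swap :
  \int[m1]_x \int[m2]_y f x y = \int[m2]_y \int[m1]_x f x y.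
Proof. by rewrite (fubini_tonelli (fun z => f z.1 z.2)). Qed.

Lemma measurable_integral_param : measurable_fun [set: X] (fun x => \int[m2]_y f x y).
Proof. by apply: (measurable_fun_fubini_tonelli_F (fun z => f z.1 z.2)). Qed.

End tonelli.
Arguments tonelli_swap {d d' X Y R} m1 m2 f.
Arguments measurable_integral_param {d d' X Y R} m2 f.

Section layer_cake.
Local Open Scope ereal_scope.
Context (R : realType).

Lemma measurable_under_graph d (Y : measurableType d) (g : Y -> \bar R) :
  measurable_fun [set: Y] g ->
  measurable [set z : Y * measurableTypeR R | (0 <= z.2)%R /\ z.2%:E < g z.1].
Proof.
move=> mg.
have -> : [set z : Y * measurableTypeR R | (0 <= z.2)%R /\ z.2%:E < g z.1] =
    [set z | 0 <= z.2%:E] `&` [set z | 0 < g z.1 - z.2%:E].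
  apply/seteqP; split=> -[y t] [t0 tg]; split; rewrite /mkset ?lee_fin ?sube_gt0 //.
  by move: tg; rewrite /mkset sube_gt0.
have m2 : measurable_fun [set: Y * measurableTypeR R] (fun z => z.2%:E).
  by apply/measurable_EFinP; exact: measurable_snd.
have m1 : measurable_fun [set: Y * measurableTypeR R] (fun z => g z.1).
  by apply: measurableT_comp => //; exact: measurable_fst.
apply: measurableI.
  rewrite -[X in measurable X]setTI.
  by apply: emeasurable_fun_c_infty.
rewrite -[X in measurable X]setTI.
by apply: emeasurable_fun_o_infty => //; apply: emeasurable_funB.
Qed.

Lemma integral_layer_cake (r : \bar R) : 0 <= r ->
  \int[@lebesgue_measure R]_t (\1_[set t : measurableTypeR R | (0 <= t)%R /\ ((t : R)%:E < r)%E] t)%:E = r.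
Proof.
case: r => [r| |]//.
- rewrite lee_fin => r0.
  have -> : [set t : measurableTypeR R | (0 <= t)%R /\ (t : R)%:E < r%:E] = [set` `[0, r[%R].
    by apply/seteqP; split=> t /=; rewrite in_itv /= ?lte_fin; [move=> [-> ->]|move/andP].
  by rewrite integral_indic //= setIT lebesgue_measure_itv /= lte_fin; case: ltgtP r0 => //= [_ _|<-]; rewrite ?sube0.
- move=> _.
  have -> : [set t : measurableTypeR R | (0 <= t)%R /\ (t : R)%:E < +oo] = [set` `[0%R, +oo[].
    by apply/seteqP; split=> t /=; rewrite in_itv /= andbT ?ltry; [move=> [-> ]|].
  by rewrite integral_indic //= setIT lebesgue_measure_itv /= ltry.
Qed.

(* Layer cake: [g] is the integral over [t] of the indicators of [t < g]. *)
Lemma ge0_integral_weighted_transfer d d' (X : measurableType d) (Y : measurableType d')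
    (m1 : {sigma_finite_measure set X -> \bar R})
    (m2 : {sigma_finite_measure set Y -> \bar R})
    (w : X -> \bar R) (phi : X -> Y) (g : Y -> \bar R) :
  measurable_fun [set: X] w -> (forall x, 0 <= w x) ->
  measurable_fun [set: X] phi ->
  (forall E, measurable E -> \int[m1]_x (w x * (\1_E (phi x))%:E) = m2 E) ->
  measurable_fun [set: Y] g -> (forall y, 0 <= g y) ->
  \int[m1]_x (w x * g (phi x)) = \int[m2]_y g y.
Proof.
move=> mw w0 mphi E12 mg g0.
pose H := [set z : Y * measurableTypeR R | (0 <= z.2)%R /\ z.2%:E < g z.1].
have mH : measurable H by exact: measurable_under_graph.
have gE y : g y = \int[lebesgue_measure]_t (\1_H (y, t))%:E.
  by rewrite -[LHS]integral_layer_cake.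
have mHt t : measurable [set y | H (y, t)].
  have -> : [set y | H (y, t)] = ysection H t.
    by apply/seteqP; split => y; rewrite /ysection /= inE.
  exact: measurable_ysection.
have mI : measurable_fun [set: Y * measurableTypeR R] (fun z => \1_H z : R).
  exact: measurable_indic.
have m1H y : measurable_fun [set: measurableTypeR R] (fun t => (\1_H (y, t) : R)%:E).
  apply/measurable_EFinP; apply: (measurableT_comp mI).
  by apply: measurable_fun_pair.
transitivity (\int[m1]_x \int[lebesgue_measure]_t (w x * (\1_H (phi x, t))%:E)).
  apply: eq_integral => x _; rewrite [in LHS]gE ge0_integralZl //.
rewrite (tonelli_swap m1 (@lebesgue_measure R) _); last 2 first.
- apply: emeasurable_funM; first by apply: measurableT_comp => //; exact: measurable_fst.
  apply/measurable_EFinP; apply: (measurableT_comp mI).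
  apply: measurable_fun_pair; last exact: measurable_snd.
  by apply: measurableT_comp => //; exact: measurable_fst.
- by move=> x t; apply: mule_ge0; rewrite ?lee_fin.
transitivity (\int[lebesgue_measure]_t \int[m2]_y (\1_H (y, t))%:E).
  apply: eq_integral => t _.
  transitivity (\int[m1]_x (w x * (\1_[set y | H (y, t)] (phi x))%:E)).
    by [].
  rewrite E12 // -[in LHS](setIT [set y | H (y, t)]) -integral_indic //.
rewrite -(tonelli_swap m2 (@lebesgue_measure R) _); last 2 first.
- apply/measurable_EFinP; apply: (measurableT_comp mI).
  by apply: measurable_fun_pair; [exact: measurable_fst|exact: measurable_snd].
- by move=> x t; rewrite lee_fin.
by apply: eq_integral => y _; rewrite gE.
Qed.

End layer_cake.

Section density_measure.
Local Open Scope ereal_scope.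
Context d (T : measurableType d) (R : realType).
Variables (mu : {measure set T -> \bar R}) (w : T -> \bar R).
Hypotheses (mw : measurable_fun [set: T] w) (w0 : forall x, 0 <= w x).

Definition densm of measurable_fun [set: T] w & (forall x, 0 <= w x) :=
  fun A => \int[mu]_(x in A) w x.

Let densm0 : densm mw w0 set0 = 0. Proof. by rewrite /densm integral_set0. Qed.
Let densm_ge0 A : 0 <= densm mw w0 A. Proof. exact: integral_ge0. Qed.
Let densm_additive : semi_sigma_additive (densm mw w0).
Proof. exact: semi_sigma_additive_nng_induced. Qed.

HB.instance Definition _ := isMeasure.Build _ _ _ (densm mw w0)
  densm0 densm_ge0 densm_additive.

End density_measure.

Section substitution.
Context (R : realType) (U : set R) (h dh : R -> R).
Hypotheses (oU : open U) (iU : is_interval U).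
Hypothesis (dhE : forall x, U x -> is_derive x 1 h (dh x)).
Hypothesis (dh_cont : forall x, U x -> {for x, continuous dh}).
Hypothesis (dh_ge0 : forall x, U x -> 0 <= dh x).
Hypothesis (h_incr : forall x y, U x -> U y -> x < y -> h x < h y).
Hypothesis (h_surj : forall y, exists2 x, U x & h x = y).

Let mU : measurable U. Proof. exact: open_measurable. Qed.

(** Outside [U] the weight [w] below vanishes, so the default value 0 of [phi] there carries no
    mass. *)
Let phi : R -> measurableTypeR R := h \_ U.
Let w : measurableTypeR R -> \bar R := fun x => ((dh \_ U) x)%:E.

Let h_cont x : U x -> {for x, continuous h}.
Proof.
move=> Ux; apply: differentiable_continuous; apply/derivable1_diffP.
by have := dhE Ux; case.
Qed.

Let mphi : measurable_fun [set: measurableTypeR R] phi.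
Proof.
apply/(measurable_restrictT _ _).1 => //.
apply: open_continuous_measurable_fun => // x /[!inE] Ux.
exact: h_cont.
Qed.

Let mdh : measurable_fun U dh.
Proof.
apply: open_continuous_measurable_fun => // x /[!inE] Ux.
exact: dh_cont.
Qed.

Let mw : measurable_fun [set: measurableTypeR R] w.
Proof.
by apply/measurable_EFinP; apply/(measurable_restrictT _ _).1.
Qed.

Let w_ge0 x : (0 <= w x)%E.
Proof.
rewrite /w lee_fin patchE; case: ifPn => // /[!inE] Ux; exact: dh_ge0.
Qed.

Let nu : {measure set (measurableTypeR R) -> \bar R} :=
  measure_function_pushforward__canonical__measure_function_Measure
    [the {measure set (measurableTypeR R) -> \bar R} of densm lebesgue_measure mw w_ge0] mphi.

Let nuE (E : set (measurableTypeR R)) : measurable E ->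
  nu E = (\int[lebesgue_measure]_x (w x * (\1_E (phi x))%:E))%E.
Proof.
move=> mE; rewrite /nu /= /pushforward /densm integral_mkcond.
apply: eq_integral => x _; rewrite patchE indicE.
have [H|H] := pselect (E (phi x)); first by rewrite !mem_set // mule1.
by rewrite !memNset // mule0.
Qed.

Let nu_itv (a b : R) : nu [set` `]a, b]] = lebesgue_measure [set` `]a, b]].
Proof.
rewrite lebesgue_measure_itv /= lte_fin.
case: ltP => [ab|ba]; last first.
  by rewrite (_ : [set` `]a, b]] = set0) ?measure0 // set_itv_ge // bnd_simp -leNgt.
have [al Ua ha] := h_surj a; have [be Ub hb] := h_surj b.
have albe : al < be.
  case: (ltgtP al be) => // [ba|ba].
    by have := h_incr Ub Ua ba; rewrite ha hb ltNge (ltW ab).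
  by move: ab; rewrite -ha -hb ba ltxx.
have itvU x : al <= x <= be -> U x by move=> xab; apply: (iU Ua Ub).
have -> : nu [set` `]a, b]] = (\int[lebesgue_measure]_(x in `]al, be]) (dh x)%:E)%E.
  rewrite /nu /= /pushforward /densm integral_mkcond [RHS]integral_mkcond.
  apply: eq_integral => x _; rewrite !patchE /w patchE.
  have [xU|xU] := boolP (x \in U); last first.
    rewrite if_same; case: ifPn => //; rewrite inE /= in_itv /= => /andP[x1 x2].
    by exfalso; move/negP: xU; apply; rewrite inE; apply: itvU; rewrite ltW.
  congr (if _ then _ else _).
  apply/idP/idP; rewrite !inE /= /phi patchE xU !in_itv /= -ha -hb => /andP[x1 x2].
    apply/andP; split.
      by rewrite ltNge; apply: contraTN x1; rewrite le_eqVlt -leNgt => /predU1P[->//|xa];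
        apply/ltW/h_incr => //; rewrite -inE.
    by rewrite leNgt; apply: contraTN x2 => xb; rewrite -ltNge; apply: h_incr => //; rewrite -inE.
  rewrite h_incr //=; last by rewrite -inE.
  by move: x2; rewrite le_eqVlt => /predU1P[->//|xb]; apply/ltW/h_incr => //; rewrite -inE.
have -> : (\int[lebesgue_measure]_(x in `]al, be]) (dh x)%:E =
           \int[lebesgue_measure]_(x in `[al, be]) (dh x)%:E)%E.
  apply: integral_itv_obnd_cbnd.
  apply: (measurable_funS mU).
    by move=> x /=; rewrite in_itv /= => /andP[x1 x2]; apply: itvU; rewrite (ltW x1) (ltW x2) || rewrite (ltW x1) x2.
  exact/measurable_EFinP.
rewrite (@continuous_FTC2 _ dh h) ?ha ?hb //.
- apply: continuous_in_subspaceT => x /[!inE] /=; rewrite in_itv /= => /itvU.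
  exact: dh_cont.
- split.
  + move=> x; rewrite in_itv /= => /andP[x1 x2].
    have Ux : U x by apply: itvU; rewrite !ltW.
    by have := dhE Ux; case.
  + exact/cvg_at_right_filter/h_cont.
  + exact/cvg_at_left_filter/h_cont.
- move=> x; rewrite in_itv /= => /andP[x1 x2].
  have Ux : U x by apply: itvU; rewrite !ltW.
  by rewrite derive1E; have := dhE Ux; case.
Qed.

(** The image under [h] of the measure [dh x dx] on [U] gives every half-open interval its length,
    by the fundamental theorem of calculus, and is therefore Lebesgue measure. Surjectivity of [h]
    provides preimages of both endpoints of any interval. *)
Lemma ge0_integral_substitution (g : R -> \bar R) :
  measurable_fun [set: R] g -> (forall y, 0 <= g y)%E ->
  (\int[lebesgue_measure]_y g y =
   \int[lebesgue_measure]_(x in U) ((dh x)%:E * g (h x)))%E.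
Proof.
move=> mg g0; rewrite [RHS]integral_mkcond.
transitivity (\int[lebesgue_measure]_x (w x * g (phi x)))%E; last first.
  apply: eq_integral => x _; rewrite /w /phi !patchE; case: ifPn => //.
  by rewrite mul0e.
apply/esym; apply: ge0_integral_weighted_transfer => //.
move=> E mE; rewrite -nuE //; apply/esym/lebesgue_measure_unique => // X [[a b] _ <-] /=.
exact/esym/nu_itv.
Qed.

End substitution.

Section affine_change.
Context (R : realType).

Lemma ge0_integral_opp (g : R -> \bar R) :
  measurable_fun [set: R] g -> (forall y, 0 <= g y)%E ->
  (\int[lebesgue_measure]_y g y = \int[lebesgue_measure]_x g (- x)%R)%E.
Proof.
move=> mg g0.
transitivity (\int[lebesgue_measure]_(x in [set: R]) (1 * g (- x)%R))%E; last first.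
  by under eq_integral do rewrite mul1e.
apply/esym; apply: (@ge0_integral_weighted_transfer R _ _ _ _ lebesgue_measure
  lebesgue_measure (cst 1%E) (-%R : R -> measurableTypeR R) g) => //.
move=> E mE.
transitivity (pushforward lebesgue_measure (-%R : _ -> measurableTypeR R) E);
  last exact: lebesgue_measureN.
under eq_integral do rewrite mul1e.
have mE' : measurable ((-%R : _ -> measurableTypeR R) @^-1` E).
  by rewrite -[X in measurable X]setTI; exact: oppr_measurable.
by rewrite /pushforward -[in RHS](setIT (_ @^-1` E)) -integral_indic.
Qed.

Lemma ge0_integral_affine (c b : R) (g : R -> \bar R) : c != 0 ->
  measurable_fun [set: R] g -> (forall y, 0 <= g y)%E ->
  (\int[lebesgue_measure]_y g y =
   `|c|%:E * \int[lebesgue_measure]_x g (c * x + b)%R)%E.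
Proof.
have pos (a b' : R) (f : R -> \bar R) : 0 < a ->
  measurable_fun [set: R] f -> (forall y, 0 <= f y)%E ->
  (\int[lebesgue_measure]_y f y =
   a%:E * \int[lebesgue_measure]_x f (a * x + b')%R)%E.
  move=> a0 mf f0.
  have dE (x : R) : [set: R] x -> is_derive x 1 (fun x => a * x + b') ((cst a) x).
    move=> _; have -> : (fun x => a * x + b') = ((a \*: @id R) + cst b').
      by apply/funext => z.
    by apply: is_derive_eq; rewrite addr0 [LHS]mulr1.
  rewrite (ge0_integral_substitution openT _ dE) //.
  - rewrite /cst ge0_integralZl //; last by rewrite lee_fin ltW.
    apply: measurableT_comp => //; apply: measurable_funD => //.
  - by move=> x _; exact: cvg_cst.
  - by move=> x _; exact: ltW.
  - by move=> x y _ _ xy; rewrite ltrD2r ltr_pM2l.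
  - move=> y; exists ((y - b') / a) => //.
    by rewrite mulrC divfK ?subrK // gt_eqF.
move=> c0 mg g0; case: (ltgtP c 0) c0 => // c0 _; last by rewrite (gtr0_norm c0); exact: pos.
rewrite (ltr0_norm c0).
rewrite (ge0_integral_opp mg g0) (pos (- c) (- b)) //; last 2 first.
- by rewrite oppr_gt0.
- exact: measurableT_comp.
congr (_ * _)%E; apply: eq_integral => x _; congr (g _).
by rewrite mulNr opprD !opprK.
Qed.

Lemma ge0_integral_translate (b : R) (g : R -> \bar R) :
  measurable_fun [set: R] g -> (forall y, 0 <= g y)%E ->
  (\int[lebesgue_measure]_y g y = \int[lebesgue_measure]_x g (x + b)%R)%E.
Proof.
move=> mg g0; rewrite (@ge0_integral_affine 1 b) ?oner_eq0 // normr1 mul1e.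
by apply: eq_integral => x _; rewrite mul1r.
Qed.

End affine_change.

Lemma measurable_EFin_fun d (T : measurableType d) (R : realType) (f : T -> R) :
  measurable_fun [set: T] f -> measurable_fun [set: T] (fun x => (f x)%:E).
Proof. by move=> mf; apply/measurable_EFinP. Qed.

Lemma measurable_norm_fun d (T : measurableType d) (R : realType) (f : T -> R) :
  measurable_fun [set: T] f -> measurable_fun [set: T] (fun x => `|f x|).
Proof. by move=> mf; apply: measurableT_comp. Qed.

Ltac measurable_mx := repeat first
  [ assumption | exact: measurable_cst | exact: measurable_id
  | exact: measurable_fst | exact: measurable_snd | exact: measurable_entry
  | apply: measurable_block_mx | apply: measurable_col_mx | apply: measurable_row_mx
  | apply: measurable_scalar_mx | apply: measurable_trmx | apply: measurable_fun_pair
  | apply: measurable_mulmx | apply: measurable_addmx | apply: measurable_oppmx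
  | apply: measurable_scalemx | apply: measurable_det | apply: measurable_mxtrace
  | apply: measurable_fun_entry
  | apply: emeasurable_funM | apply: measurable_funM | apply: measurable_funD
  | apply: measurable_funB | apply: measurable_EFin_fun | apply: measurable_norm_fun
  | apply: (measurableT_comp (f := fst)) | apply: (measurableT_comp (f := snd))].

Section vector_change.
Variable R : realType.
Local Open Scope ereal_scope.

Lemma cV0_eq n (x y : 'cV[R]_n) : n = 0%N -> x = y.
Proof. by move=> n0; apply/matrixP => -[i i0]; exfalso; rewrite n0 in i0. Qed.

Lemma col_mx_decomp n (b : 'cV[R]_(1 + n)) : b = col_mx (b 0%R 0%R)%:M (dsubmx b).
Proof.
rewrite -[LHS]vsubmxK; congr col_mx; apply/matrixP => i j.
by rewrite !mxE !ord1 eqxx mulr1n; congr (b _ _); apply/val_inj.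
Qed.

Lemma integral_vecm_translate n (b : 'cV[R]_n) (g : 'cV[R]_n -> \bar R) :
  measurable_fun [set: 'cV[R]_n] g -> (forall y, 0 <= g y) ->
  \int[vecm R n]_y g y = \int[vecm R n]_y g (y + b)%R.
Proof.
elim: n b g => [|n IH] b g mg g0.
  by apply: eq_integral => y _; congr g; exact: cV0_eq.
move: b g mg g0; rewrite -[n.+1]/(1 + n)%N => b g mg g0.
have mgb : measurable_fun [set: 'cV[R]_(1 + n)] (fun y : 'cV[R]_(1 + n) => g (y + b)%R).
  by apply: (measurableT_comp mg); measurable_mx.
rewrite [LHS](integral_vecmS mg g0) (integral_vecmS mgb (fun _ => g0 _)).
have mcol : measurable_fun [set: measurableTypeR R * 'cV[R]_n]
    (fun z => g (col_mx z.1%:M z.2)).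
  by apply: (measurableT_comp mg); measurable_mx.
rewrite (ge0_integral_translate (b 0%R 0%R)); last 2 first.
- exact: (measurable_integral_param _ (fun (x : measurableTypeR R) (y : 'cV[R]_n) => g (col_mx x%:M y)) mcol (fun _ _ => g0 _)).
- by move=> x; exact: integral_ge0.
apply: eq_integral => x _.
rewrite (IH (dsubmx b)) //; last first.
  by apply: (measurableT_comp mg); measurable_mx.
apply: eq_integral => y _; congr g.
by rewrite [in RHS](col_mx_decomp b) add_col_mx -raddfD.
Qed.

(** The property is closed under products, so invertible matrices can be treated through triangular
    factors. *)
Definition vec_change n (P : 'M[R]_n) := forall g : 'cV[R]_n -> \bar R,
  measurable_fun [set: 'cV[R]_n] g -> (forall y, 0 <= g y) ->
  \int[vecm R n]_y g y = `|\det P|%:E * \int[vecm R n]_y g (P *m y)%R.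

Lemma vec_changeM n (P Q : 'M[R]_n) :
  vec_change P -> vec_change Q -> vec_change (P *m Q).
Proof.
move=> hP hQ g mg g0; rewrite hP // hQ //; last first.
  by apply: (measurableT_comp mg); measurable_mx.
rewrite det_mulmx normrM EFinM muleA; congr (_ * _).
by apply: eq_integral => y _; rewrite mulmxA.
Qed.

(** For fixed [y] the first coordinate is affine in [x] with slope [d]; Tonelli makes [x] the inner
    variable, and [P] then acts on [y] alone. *)
Lemma vec_change_upper n (d : R) (u : 'rV[R]_n) (P : 'M[R]_n) : d != 0%R ->
  vec_change P -> vec_change (block_mx d%:M u 0 P : 'M[R]_(1 + n)).
Proof.
move=> d0 hP g mg g0.
rewrite det_ublock det_scalar1 normrM.
have mgP : measurable_fun [set: 'cV[R]_(1 + n)]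
    (fun y : 'cV[R]_(1 + n) => g (block_mx d%:M u 0 P *m y)%R).
  by apply: (measurableT_comp mg); measurable_mx.
rewrite [LHS](integral_vecmS mg g0) (integral_vecmS mgP (fun _ => g0 _)).
have mcol : measurable_fun [set: measurableTypeR R * 'cV[R]_n]
    (fun z => g (col_mx z.1%:M z.2)).
  by apply: (measurableT_comp mg); measurable_mx.
rewrite (tonelli_swap lebesgue_measure (vecm R n) (fun (x : measurableTypeR R) (y : 'cV[R]_n) => g (col_mx x%:M y)) mcol) //.
rewrite (tonelli_swap lebesgue_measure (vecm R n) (fun (x : measurableTypeR R) (y : 'cV[R]_n) =>
  g (block_mx d%:M u 0 P *m col_mx x%:M y)%R)) //; last first.
  by apply: (measurableT_comp mg); measurable_mx.
have mcol' : measurable_fun [set: 'cV[R]_n * measurableTypeR R]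
    (fun z => g (col_mx z.2%:M z.1)).
  by apply: (measurableT_comp mg); measurable_mx.
rewrite hP; last 2 first.
- exact: (measurable_integral_param _ (fun (y : 'cV[R]_n) (x : measurableTypeR R) => g (col_mx x%:M y)) mcol' (fun _ _ => g0 _)).
- by move=> x; exact: integral_ge0.
rewrite mulrC EFinM -muleA; congr (_ * _).
rewrite -ge0_integralZl //; last 2 first.
- apply: (measurable_integral_param _ (fun (y : 'cV[R]_n) (x : measurableTypeR R) => g (block_mx d%:M u 0 P *m col_mx x%:M y)%R)) => //.
  by apply: (measurableT_comp mg); measurable_mx.
- by move=> y _; exact: integral_ge0.
apply: eq_integral => y _.
rewrite (@ge0_integral_affine R d ((u *m y)%R 0%R 0%R)) //; last first.
  by apply: (measurableT_comp mg); measurable_mx.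
congr (_ * _); apply: eq_integral => x _; congr g.
rewrite mul_block_col mul0mx add0r; congr col_mx.
by rewrite -scalar_mxM raddfD /= -mx11_scalar.
Qed.

Lemma vec_change_lower n (r : 'cV[R]_n) :
  vec_change (block_mx 1%:M 0 r 1%:M : 'M[R]_(1 + n)).
Proof.
move=> g mg g0.
rewrite det_lblock !det1 mulr1 normr1 mul1e.
have mgP : measurable_fun [set: 'cV[R]_(1 + n)]
    (fun y : 'cV[R]_(1 + n) => g (block_mx 1%:M 0 r 1%:M *m y)%R).
  by apply: (measurableT_comp mg); measurable_mx.
rewrite [LHS](integral_vecmS mg g0) (integral_vecmS mgP (fun _ => g0 _)).
apply: eq_integral => x _.
rewrite (integral_vecm_translate (x *: r)%R) //; last first.
  by apply: (measurableT_comp mg); measurable_mx.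
apply: eq_integral => y _; congr g.
by rewrite mul_block_col !mul1mx mul0mx addr0 mul_mx_scalar addrC.
Qed.

(** Gaussian elimination. With a nonzero corner [d] the matrix is a lower shear times an upper block
    matrix whose lower block is the Schur complement [S]; a zero corner is first repaired by a row
    operation. *)
Lemma vec_change_unit n (P : 'M[R]_n) : P \in unitmx -> vec_change P.
Proof.
elim: n P => [|n IH] P uP.
  move=> g mg g0; rewrite [P]flatmx0 det_mx00 normr1 mul1e.
  by apply: eq_integral => y _; congr g; exact: cV0_eq.
have nz (A : 'M[R]_(1 + n)) : A 0%R 0%R != 0%R -> A \in unitmx -> vec_change A.
  move=> d0 uA; set d := A 0%R 0%R in d0.
  have Ad : A = block_mx d%:M (ursubmx A) (dlsubmx A) (drsubmx A).
    rewrite -[LHS]submxK; congr block_mx; apply/matrixP => i j.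
    by rewrite !mxE !ord1 eqxx mulr1n; congr (A _ _); apply/val_inj.
  set S := (drsubmx A - d^-1 *: (dlsubmx A *m ursubmx A))%R.
  have AE : A = block_mx 1%:M 0 (d^-1 *: dlsubmx A)%R 1%:M *m block_mx d%:M (ursubmx A) 0 S.
    rewrite mulmx_block !(mul1mx, mul0mx, mulmx0, addr0) {1}Ad; congr block_mx.
      by rewrite mul_mx_scalar scalerA mulfV // scale1r.
    by rewrite /S -scalemxAl addrC subrK.
  rewrite AE; apply: vec_changeM; first exact: vec_change_lower.
  apply: vec_change_upper => //; apply: IH.
  move: uA; rewrite !unitmxE AE det_mulmx det_lblock !det1 mulr1 mul1r det_ublock.
  by rewrite unitrM => /andP[].
have [P0|] := eqVneq (P 0%R 0%R) 0%R; last by move=> ?; apply: nz.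
have [i Pi] : exists i, P (lift 0%R i) 0%R != 0%R.
  apply/existsP; rewrite -[X in is_true X]negbK negb_exists; apply/negP => /forallP Hi.
  move: uP; rewrite unitmxE (expand_det_col _ 0%R) big1 ?unitr0 // => j _.
  case: (unliftP 0%R j) => [k ->|->]; last by rewrite P0 mul0r.
  by have := Hi k; rewrite negbK => /eqP ->; rewrite mul0r.
(* [T s] adds [s] times row [i] of the lower block to the first row. [T 1] makes the corner nonzero
   and [T (-1)] undoes it. *)
pose T (s : R) : 'M[R]_(1 + n) := block_mx 1%:M (s *: delta_mx 0%R i)%R 0 1%:M.
have TT : T (-1)%R *m T 1%R = 1%:M.
  rewrite /T mulmx_block !(mul1mx, mulmx1, mul0mx, mulmx0, addr0, add0r).
  by rewrite scaleN1r scale1r subrr -scalar_mx_block.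
have uT s : T s \in unitmx by rewrite unitmxE det_ublock !det1 mulr1 unitr1.
rewrite -[P]mul1mx -TT -mulmxA; apply: vec_changeM.
  apply: vec_change_upper; first exact: oner_neq0.
  by apply: IH; rewrite unitmx1.
apply: nz; last by rewrite unitmx_mul uT.
have l0 : ord0 = lshift n (ord0 : 'I_1) :> 'I_(1 + n) by exact/val_inj.
rewrite mxE (@big_split_ord _ _ _ 1 n) /= big_ord1 (bigD1 i) //= big1.
  rewrite -l0 P0 mulr0 add0r addr0 [X in T _ X _]l0 /T block_mxEur !mxE !eqxx mulr1 mul1r.
  by rewrite (_ : rshift 1 i = lift 0%R i :> 'I_(1+n)) //; exact/val_inj.
by move=> j ji; rewrite [X in T _ X _]l0 /T block_mxEur !mxE (negbTE ji) andbF mulr0 mul0r.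
Qed.

End vector_change.

Section tonelli3.
Local Open Scope ereal_scope.
Context d1 d2 d3 (X : measurableType d1) (Y : measurableType d2) (Z : measurableType d3).
Context (R : realType).
Variables (m1 : {sigma_finite_measure set X -> \bar R})
  (m2 : {sigma_finite_measure set Y -> \bar R})
  (m3 : {sigma_finite_measure set Z -> \bar R}) (F : X -> Y -> Z -> \bar R).
Hypotheses (mF : measurable_fun [set: X * (Y * Z)] (fun w => F w.1 w.2.1 w.2.2))
  (F0 : forall x y z, 0 <= F x y z).

Let comp3 d (T : measurableType d) (a : T -> X) (b : T -> Y) (c : T -> Z) :
  measurable_fun [set: T] a -> measurable_fun [set: T] b -> measurable_fun [set: T] c ->
  measurable_fun [set: T] (fun t => F (a t) (b t) (c t)).
Proof.
move=> ma mb mc.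
apply: (measurableT_comp mF (g := fun t => (a t, (b t, c t)))).
by apply: measurable_fun_pair => //; exact: measurable_fun_pair.
Qed.

Lemma tonelli_rev3 :
  \int[m1]_x \int[m2]_y \int[m3]_z F x y z = \int[m3]_z \int[m2]_y \int[m1]_x F x y z.
Proof.
transitivity (\int[m1]_x \int[m3]_z \int[m2]_y F x y z).
  apply: eq_integral => x _; apply: tonelli_swap => //.
  by apply: comp3; measurable_mx.
rewrite (tonelli_swap m1 m3 (fun x z => \int[m2]_y F x y z)); last 2 first.
- apply: (measurable_integral_param m2 (fun (w : X * Z) y => F w.1 y w.2)) => //.
  by apply: comp3; measurable_mx.
- by move=> x y; exact: integral_ge0.
apply: eq_integral => z _; apply: tonelli_swap => //.
by apply: comp3; measurable_mx.
Qed.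

End tonelli3.

Section symmetric_change.
Variable R : realType.
Local Open Scope ereal_scope.

Lemma measurable_block_sym n (g : 'M[R]_(1 + n) -> \bar R) :
  measurable_fun [set: 'M[R]_(1 + n)] g ->
  measurable_fun [set: measurableTypeR R * ('cV[R]_n * 'M[R]_n)]
    (fun w => g (block_mx w.1%:M (w.2.1)^T w.2.1 w.2.2)).
Proof. by move=> mg; apply: (measurableT_comp mg); measurable_mx. Qed.

Lemma integral_symmS_rev n (f : 'M[R]_(1 + n) -> \bar R) :
  measurable_fun [set: 'M[R]_(1 + n)] f -> (forall y, 0 <= f y) ->
  \int[symm R n.+1]_M f M =
  \int[symm R n]_A \int[vecm R n]_v \int[lebesgue_measure]_x f (block_mx x%:M v^T v A).
Proof.
move=> mf f0; rewrite (integral_symmS mf f0).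
exact: (tonelli_rev3 lebesgue_measure (vecm R n) (symm R n) (measurable_block_sym mf)).
Qed.

(** Each layer of [symm] places [v] and its transpose symmetrically, so induction along the blocks
    reaches symmetric matrices only. *)
Lemma eq_integral_symm n (f g : 'M[R]_n -> \bar R) :
  measurable_fun [set: 'M[R]_n] f -> measurable_fun [set: 'M[R]_n] g ->
  (forall A, 0 <= f A) -> (forall A, 0 <= g A) ->
  (forall A, A^T = A -> f A = g A) ->
  \int[symm R n]_A f A = \int[symm R n]_A g A.
Proof.
elim: n f g => [|n IH] f g mf mg f0 g0 fg.
  by apply: eq_integral => A _; apply: fg; rewrite [RHS]flatmx0 [LHS]flatmx0.
move: f g mf mg f0 g0 fg; rewrite -[n.+1]/(1 + n)%N => f g mf mg f0 g0 fg.
rewrite (integral_symmS mf f0) (integral_symmS mg g0).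
apply: eq_integral => x _; apply: eq_integral => v _; apply: IH => //.
- by apply: (measurableT_comp mf); measurable_mx.
- by apply: (measurableT_comp mg); measurable_mx.
- move=> A AT; apply: fg.
  by rewrite (@tr_block_mx _ 1 n 1 n) AT tr_scalar_mx trmxK.
Qed.

Lemma integral_symm_translate n (b : R) (g : 'M[R]_n -> \bar R) :
  measurable_fun [set: 'M[R]_n] g -> (forall y, 0 <= g y) ->
  \int[symm R n]_A g A = \int[symm R n]_A g (A + b%:M)%R.
Proof.
elim: n g => [|n IH] g mg g0.
  by apply: eq_integral => y _; congr g; rewrite [LHS]flatmx0 [RHS]flatmx0.
move: g mg g0; rewrite -[n.+1]/(1 + n)%N => g mg g0.
have mgb : measurable_fun [set: 'M[R]_(1 + n)] (fun A : 'M[R]_(1 + n) => g (A + b%:M)%R).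
  by apply: (measurableT_comp mg); measurable_mx.
rewrite [LHS](integral_symmS_rev mg g0) [RHS](integral_symmS_rev mgb (fun _ => g0 _)).
rewrite IH; last 2 first.
- apply: (measurable_integral_param (vecm R n) (fun A v =>
    \int[lebesgue_measure]_x g (block_mx x%:M v^T v A))); last first.
    by move=> A v; exact: integral_ge0.
  apply: (measurable_integral_param lebesgue_measure
    (fun (w : 'M[R]_n * 'cV[R]_n) (x : measurableTypeR R) => g (block_mx x%:M w.2^T w.2 w.1))) => //.
  by apply: (measurableT_comp mg); measurable_mx.
- by move=> A; apply: integral_ge0 => v _; exact: integral_ge0.
apply: eq_integral => A _; apply: eq_integral => v _.
rewrite (ge0_integral_translate b) //; last first.
  by apply: (measurableT_comp mg); measurable_mx.
apply: eq_integral => x _; congr g.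
by rewrite (scalar_mx_block 1 n) add_block_mx !addr0 -raddfD.
Qed.

(** The exponent [n + 1] is that of the determinant of [A |-> P A P^T] on the space of symmetric
    matrices. *)
Definition sym_change n (P : 'M[R]_n) := forall g : 'M[R]_n -> \bar R,
  measurable_fun [set: 'M[R]_n] g -> (forall y, 0 <= g y) ->
  \int[symm R n]_A g A = (`|\det P| ^+ n.+1)%:E * \int[symm R n]_A g (P *m A *m P^T)%R.

Lemma mulmx_congr_block n (d : R) (r : 'rV[R]_n) (P A : 'M[R]_n) (x : R) (v : 'cV[R]_n) :
  A^T = A ->
  let M : 'M[R]_(1 + n) := block_mx x%:M v^T v A in
  let Q : 'M[R]_(1 + n) := block_mx d%:M r 0 P in
  let v' := ((d *: P) *m v + P *m A *m r^T)%R in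
  let c := ((2 * d) * (r *m v) 0 0 + (r *m A *m r^T) 0 0)%R in
  Q *m M *m Q^T = block_mx (d ^+ 2 * x + c)%:M v'^T v' (P *m A *m P^T).
Proof.
move=> AT M Q v' c.
rewrite /M /Q tr_block_mx !mulmx_block !(mul0mx, mulmx0, add0r, addr0, tr_scalar_mx, trmx0).
congr block_mx.
- rewrite (mx11_scalar (r *m v)) -scalar_mxM -raddfD /= -scalar_mxM.
  rewrite mulmxDl mul_scalar_mx.
  have -> : (d *: v^T *m r^T)%R = (d * (r *m v) 0 0)%R%:M.
    rewrite -scalemxAl -trmx_mul (mx11_scalar (r *m v)) tr_scalar_mx -mul_scalar_mx.
    by rewrite -scalar_mxM !mxE eqxx mulr1n.
  rewrite (mx11_scalar (r *m A *m r^T)) -!raddfD /=; congr scalar_mx.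
  by rewrite /c; ring.
- by rewrite /v' raddfD /= -scalemxAl linearZ /= !trmx_mul trmxK AT mulmxDl
    mul_scalar_mx -scalemxAl mulmxA.
- by rewrite /v' mul_mx_scalar -scalemxAl.
Qed.

(** In the coordinates [(A, v, x)] the congruence is triangular: [x] is scaled by [d^2] and shifted,
    [v] is multiplied by [d P] and shifted, [A] undergoes the congruence by [P]. The factors
    [|d|^2], [|d|^n |det P|] and [|det P|^(n+1)] multiply to [|d det P|^(n+2)]. *)
Lemma sym_change_upper n (d : R) (r : 'rV[R]_n) (P : 'M[R]_n) : d != 0%R ->
  P \in unitmx -> sym_change P -> sym_change (block_mx d%:M r 0 P : 'M[R]_(1 + n)).
Proof.
move=> d0 uP hP g mg g0.
set Q := block_mx _ _ _ _.
have mgQ : measurable_fun [set: 'M[R]_(1 + n)]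
    (fun A : 'M[R]_(1 + n) => g (Q *m A *m Q^T)%R).
  by apply: (measurableT_comp mg); measurable_mx.
rewrite [LHS](integral_symmS_rev mg g0) (integral_symmS_rev mgQ (fun _ => g0 _)).
have mpar (G : 'M[R]_(1 + n) -> \bar R) :
    measurable_fun [set: 'M[R]_(1 + n)] G -> (forall A, 0 <= G A) ->
    measurable_fun [set: 'M[R]_n * 'cV[R]_n]
      (fun w => \int[lebesgue_measure]_x G (block_mx x%:M w.2^T w.2 w.1)).
  move=> mG G0; apply: (measurable_integral_param lebesgue_measure
    (fun (w : 'M[R]_n * 'cV[R]_n) (x : measurableTypeR R) => G (block_mx x%:M w.2^T w.2 w.1))) => //.
  by apply: (measurableT_comp mG); measurable_mx.
have mpar2 (G : 'M[R]_(1 + n) -> \bar R) :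
    measurable_fun [set: 'M[R]_(1 + n)] G -> (forall A, 0 <= G A) ->
    measurable_fun [set: 'M[R]_n]
      (fun A => \int[vecm R n]_v \int[lebesgue_measure]_x G (block_mx x%:M v^T v A)).
  move=> mG G0; apply: (measurable_integral_param (vecm R n) (fun A v =>
    \int[lebesgue_measure]_x G (block_mx x%:M v^T v A))); first exact: mpar.
  by move=> A v; exact: integral_ge0.
rewrite hP; last 2 first.
- exact: mpar2.
- by move=> A; apply: integral_ge0 => v _; exact: integral_ge0.
have -> : (`|\det Q| ^+ n.+2)%:E =
    (`|\det P| ^+ n.+1)%:E * (`|\det (d *: P)| * `|d ^+ 2|)%:E.
  rewrite -EFinM /Q det_ublock det_scalar1 detZ !normrM !normrX; congr (_%:E).
  by rewrite exprMn !exprS; ring.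
rewrite -muleA; congr (_ * _).
rewrite -ge0_integralZl //; last 2 first.
- exact: (mpar2 _ mgQ (fun _ => g0 _)).
- by move=> A _; apply: integral_ge0 => v _; exact: integral_ge0.
have mcomp : measurable_fun [set: 'M[R]_n] (fun A => P *m A *m P^T)%R by measurable_mx.
apply: eq_integral_symm.
- exact: (measurableT_comp (mpar2 _ mg g0) mcomp).
- by apply: emeasurable_funM => //; exact: (mpar2 _ mgQ (fun _ => g0 _)).
- by move=> A; apply: integral_ge0 => v _; exact: integral_ge0.
- by move=> A; apply: mule_ge0 => //; apply: integral_ge0 => v _; exact: integral_ge0.
move=> A AT.
have dP : (d *: P)%R \in unitmx.
  by rewrite unitmxE detZ unitrM -unitmxE uP andbT unitfE expf_neq0.
have mv1 B : measurable_fun [set: 'cV[R]_n]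
    (fun v => \int[lebesgue_measure]_x g (block_mx x%:M v^T v B)).
  by apply: (measurableT_comp (mpar _ mg g0) (g := fun v => (B, v))); measurable_mx.
rewrite (integral_vecm_translate (P *m A *m r^T)%R) //; last first.
  by move=> v; exact: integral_ge0.
rewrite (vec_change_unit dP); last 2 first.
- apply: (measurableT_comp (mv1 (P *m A *m P^T)%R) (g := fun v : 'cV[R]_n => (v + P *m A *m r^T)%R : 'cV[R]_n)).
  by measurable_mx.
- by move=> v; exact: integral_ge0.
rewrite EFinM -muleA; congr (_ * _).
rewrite -ge0_integralZl //; last 2 first.
- apply: (measurableT_comp (mpar _ mgQ _) (g := fun v => (A, v))); first by move=> ?; exact: g0.
  by measurable_mx.
- by move=> v _; exact: integral_ge0.
apply: eq_integral => v _.
rewrite (@ge0_integral_affine R (d ^+ 2)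
   ((2 * d) * (r *m v) 0 0 + (r *m A *m r^T) 0 0)%R) //; last 2 first.
- by rewrite expf_neq0.
- by apply: (measurableT_comp mg); measurable_mx.
congr (_ * _); apply: eq_integral => x _.
by rewrite /Q mulmx_congr_block.
Qed.

End symmetric_change.

(** * Spectra of symmetric matrices *)

Lemma char_poly_conj (F : fieldType) n (M N H : 'M[F]_n) : H \in unitmx ->
  M *m H = H *m N -> char_poly M = char_poly N.
Proof.
move=> uH MH; rewrite /char_poly.
have hH : \det (map_mx polyC H) != 0.
  by rewrite det_map_mx polyC_eq0 -unitfE -unitmxE.
apply: (mulfI hH); rewrite -[RHS]det_mulmx mulrC -det_mulmx; congr (\det _).
rewrite /char_poly_mx mulmxBl mulmxBr -!map_mxM MH; congr (_ - _).
by rewrite mul_scalar_mx mul_mx_scalar.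
Qed.

Lemma char_poly_block_diag (F : fieldType) m n (A : 'M[F]_m) (B : 'M[F]_n) :
  char_poly (block_mx A 0 0 B) = char_poly A * char_poly B.
Proof.
rewrite /char_poly /char_poly_mx map_block_mx (scalar_mx_block m n) opp_block_mx.
by rewrite add_block_mx !map_mx0 !subr0 det_ublock.
Qed.

Lemma char_poly_scalar11 (F : fieldType) (x : F) :
  char_poly (x%:M : 'M[F]_1) = 'X - x%:P.
Proof. by rewrite /char_poly det_mx11 !mxE !eqxx !mulr1n. Qed.

Lemma trmxZ (F : fieldType) m n (a : F) (A : 'M[F]_(m, n)) : (a *: A)^T = a *: A^T.
Proof. by apply/matrixP => i j; rewrite !mxE. Qed.

Section gram.
Variable R : realType.

(** A Cholesky factor, kept upper triangular so that [sym_change_upper] applies at each step. With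
    corner [d = sqrt (1 + w0^2)] the Schur complement is [1 + w' w'^T / d^2], again of the form
    treated, for the vector [w' / d]. *)
Lemma upper_gram_factor n (w : 'cV[R]_n) : exists Q : 'M[R]_n,
  [/\ Q \in unitmx, sym_change Q, Q^T *m Q = 1%:M + w *m w^T
    & (\det Q) ^+ 2 = 1 + (w^T *m w) 0 0].
Proof.
elim: n w => [|n IH] w.
  exists 1%:M; split.
  - exact: unitmx1.
  - move=> g mg g0; rewrite det1 normr1 expr1n mul1e; apply: eq_integral => A _.
    by congr g; rewrite [LHS]flatmx0 [RHS]flatmx0.
  - by rewrite [LHS]flatmx0 [RHS]flatmx0.
  - by rewrite det1 expr1n mxE big_ord0 addr0.
move: w; rewrite -[n.+1]/(1 + n)%N => w.
pose w0 := w 0 0; pose w' : 'cV[R]_n := dsubmx w.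
have d2 : 0 < 1 + w0 ^+ 2 by rewrite ltr_pwDl ?sqr_ge0.
pose d := Num.sqrt (1 + w0 ^+ 2).
have d0 : 0 < d by rewrite sqrtr_gt0.
have dd : d ^+ 2 = 1 + w0 ^+ 2 by rewrite sqr_sqrtr // ltW.
have [Q [uQ cQ QQ dQ]] := IH (d^-1 *: w').
exists (block_mx d%:M ((w0 / d) *: w'^T) 0 Q : 'M[R]_(1 + n)).
have wE : w = col_mx w0%:M w' by exact: col_mx_decomp.
split.
- by rewrite unitmxE det_ublock det_scalar1 unitrM -unitmxE uQ unitfE gt_eqF.
- by apply: sym_change_upper => //; rewrite gt_eqF.
- rewrite tr_block_mx trmx0 tr_scalar_mx trmxZ trmxK.
  rewrite mulmx_block !(mul0mx, mulmx0, addr0).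
  rewrite wE tr_col_mx mul_col_row (scalar_mx_block 1 n) add_block_mx !add0r tr_scalar_mx.
  have dV : d * (w0 / d) = w0 by rewrite mulrC divfK // gt_eqF.
  congr block_mx.
  + by rewrite -!scalar_mxM -raddfD /= -!expr2 dd.
  + by rewrite !mul_scalar_mx scalerA dV.
  + by rewrite !mul_mx_scalar scalerA dV.
  + rewrite QQ !trmxZ -!scalemxAl -!scalemxAr !scalerA addrCA -scalerDl.
    rewrite (_ : _ + _ = 1) ?scale1r //.
    have -> : w0 / d * (w0 / d) + d^-1 * d^-1 = (1 + w0 ^+ 2) / d ^+ 2.
      by field; rewrite gt_eqF.
    by rewrite -dd divff // expf_neq0 // gt_eqF.
- rewrite det_ublock det_scalar1 exprMn dQ dd wE tr_col_mx mul_row_col tr_scalar_mx.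
  rewrite -scalar_mxM trmxZ -scalemxAl -scalemxAr scalerA [in RHS]mxE.
  rewrite [X in _ = 1 + (X + _)]mxE eqxx mulr1n mxE -dd.
  have -> : d^-1 * d^-1 = (d ^+ 2)^-1 by rewrite -expr2 exprVn.
  rewrite mulrDr mulr1 mulrA mulfV ?mul1r ?dd; last by rewrite gt_eqF.
  by rewrite -expr2 addrA.
Qed.

(** The vector [y = (1, w)] is orthogonal to the columns of [K], hence an eigenvector for [l]. Since
    [K^T K = 1 + w w^T = Q^T Q], the columns of [O = K Q^-1] are an orthonormal basis of the
    complement of [y], and in the basis [H] formed by both the matrix is the direct sum. *)
Lemma char_poly_rank_deflation n (l : R) (w : 'cV[R]_n) (S Q : 'M[R]_n) :
  Q \in unitmx -> Q^T *m Q = 1%:M + w *m w^T ->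
  let K : 'M[R]_(1 + n, n) := col_mx (- w^T) 1%:M in
  char_poly (l%:M + K *m S *m K^T) =
  char_poly (block_mx l%:M 0 0 (l%:M + Q *m S *m Q^T) : 'M[R]_(1 + n)).
Proof.
move=> uQ QQ K.
pose y : 'cV[R]_(1 + n) := col_mx 1%:M w.
pose O : 'M[R]_(1 + n, n) := K *m invmx Q.
pose H : 'M[R]_(1 + n) := row_mx y O.
have KT : K^T = row_mx (- w) 1%:M.
  by rewrite /K tr_col_mx linearN /= trmxK tr_scalar_mx.
have Ky : K^T *m y = 0.
  by rewrite KT /y mul_row_col mulmx1 mul1mx addrC subrr.
have KK : K^T *m K = Q^T *m Q.
  by rewrite KT /K mul_row_col mulNmx mulmxN opprK mulmx1 addrC QQ.
have yK : y^T *m K = 0 by apply: trmx_inj; rewrite trmx_mul trmxK Ky trmx0.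
have OO : O^T *m O = 1%:M.
  rewrite /O trmx_mul -mulmxA (mulmxA K^T) KK -!mulmxA mulmxV // mulmx1.
  by rewrite -trmx_mul mulmxV // trmx1.
apply: (@char_poly_conj _ _ _ _ H).
  have HH : H^T *m H = block_mx (1 + (w^T *m w) 0 0)%:M 0 0 1%:M.
    rewrite /H tr_row_mx mul_col_row OO; congr block_mx.
    - rewrite /y tr_col_mx mul_row_col tr_scalar_mx mulmx1 raddfD /=.
      by rewrite -mx11_scalar.
    - by rewrite /O mulmxA yK mul0mx.
    - by rewrite /O trmx_mul -mulmxA Ky mulmx0.
  have : \det (H^T *m H) != 0.
    rewrite HH det_ublock det1 mulr1 det_scalar1 gt_eqF // ltr_pwDl //.
    by rewrite mxE; apply: sumr_ge0 => i _; rewrite mxE -expr2 sqr_ge0.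
  by rewrite det_mulmx mulf_eq0 negb_or => /andP[_]; rewrite unitmxE unitfE.
rewrite /H mul_mx_row (mul_row_block y O) !mulmx0 addr0 add0r; congr row_mx.
  by rewrite mulmxDl -!mulmxA Ky !mulmx0 addr0 mul_mx_scalar mul_scalar_mx.
rewrite mulmxDl mulmxDr mul_mx_scalar mul_scalar_mx; congr (_ + _).
by rewrite /O -!mulmxA (mulmxA K^T) KK -mulmxA mulmxV // mulmx1 mulKmx.
Qed.

End gram.

Section symmetric_spectral.
Variable R : realType.
Local Notation C := (complex R).
Local Notation toC := (real_complex R).

Lemma conjC_real_complex (x : R) : (toC x)^*%R = toC x.
Proof. by apply/CrealP/complex_realP; exists x. Qed.

Lemma unitary_diagonalization n (A : 'M[R]_n) : A^T = A ->
  exists (P : 'M[C]_n) (mu : 'rV[R]_n),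
  [/\ P \in unitmx, invmx P = map_mx conjC P^T
    & map_mx toC A = invmx P *m diag_mx (map_mx toC mu) *m P].
Proof.
move=> AT; set B := map_mx toC A.
have BT : B^T = B by rewrite /B map_trmx AT.
have Bh : B \is hermsymmx.
  apply/is_hermitianmxP; rewrite expr0 scale1r.
  apply/matrixP => i j; rewrite !mxE conjC_real_complex.
  by have /matrixP/(_ i j) := BT; rewrite !mxE.
have Bn := hermitian_normalmx Bh.
have Pu := spectral_unitarymx B.
exists (spectralmx B), (map_mx (@complex.Re R) (spectral_diag B)).
split; [exact: spectral_unit | by rewrite invmx_unitary // map_trmx | ].
have -> : map_mx toC (map_mx (@complex.Re R) (spectral_diag B)) = spectral_diag B.
  apply/matrixP => i j; rewrite !mxE; apply: RRe_real.
  exact: (mxOverP (hermitian_spectral_diag_real Bh)).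
exact/orthomx_spectralP.
Qed.

Lemma invmx_right_inverse (F : fieldType) n (A B : 'M[F]_n) : A *m B = 1%:M -> invmx A = B.
Proof.
by move=> AB; have [uA uB] := mulmx1_unit AB; rewrite -[LHS]mulmx1 -AB mulKmx.
Qed.

Lemma diag_mx_mul (F : fieldType) n (d e : 'rV[F]_n) :
  diag_mx d *m diag_mx e = diag_mx (\row_i (d 0 i * e 0 i)).
Proof. by apply/matrixP => i j; rewrite mul_diag_mx !mxE; case: eqP => [->|]; rewrite ?mulr1n // !mulr0n mulr0. Qed.

Lemma diag_mx_exp (F : fieldType) n (d : 'rV[F]_n) k :
  diag_mx d ^+ k = diag_mx (\row_i (d 0 i ^+ k)).
Proof.
elim: k => [|k IH].
  rewrite expr0; apply/matrixP => i j; rewrite !mxE expr0; by case: eqP.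
rewrite exprS IH [LHS]diag_mx_mul; congr diag_mx.
by apply/rowP => i; rewrite !mxE exprS.
Qed.

Lemma conj_mx_exp (F : fieldType) n (P X : 'M[F]_n) k : P \in unitmx ->
  (invmx P *m X *m P) ^+ k = invmx P *m X ^+ k *m P.
Proof.
move=> uP; elim: k => [|k IH].
  by rewrite !expr0 [X in invmx P *m X]/(1%:M) mulmx1 mulVmx.
rewrite !exprS IH -[LHS]/(_ *m _) -[in RHS]/(X *m X ^+ k) -!mulmxA; congr (_ *m _).
by rewrite (mulmxA P) mulmxV // mul1mx.
Qed.

Lemma conj_mx_sq (F : fieldType) n (P X Y : 'M[F]_n) : P \in unitmx ->
  invmx P *m (X *m Y) *m P = (invmx P *m X *m P) *m (invmx P *m Y *m P).
Proof. by move=> uP; rewrite !mulmxA mulmxK. Qed.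

Lemma map_mx_exp (F G : fieldType) (f : {rmorphism F -> G}) n (A : 'M[F]_n) k :
  map_mx f (A ^+ k) = (map_mx f A) ^+ k.
Proof.
elim: k => [|k IH]; first by rewrite !expr0 [LHS]map_mx1.
by rewrite !exprS -IH -[LHS]/(map_mx f (A *m A ^+ k)) map_mxM.
Qed.

(** [X] and [Y] are the real and imaginary parts of a unitary diagonalizing matrix, so the squared
    moduli of the spectral coordinates of [v] are sums of two real squares. The trace identity
    serves to express eigenvalue counts by polynomials in the matrix. *)
Lemma sym_spectral n (A : 'M[R]_n) : A^T = A ->
  exists (mu : 'I_n -> R) (X Y : 'M[R]_n),
  [/\ char_poly A = \prod_i ('X - (mu i)%:P),
     forall i, exists j, (X i j != 0) || (Y i j != 0),
     forall l (v : 'cV[R]_n), (forall i, mu i != l) ->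
       (v^T *m invmx (A - l%:M) *m v) 0 0 =
         \sum_i (((X *m v) i 0) ^+ 2 + ((Y *m v) i 0) ^+ 2) / (mu i - l) /\
       (v^T *m invmx (A - l%:M) *m invmx (A - l%:M) *m v) 0 0 =
         \sum_i (((X *m v) i 0) ^+ 2 + ((Y *m v) i 0) ^+ 2) / (mu i - l) ^+ 2
   & forall a b m k, \tr ((1 - (a *: A + b%:M) ^+ m) ^+ k) =
       \sum_i (1 - (a * mu i + b) ^+ m) ^+ k].
Proof.
move=> AT; have [P [mu [uP PT AE]]] := unitary_diagonalization AT.
set D := diag_mx (map_mx toC mu) in AE.
exists (fun i => mu 0 i), (map_mx (@complex.Re R) P), (map_mx (@complex.Im R) P).
have shift (a b : R) : map_mx toC (a *: A + b%:M) =
    invmx P *m diag_mx (\row_i toC (a * mu 0 i + b)) *m P.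
  rewrite map_mxD map_mxZ AE map_scalar_mx scalemxAl scalemxAr.
  have -> : (toC b)%:M = invmx P *m (toC b)%:M *m P.
    by rewrite mul_mx_scalar -scalemxAl mulVmx // scalemx1.
  rewrite -mulmxDl -mulmxDr; apply: (congr1 (fun Z => invmx P *m Z *m P)); apply/matrixP => i j.
  by rewrite !mxE rmorphD rmorphM; case: eqP => _; rewrite ?mulr1n ?mulr0n ?mulr0 ?addr0.
split.
- apply: (map_poly_inj toC); rewrite map_char_poly.
  rewrite (@char_poly_conj _ _ _ D (invmx P)) ?unitmx_inv //; last first.
    by rewrite AE mulmxK.
  rewrite char_poly_trig ?diag_mx_is_trig // rmorph_prod /=.
  apply: eq_bigr => i _.
  by rewrite rmorphB /= map_polyX map_polyC /= !mxE eqxx mulr1n.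
- move=> i; apply/existsP; apply: contraT; rewrite negb_exists => /forallP H.
  have Pi0 : row i P = 0.
    apply/rowP => j; rewrite !mxE; have := H j; rewrite !mxE negb_or !negbK => /andP[/eqP re /eqP im].
    by apply/eqP; rewrite eq_complex /= re im !eqxx.
  have : row i (P *m invmx P) = 0 by rewrite row_mul Pi0 mul0mx.
  rewrite mulmxV // => /rowP/(_ i); rewrite !mxE eqxx mulr1n => /eqP.
  by rewrite oner_eq0.
- move=> l v mul.
  pose e (k : nat) : 'rV[C]_n := \row_i toC ((mu 0 i - l) ^- k).
  have invE : map_mx toC (invmx (A - l%:M)) = invmx P *m diag_mx (e 1%N) *m P.
    rewrite map_invmx; apply: invmx_right_inverse.
    rewrite (_ : A - l%:M = 1 *: A + (- l)%:M); last by rewrite scale1r raddfN.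
    rewrite shift.
    rewrite -!mulmxA (mulmxA P) mulmxV // mul1mx (mulmxA (diag_mx _)) diag_mx_mul.
    rewrite (_ : diag_mx _ = 1%:M) ?mul1mx ?mulVmx //.
    rewrite -[RHS]diag_const_mx; congr diag_mx; apply/rowP => i.
    by rewrite !mxE -rmorphM mul1r expr1 mulfV ?rmorph1 // subr_eq0.
  pose z := P *m map_mx toC v.
  have zT : map_mx toC v^T *m invmx P = map_mx conjC z^T.
    rewrite /z trmx_mul map_mxM PT; congr (_ *m _).
    apply/matrixP => i j; rewrite !mxE; exact/esym/conjC_real_complex.
  have ReE i : (map_mx (@complex.Re R) P *m v) i 0 = complex.Re (z i 0).
    rewrite /z !mxE (raddf_sum (@complex.Re R : Rcomplex R -> R)); apply: eq_bigr => j _.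
    by rewrite !mxE; case: (P i j) => x y /=; rewrite mulr0 subr0.
  have ImE i : (map_mx (@complex.Im R) P *m v) i 0 = complex.Im (z i 0).
    rewrite /z !mxE (raddf_sum (@complex.Im R : Rcomplex R -> R)); apply: eq_bigr => j _.
    by rewrite !mxE; case: (P i j) => x y /=; rewrite mulr0 add0r.
  have quad k : (map_mx conjC z^T *m diag_mx (e k) *m z) 0 0 =
      toC (\sum_i (((map_mx (@complex.Re R) P *m v) i 0) ^+ 2 +
            ((map_mx (@complex.Im R) P *m v) i 0) ^+ 2) / (mu 0 i - l) ^+ k).
    under [in RHS]eq_bigr do rewrite ReE ImE.
    move: (z) => y; rewrite mxE rmorph_sum; apply: eq_bigr => i _.
    rewrite mul_mx_diag !mxE rmorphM mulrAC; congr (_ * _).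
    by rewrite [RHS]add_Re2_Im2 mulrC [RHS]normCK.
  have e00 (M : 'M[R]_1) : toC (M 0 0) = (map_mx toC M) 0 0 by rewrite mxE.
  split; apply: (@complexI R).
    under [in RHS]eq_bigr do rewrite -[mu 0 _ - l]expr1.
    rewrite -quad e00 !map_mxM invE !mulmxA zT -!mulmxA -/z.
    by rewrite !mulmxA.
  have inv2 : map_mx toC (invmx (A - l%:M) *m invmx (A - l%:M)) = invmx P *m diag_mx (e 2%N) *m P.
    rewrite map_mxM invE -[LHS](conj_mx_sq _ _ uP).
    rewrite diag_mx_mul; apply: (congr1 (fun Z => invmx P *m diag_mx Z *m P)).
    by apply/rowP => i; rewrite !mxE -rmorphM -invfM expr1 expr2.
  rewrite -quad e00 -(mulmxA v^T) map_mxM (map_mxM _ v^T) inv2 !mulmxA zT -!mulmxA -/z.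
  by rewrite !mulmxA.
- move=> a b m k; apply: (@complexI R).
  rewrite -[LHS]trace_map_mx map_mx_exp map_mxB map_mx_exp map_mx1 shift conj_mx_exp //.
  have -> : (1 - invmx P *m diag_mx (\row_i toC (a * mu 0 i + b)) ^+ m *m P : 'M[C]_n) =
     invmx P *m (1 - diag_mx (\row_i toC (a * mu 0 i + b)) ^+ m) *m P.
    by rewrite mulmxBr mulmxBl mulmx1 mulVmx.
  rewrite conj_mx_exp // mxtrace_mulC mulmxA mulmxV // mul1mx diag_mx_exp.
  have -> : (1 - diag_mx (\row_i (\row_i toC (a * mu 0 i + b)) 0 i ^+ m) : 'M[C]_n) =
     diag_mx (\row_i toC (1 - (a * mu 0 i + b) ^+ m)).
    apply/matrixP => i j; rewrite !mxE rmorphB rmorphXn rmorph1.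
    by case: eqP => _; rewrite ?mulr1n ?mulr0n ?subr0.
  rewrite diag_mx_exp mxtrace_diag rmorph_sum; apply: eq_bigr => i _.
  by rewrite !mxE rmorphXn.
Qed.

End symmetric_spectral.

(** * Ordered eigenvalues and the measurability of their counting function *)

Section eigenvalues.
Variable R : realType.

Lemma eigs_unique n (M : 'M[R]_n) s : sorted <=%R s ->
  char_poly M = \prod_(x <- s) ('X - x%:P) -> eigs M = s.
Proof.
move=> ss Ms; rewrite /eigs; case: xgetP => [t -> [st Mt]|/(_ s)]; last first.
  by case.
apply: (le_sorted_eq st ss).
by apply: prod_XsubC_eq; rewrite -Mt -Ms.
Qed.

Lemma eigs_char_poly n (M N : 'M[R]_n) : char_poly M = char_poly N -> eigs M = eigs N.
Proof. by move=> MN; rewrite /eigs MN. Qed.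

Lemma eigs_perm n (M : 'M[R]_n) (mu : 'I_n -> R) :
  char_poly M = \prod_i ('X - (mu i)%:P) ->
  eigs M = sort <=%R [seq mu i | i <- enum 'I_n].
Proof.
move=> Mmu; apply: eigs_unique; first exact: sort_le_sorted.
rewrite Mmu (perm_big [seq mu i | i <- enum 'I_n]); last by rewrite perm_sort.
by rewrite big_map big_enum.
Qed.

Lemma eigsP n (M : 'M[R]_n) : M^T = M ->
  [/\ sorted <=%R (eigs M), size (eigs M) = n
    & char_poly M = \prod_(x <- eigs M) ('X - x%:P)].
Proof.
move=> MT; have [mu [_ [_ [cM _ _ _]]]] := sym_spectral MT.
rewrite (eigs_perm cM) sort_le_sorted size_sort size_map size_enum_ord; split => //.
rewrite cM (perm_big [seq mu i | i <- enum 'I_n]); last by rewrite perm_sort.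
by rewrite big_map big_enum.
Qed.

Definition cnt n (M : 'M[R]_n) (t : R) : nat := count (fun x => x < t) (eigs M).

Lemma sorted_nth_lt (s : seq R) (t : R) j : sorted <=%R s -> (j < size s)%N ->
  (nth 0 s j < t) = (j < count (fun x => (x < t)%R) s)%N.
Proof.
elim: s j => // x s IH j /= sxs js.
have ss : sorted <=%R s by exact: path_sorted sxs.
case: (ltP x t) => xt /=; last first.
  have /eqP c0 : count (fun x0 : R => x0 < t) s == 0%N.
    rewrite eqn0Ngt -has_count; apply/hasPn => y ys; rewrite -leNgt.
    by apply: (le_trans xt); move/(order_path_min le_trans)/allP: sxs => /(_ y ys).
  rewrite c0 ltn0; apply/negbTE; rewrite -leNgt.
  case: j js => // j js /=; apply: (le_trans xt).
  by move/(order_path_min le_trans)/allP: sxs; apply; apply: mem_nth.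
by case: j js => [|j] js; rewrite ?xt //= add1n ltnS IH.
Qed.

(* The symmetric matrix with the same upper triangle; it makes eigenvalue
   functionals well behaved on all matrices. *)
Definition symz n (M : 'M[R]_n) : 'M[R]_n :=
  \matrix_(i, j) if (i <= j)%N then M i j else M j i.

Lemma symz_sym n (M : 'M[R]_n) : (symz M)^T = symz M.
Proof.
apply/matrixP => i j; rewrite !mxE; case: ltngtP => // /val_inj ->.
by [].
Qed.

Lemma symzE n (M : 'M[R]_n) : M^T = M -> symz M = M.
Proof.
move=> MT; apply/matrixP => i j; rewrite !mxE; case: ifP => // _.
by have /matrixP/(_ i j) := MT; rewrite mxE.
Qed.

Lemma measurable_symz n : measurable_fun [set: 'M[R]_n] (@symz n).
Proof.
apply: measurable_mxP => i j; under eq_fun do rewrite mxE.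
by case: (i <= j)%N; exact: measurable_entry.
Qed.

Lemma measurable_mxexp d (T : measurableType d) n (f : T -> 'M[R]_n) k :
  measurable_fun [set: T] f -> measurable_fun [set: T] (fun x => f x ^+ k).
Proof.
move=> mf; elim: k => [|k IH].
  by under eq_fun do rewrite expr0; exact: measurable_cst.
by under eq_fun do rewrite exprS; exact: measurable_mulmx.
Qed.

Lemma bernoulli_ge (x : R) k : -1 <= x -> 1 + k%:R * x <= (1 + x) ^+ k.
Proof.
move=> x1; elim: k => [|k IH]; first by rewrite mul0r addr0.
rewrite exprS; have : (1 + x) * (1 + k%:R * x) <= (1 + x) * (1 + x) ^+ k.
  by rewrite ler_wpM2l //; lra.
apply: le_trans; rewrite -natr1.
have : 0 <= k%:R * x ^+ 2 by rewrite mulr_ge0 ?sqr_ge0.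
by nra.
Qed.

Lemma cvg_natmul_geometric (z : R) : 0 <= z < 1 ->
  (fun m => m%:R * z ^+ m) @ \oo --> (0 : R).
Proof.
move=> /andP[z0 z1]; have [->|zn0] := eqVneq z 0.
  rewrite [X in X @ _](_ : _ = cst 0); first exact: cvg_cst.
  by apply/funext => -[|m]; rewrite ?mul0r // expr0n mulr0.
have {zn0}z0 : 0 < z by rewrite lt_neqAle eq_sym zn0.
(* In [m z^m = (m r^m) r^m] the first factor is bounded, by Bernoulli's inequality for
   [1 / r = 1 + e], and the second tends to 0. *)
pose r := Num.sqrt z.
have r0 : 0 < r by rewrite sqrtr_gt0.
have r1 : r < 1 by rewrite -sqrtr1 ltr_sqrt.
have rr : r ^+ 2 = z by rewrite sqr_sqrtr // ltW.
pose e := r^-1 - 1.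
have e0 : 0 < e by rewrite subr_gt0 invf_gt1.
have mr m : m%:R * r ^+ m <= e^-1.
  have h : 1 + m%:R * e <= (r^-1) ^+ m.
    have -> : r^-1 = 1 + e by rewrite /e addrC subrK.
    by apply: bernoulli_ge; apply: (le_trans _ (ltW e0)); rewrite oppr_le0.
  rewrite -ler_pdivlMr ?exprn_gt0 // -exprVn.
  rewrite ler_pdivlMl // mulrC.
  by apply: le_trans h; rewrite lerDr.
apply: (@squeeze_cvgr _ _ _ _ (cst 0) (fun m => e^-1 * r ^+ m)).
- apply: nearW => m; rewrite mulr_ge0 ?exprn_ge0 ?(ltW z0) //=.
  rewrite -rr -exprM mul2n -addnn exprD mulrA.
  by rewrite ler_wpM2r // exprn_ge0 // ltW.
- exact: cvg_cst.
- rewrite -[X in _ --> X](mulr0 e^-1); apply: cvgMr.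
  by apply: cvg_expr; rewrite ger0_norm // ltW.
Qed.

(* The exponent [m 2 ^ m] makes the limit exact at the threshold [1 / 2]. *)
Lemma cvg_indicator_poly (y : R) : 0 <= y <= 1 ->
  (fun m => (1 - y ^+ m) ^+ (m * 2 ^ m)) @ \oo --> ((y < 1 / 2)%R%:R : R).
Proof.
move=> /andP[y0 y1].
have x0 m : 0 <= y ^+ m by rewrite exprn_ge0.
have x1 m : y ^+ m <= 1 by rewrite exprn_ile1.
have Kx m : (m * 2 ^ m)%:R * y ^+ m = m%:R * (2 * y) ^+ m.
  by rewrite natrM natrX exprMn mulrA.
case: ltP => [yh|yh] /=.
- apply: (@squeeze_cvgr _ _ _ _ (fun m => 1 - m%:R * (2 * y) ^+ m) (cst 1)).
  + apply: nearW => m; apply/andP; split.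
      rewrite -Kx -mulrN; apply: le_trans (bernoulli_ge _ _) _ => //.
      by have := x1 m; lra.
    by rewrite exprn_ile1 ?subr_ge0 // gerBl.
  + rewrite -[X in _ --> X]subr0; apply: cvgB; first exact: cvg_cst.
    apply: cvg_natmul_geometric; apply/andP; split; lra.
  + exact: cvg_cst.
- apply: (@squeeze_cvgr _ _ _ _ (cst 0) (fun m => m.+1%:R^-1)).
  + apply: nearW => m; rewrite exprn_ge0 ?subr_ge0 //=.
    (* As [(1 - x)^K (1 + x)^K <= 1], Bernoulli's inequality bounds the term by [1 / (1 + K x)], and
       [K x = m (2 y)^m >= m] because [y >= 1/2]. *)
    set K := (m * 2 ^ m)%N; set x := y ^+ m.
    have xm0 : 0 <= x by exact: x0.
    have xm1 : x <= 1 by exact: x1.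
    have x10 : 0 < 1 + x by rewrite ltr_pwDl.
    have h1 : m.+1%:R <= (1 + x) ^+ K.
      apply: (le_trans _ (bernoulli_ge _ _)); last by rewrite (le_trans _ (x0 m)) // oppr_le0.
      rewrite Kx -natr1 addrC lerD2l ler_peMr // exprn_ege1 //; lra.
    have : (1 - x) ^+ K * (1 + x) ^+ K <= 1.
      by rewrite -exprMn; apply: exprn_ile1; nra.
    move=> h2.
    apply: (@le_trans _ _ (((1 + x) ^+ K)^-1)).
      rewrite -[leRHS]mul1r ler_pdivlMr //.
      by rewrite exprn_gt0.
    by rewrite lef_pV2 ?posrE ?exprn_gt0.
  + exact: cvg_cst.
  + exact: cvg_harmonic.
Qed.

Lemma cvgr_sum (T : Type) (F : set_system T) (FF : Filter F) (I : Type) (r : seq I)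
    (f : I -> T -> R) (l : I -> R) :
  (forall i, f i @ F --> l i) ->
  (fun m => \sum_(i <- r) f i m) @ F --> \sum_(i <- r) l i.
Proof.
move=> fl; elim: r => [|i r IH].
  rewrite big_nil; under eq_fun do rewrite big_nil; exact: cvg_cst.
by rewrite big_cons; under eq_fun do rewrite big_cons; exact: cvgD.
Qed.

Lemma measurable_invr : measurable_fun [set: R] (fun x : R => x^-1).
Proof.
pose U := [set x : R | x != 0].
have oU : open U.
  rewrite (_ : U = ~` [set 0]); first by apply: closed_openC; exact: closed_eq.
  by apply/seteqP; split => x /= /eqP.
have -> : (fun x : R => x^-1) = (fun x : R => x^-1) \_ U.
  apply/funext => x; rewrite patchE; case: ifPn => //.
  by rewrite notin_setE /U /= => /negP; rewrite negbK => /eqP ->; rewrite invr0.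
apply/(measurable_restrictT _ _).1; first exact: open_measurable.
apply: open_continuous_measurable_fun => // x /[!inE] x0.
exact: cvgV.
Qed.

(** [bnd M t] dominates [|t|] and every eigenvalue, whose square is at most [\tr (M ^+ 2)]. Hence
    [x |-> slope x + offset] sends [t] to 1/2 and the spectrum into [[0, 1]]. *)
Let bnd n (M : 'M[R]_n) (t : R) : R := 1 + \tr (M ^+ 2) + `|t|.
Let slope n (M : 'M[R]_n) (t : R) : R := (4 * bnd M t)^-1.
Let offset n (M : 'M[R]_n) (t : R) : R := 1 / 2 - t * slope M t.

Lemma mxtrace_sqr n (M : 'M[R]_n) (mu : 'I_n -> R) :
  (forall a b m k, \tr ((1 - (a *: M + b%:M) ^+ m) ^+ k) =
       \sum_i (1 - (a * mu i + b) ^+ m) ^+ k) ->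
  \tr (M ^+ 2) = \sum_i (mu i) ^+ 2.
Proof.
(* For these parameters the inner expression is [1 - (1 - x) = x], squared. *)
move=> /(_ (-1) 1 1%N 2%N); rewrite !expr1 scaleN1r opprD opprK.
rewrite (_ : 1 + (M - 1%:M) = M); last by rewrite addrC subrK.
by move=> ->; apply: eq_bigr => i _; congr (_ ^+ 2); ring.
Qed.

Lemma cvg_cnt n (M : 'M[R]_n) (t : R) : M^T = M ->
  (fun m => \tr ((1 - (slope M t *: M + (offset M t)%:M) ^+ m) ^+ (m * 2 ^ m)%N)) @ \oo
    --> ((cnt M t)%:R : R).
Proof.
move=> MT; have [mu [_ [_ [cM _ _ trM]]]] := sym_spectral MT.
have trM2 := mxtrace_sqr trM.
have -> : (cnt M t)%:R = \sum_i (mu i < t)%R%:R :> R.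
  rewrite /cnt (eigs_perm cM) count_sort count_map -sum1_count natr_sum.
  rewrite big_enum_cond /= big_mkcond /=.
  by apply: eq_bigr => i _; case: (mu i < t).
under eq_fun do rewrite trM.
apply: cvgr_sum => i.
have mule : `|mu i| < bnd M t.
  have h0 : 0 <= \sum_(j | j != i) mu j ^+ 2 by apply: sumr_ge0 => j _; exact: sqr_ge0.
  have : mu i ^+ 2 <= \tr (M ^+ 2) by rewrite trM2 (bigD1 i) //= lerDl.
  rewrite /bnd -[mu i ^+ 2]real_normK ?num_real // => h1.
  have h2 := normr_ge0 (mu i); have h3 := normr_ge0 t.
  by nra.
have tle : `|t| <= bnd M t.
  rewrite /bnd lerDr addr_ge0 // trM2; apply: sumr_ge0 => j _; exact: sqr_ge0.
have B0 : 0 < bnd M t by exact: le_lt_trans (normr_ge0 _) mule.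
have s0 : 0 < slope M t by rewrite invr_gt0 mulr_gt0.
have yE : slope M t * mu i + offset M t = 1 / 2 + (mu i - t) * slope M t.
  by rewrite /offset; ring.
have -> : (mu i < t)%R = (slope M t * mu i + offset M t < 1 / 2)%R.
  by rewrite yE gtrDl pmulr_llt0 // subr_lt0.
apply: cvg_indicator_poly.
have sB : slope M t * bnd M t = 1 / 4.
  by rewrite /slope; field; rewrite ?gt_eqF.
move: mule tle; rewrite ltr_norml ler_norml => /andP[m1 m2] /andP[t1 t2].
rewrite yE; apply/andP; split; nra.
Qed.

(** For symmetric matrices [cnt] is a pointwise limit of traces of polynomials in the matrix with
    measurable coefficients; composing with [symz] extends the limit to every matrix. *)
Lemma measurable_cnt n :
  measurable_fun [set: 'M[R]_n * measurableTypeR R]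
    (fun z => ((cnt (symz z.1) z.2)%:R : R)).
Proof.
apply/measurable_EFinP.
pose f m (z : 'M[R]_n * measurableTypeR R) : R :=
  \tr ((1 - (slope (symz z.1) z.2 *: symz z.1 + (offset (symz z.1) z.2)%:M) ^+ m) ^+ (m * 2 ^ m)%N).
apply: (emeasurable_fun_cvg (fun m z => (f m z)%:E)) => [m|z _]; last first.
  apply: cvg_EFin; first exact: nearW.
  exact/cvg_cnt/symz_sym.
apply/measurable_EFinP; apply: measurable_mxtrace; apply: measurable_mxexp.
have ms : measurable_fun [set: 'M[R]_n * measurableTypeR R] (fun z => symz z.1).
  by apply: measurableT_comp; [exact: measurable_symz | exact: measurable_fst].
have mt : measurable_fun [set: 'M[R]_n * measurableTypeR R] (fun z => (z.2 : R)).
  exact: measurable_snd.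
have mb : measurable_fun [set: 'M[R]_n * measurableTypeR R] (fun z => bnd (symz z.1) z.2).
  apply: measurable_funD; last exact: measurableT_comp.
  apply: measurable_funD => //; apply: measurable_mxtrace; exact: measurable_mxexp.
have msl : measurable_fun [set: 'M[R]_n * measurableTypeR R] (fun z => slope (symz z.1) z.2).
  by apply: (measurableT_comp measurable_invr); apply: measurable_funM.
apply: measurable_addmx; first exact: measurable_cst.
apply: measurable_oppmx; apply: measurable_mxexp; apply: measurable_addmx.
  exact: measurable_scalemx.
apply: measurable_scalar_mx; apply: measurable_funB => //; exact: measurable_funM.
Qed.

End eigenvalues.

(** * An eigenvalue as a coordinate *)

Section secular.
Variable R : realType.

(** For [mu] the spectrum of [A] and [rho i] the squared spectral components of [v], a point [x] off
    the spectrum is an eigenvalue of the matrix bordered by [v] with corner [a] exactly when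
    [secular mu rho x = a]. *)
Definition secular n (mu rho : 'I_n -> R) (x : R) : R := x + \sum_i rho i / (mu i - x).
Definition dsecular n (mu rho : 'I_n -> R) (x : R) : R := 1 + \sum_i rho i / (mu i - x) ^+ 2.
(** For increasing [mu] this is the interval with exactly the first [k] points to its left; it is
    unbounded below for [k = 0] and above for [k = n]. *)
Definition gap n (mu : 'I_n -> R) k : set R :=
  [set x | forall i : 'I_n, if (i < k)%N then mu i < x else x < mu i].

Lemma gap_neq n (mu : 'I_n -> R) k x i : gap mu k x -> mu i != x.
Proof. by move=> /(_ i); case: ifP => _ h; rewrite ?(lt_eqF h) ?(gt_eqF h). Qed.

Lemma open_gap n (mu : 'I_n -> R) k : open (gap mu k).
Proof.
rewrite openE => x gx.
have H : \forall y \near x, forall i : 'I_n, if (i < k)%N then mu i < y else y < mu i.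
  apply: (@filter_forall R 'I_n (fun i => [set y | if (i < k)%N then mu i < y else y < mu i])
    (nbhs x) _) => i.
  have := gx i; case: (i < k)%N => h.
    by apply: open_nbhs_nbhs; split => //; exact: open_gt.
  by apply: open_nbhs_nbhs; split => //; exact: open_lt.
exact: H.
Qed.

Lemma is_interval_gap n (mu : 'I_n -> R) k : is_interval (gap mu k).
Proof.
move=> x y gx gy z /andP[xz zy] i; have := gx i; have := gy i.
by case: ifP => _ h1 h2; [exact: lt_le_trans xz|exact: le_lt_trans h1].
Qed.

Lemma is_derive_secular n (mu rho : 'I_n -> R) x : (forall i, mu i != x) ->
  is_derive x 1 (secular mu rho) (dsecular mu rho x).
Proof.
move=> mux.
have -> : secular mu rho = (@id R : R -> R) + \sum_i (fun x => rho i / (mu i - x)).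
  by apply/funext => y; rewrite /secular /= fctE fct_sumE.
apply: is_deriveD; apply: is_derive_sum => i.
have nz : mu i - x != 0 by rewrite subr_eq0.
have d1 : is_derive x 1 (fun y : R => mu i - y) (-1).
  have -> : (fun y : R => mu i - y) = cst (mu i) - id by apply/funext.
  by apply: is_derive_eq; rewrite sub0r.
have d2 : is_derive x 1 (fun y : R => (mu i - y)^-1) ((mu i - x) ^- 2).
  have := is_deriveV (f := fun y : R => mu i - y) nz d1.
  by rewrite scaleNr scalerN opprK [X in is_derive _ _ _ X]mulr1.
have -> : (fun y => rho i / (mu i - y)) = rho i \*: (fun y : R => (mu i - y)^-1).
  by apply/funext.
exact: is_deriveZ.
Qed.

Lemma continuous_dsecular n (mu rho : 'I_n -> R) x : (forall i, mu i != x) ->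
  {for x, continuous (dsecular mu rho)}.
Proof.
move=> mux; apply: cvgD; first exact: cvg_cst.
apply: cvgr_sum => i; apply: cvgMr; apply: cvgV.
  by rewrite expf_neq0 // subr_eq0.
apply: (@continuous_comp _ _ _ (fun y => mu i - y) (fun z => z ^+ 2)).
  by apply: cvgB; [exact: cvg_cst|exact: cvg_id].
exact: exprn_continuous.
Qed.

Lemma dsecular_ge1 n (mu rho : 'I_n -> R) x : (forall i, 0 <= rho i) ->
  1 <= dsecular mu rho x.
Proof.
move=> r0; rewrite lerDl; apply: sumr_ge0 => i _.
by rewrite divr_ge0 ?sqr_ge0.
Qed.

Lemma secular_incr n (mu rho : 'I_n -> R) k x y : (forall i, 0 <= rho i) ->
  gap mu k x -> gap mu k y -> x < y -> secular mu rho x < secular mu rho y.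
Proof.
move=> r0 gx gy xy; apply: ltr_leD => //; apply: ler_sum => i _.
rewrite ler_wpM2l //; have := gx i; have := gy i; case: ifP => _ h1 h2.
  by rewrite -[leLHS]opprK -[leRHS]opprK lerN2 -!invrN !opprB lef_pV2 ?posrE ?subr_gt0 // lerD2r ltW.
by rewrite lef_pV2 ?posrE ?subr_gt0 // lerD2l lerN2 ltW.
Qed.

(** In the leftmost gap the linear term [x] tends to minus infinity; in any other gap the pole at
    its left end does the work. *)
Lemma secular_unbounded_below n (mu rho : 'I_n -> R) k y :
  (forall i j : 'I_n, (i < j)%N -> mu i < mu j) -> (forall i, 0 < rho i) -> (k <= n)%N ->
  exists2 x, gap mu k x & secular mu rho x <= y.
Proof.
move=> mui r0; case: k => [_|k kn].
  have m0 : 0 <= \sum_i `|mu i| by apply: sumr_ge0 => i _.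
  have rs0 : 0 <= \sum_i rho i by apply: sumr_ge0 => i _; exact: ltW.
  (* So far to the left every denominator is at least 1, and the quotients add up to at most the sum
     of the [rho i]. *)
  pose x := - (\sum_i `|mu i|) - 1 - \sum_i rho i - `|y|.
  have xmu i : 1 <= mu i - x.
    have h1 : `|mu i| <= \sum_i `|mu i|.
      by rewrite (bigD1 i) //= lerDl; apply: sumr_ge0.
    have h2 := ler_norm (- mu i); rewrite normrN in h2; have h3 := normr_ge0 y.
    by rewrite /x; lra.
  exists x; first by move=> i /=; rewrite -subr_gt0; exact: lt_le_trans (xmu i).
  have : \sum_i rho i / (mu i - x) <= \sum_i rho i.
    apply: ler_sum => i _; rewrite ler_pdivrMr ?ler_peMr //; first exact: ltW.
    exact: lt_le_trans (xmu i).
  rewrite /secular => h; have h2 := ler_norm (- y); rewrite normrN in h2.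
  by rewrite {1}/x; lra.
pose j := Ordinal kn; pose p := mu j.
have [D D0 HD] : exists2 D, 0 < D & forall i : 'I_n, (j < i)%N -> 2 * D <= mu i - p.
  case: (ltnP k.+1 n) => [k1n|nk1]; last first.
    exists 1 => // i /= ji; exfalso; have := leq_trans (ltn_ord i) nk1.
    by rewrite ltnS leqNgt ji.
  exists ((mu (Ordinal k1n) - p) / 2).
    by rewrite divr_gt0 // subr_gt0 mui.
  move=> i ji; rewrite mulrC divfK // lerD2r.
  by case: (ltngtP k.+1 i) ji => [h _|//|h _];
    [exact/ltW/mui|rewrite (_ : Ordinal k1n = i) //; exact/val_inj].
pose Cc := \sum_i rho i / D.
have C0 : 0 <= Cc by apply: sumr_ge0 => i _; rewrite divr_ge0 ?ltW.
(* At [p + e], just right of the pole [p], the term of index [j] is at most [- B] because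
   [e <= rho j / B]. Poles further right stay at distance at least [D], so their terms add at most
   [Cc]; those further left contribute nonpositive terms. [B] is chosen to outweigh [p], [e], [Cc]
   and [y] together. *)
pose B := `|p| + 1 + Cc + `|y|.
have B0 : 0 < B by rewrite /B; have := normr_ge0 p; have := normr_ge0 y; lra.
pose e := Num.min (Num.min D 1) (rho j / B).
have e0 : 0 < e by rewrite !lt_min D0 ltr01 divr_gt0.
have eD : e <= D by rewrite /e !ge_min lexx.
have e1 : e <= 1 by rewrite /e !ge_min lexx orbT.
have eB : e <= rho j / B by rewrite /e !ge_min lexx orbT.
have gx : gap mu k.+1 (p + e).
  move=> i; case: ifPn => ik.
    apply: (@le_lt_trans _ _ p); last by rewrite ltrDl.
    move: ik; rewrite ltnS leq_eqVlt => /predU1P[ik|ik]; last exact/ltW/mui.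
    by rewrite /p (_ : i = j) //; exact/val_inj.
  have := HD i; rewrite /= ltnNge -ltnS ik => /(_ isT) h; lra.
exists (p + e) => //.
have hj : rho j / (mu j - (p + e)) <= - B.
  rewrite (_ : mu j - (p + e) = - e); last by rewrite /p; ring.
  rewrite invrN mulrN lerN2 ler_pdivlMr // mulrC -ler_pdivlMr //.
have hs : \sum_i rho i / (mu i - (p + e)) <= - B + Cc.
  rewrite (bigD1 j) //=; apply: lerD => //.
  apply: (@le_trans _ _ (\sum_(i | i != j) rho i / D)); last first.
    by rewrite /Cc [leRHS](bigD1 j) //= lerDr divr_ge0 ?ltW.
  apply: ler_sum => i ij; have := gx i; case: ifPn => ik h.
    apply: (@le_trans _ _ 0); last by rewrite divr_ge0 ?ltW.
    by rewrite nmulr_lle0 ?ltW // invr_lt0 subr_lt0.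
  apply: ler_wpM2l; first exact: ltW.
  rewrite lef_pV2 ?posrE ?subr_gt0 //.
  have := HD i; rewrite /= ltnNge -ltnS ik => /(_ isT) h2; lra.
rewrite /secular; have h1 := ler_norm p; have h2 := ler_norm (- y); rewrite normrN in h2.
rewrite /B in hs; lra.
Qed.

Lemma secular_surj n (mu rho : 'I_n -> R) k y :
  (forall i j : 'I_n, (i < j)%N -> mu i < mu j) -> (forall i, 0 < rho i) -> (k <= n)%N ->
  exists2 x, gap mu k x & secular mu rho x = y.
Proof.
move=> mui r0 kn.
have [x1 g1 h1] := secular_unbounded_below y mui r0 kn.
have [x2 g2 h2] : exists2 x, gap mu k x & y <= secular mu rho x.
  (* Large values come from the reflection [x |-> - x]: it negates and reverses [mu], turns gap [k]
     into gap [n - k], and changes the sign of the secular function. *)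
  have mui' (i j : 'I_n) : (i < j)%N -> - mu (rev_ord i) < - mu (rev_ord j).
    by move=> ij; rewrite ltrN2; apply: mui => /=; rewrite ltn_sub2l // (leq_ltn_trans _ (ltn_ord j)).
  have [x gx hx] := secular_unbounded_below (- y) mui' (fun i => r0 (rev_ord i)) (leq_subr k n).
  exists (- x).
    move=> i; have := gx (rev_ord i); rewrite rev_ordK /=.
    have -> : (n - i.+1 < n - k)%N = (k <= i)%N by have := ltn_ord i; lia.
    by rewrite leqNgt; case: (i < k)%N => /=; [rewrite ltrNr|rewrite ltrNl].
  move: hx; rewrite /secular (reindex_inj rev_ord_inj) /= lerNr opprD => /le_trans; apply.
  rewrite lerD2l -sumrN; apply: ler_sum => i _; rewrite rev_ordK.
  by rewrite -mulrN -invrN opprD opprK.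
have gseg z : x1 <= z <= x2 \/ x2 <= z <= x1 -> gap mu k z.
  by move=> [h|h]; [exact: (is_interval_gap g1 g2)|exact: (is_interval_gap g2 g1)].
have x12 : x1 <= x2.
  rewrite leNgt; apply/negP => x21; have := secular_incr (fun i => ltW (r0 i)) g2 g1 x21.
  by rewrite ltNge (le_trans h1 h2).
have := @IVT _ (secular mu rho) x1 x2 y x12.
case.
- apply: continuous_in_subspaceT => z; rewrite inE /= in_itv /= => hz.
  apply: differentiable_continuous; apply/derivable1_diffP.
  have gz : gap mu k z by apply: gseg; left.
  by have := is_derive_secular rho (fun i => gap_neq i gz); case.
- by rewrite ge_min h1 le_max h2 orbT.
move=> c; rewrite in_itv /= => hc <-; exists c => //.
by apply: gseg; left.
Qed.

End secular.

Section border.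
Variable R : realType.

Definition bord n (a : R) (v : 'cV[R]_n) (A : 'M[R]_n) : 'M[R]_(1 + n) :=
  block_mx a%:M v^T v A.

Lemma bord_sym n (a : R) (v : 'cV[R]_n) (A : 'M[R]_n) : A^T = A ->
  (bord a v A)^T = bord a v A.
Proof. by move=> AT; rewrite /bord tr_block_mx tr_scalar_mx trmxK AT. Qed.

Lemma horner_char_poly n (M : 'M[R]_n) x : (char_poly M).[x] = \det (x%:M - M).
Proof.
rewrite /char_poly -horner_evalE -det_map_mx; congr (\det _).
apply/matrixP => i j; rewrite !mxE /= /horner_eval hornerD hornerN hornerC.
by case: eqP => _; rewrite ?mulr1n ?mulr0n ?hornerX ?horner0.
Qed.

Lemma det_schur n (p : R) (r : 'rV[R]_n) (c : 'cV[R]_n) (S : 'M[R]_n) :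
  S \in unitmx ->
  \det (block_mx p%:M r c S : 'M[R]_(1 + n)) = (p - (r *m invmx S *m c) 0 0) * \det S.
Proof.
move=> uS; pose L : 'M[R]_(1 + n) := block_mx 1%:M 0 (- (invmx S *m c)) 1%:M.
have dL : \det L = 1 by rewrite det_lblock !det1 mulr1.
rewrite -[LHS]mulr1 -dL -det_mulmx mulmx_block !(mulmx1, mulmx0, add0r, addr0).
rewrite !mulmxN mulKVmx // subrr det_ublock; congr (_ * _).
by rewrite mulmxA [r *m _ *m c]mx11_scalar -raddfB /= det_scalar1 !mxE eqxx mulr1n.
Qed.

Lemma char_poly_border n (a : R) (v : 'cV[R]_n) (A : 'M[R]_n) x :
  A - x%:M \in unitmx ->
  (char_poly (bord a v A)).[x] =
  (char_poly A).[x] * (x + (v^T *m invmx (A - x%:M) *m v) 0 0 - a).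
Proof.
move=> uA; rewrite !horner_char_poly.
have -> : x%:M - bord a v A = block_mx (x - a)%:M (- v^T) (- v) (x%:M - A).
  rewrite /bord (scalar_mx_block 1 n) opp_block_mx add_block_mx !add0r.
  by rewrite -raddfB.
have uA' : x%:M - A \in unitmx.
  by rewrite -opprB unitmxE -scaleN1r detZ unitrM -unitmxE uA andbT unitrX // unitrN1.
rewrite det_schur // mulrC; congr (_ * _).
have -> : invmx (x%:M - A) = - invmx (A - x%:M).
  apply: invmx_right_inverse; rewrite mulmxN -mulNmx opprB mulmxV //.
rewrite (_ : _ *m _ *m _ = - (v^T *m invmx (A - x%:M) *m v)); last first.
  by rewrite !(mulNmx, mulmxN, opprK).
by move: (_ *m _ *m _) => N; rewrite mxE; ring.
Qed.

Lemma sym_spectral_sorted n (A : 'M[R]_n) : A^T = A -> uniq (eigs A) ->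
  let mu (i : 'I_n) := nth 0 (eigs A) i in
  exists X Y : 'M[R]_n,
  [/\ forall i j : 'I_n, (i < j)%N -> mu i < mu j,
     forall i, exists j, (X i j != 0) || (Y i j != 0)
   & forall l (v : 'cV[R]_n), (forall i, mu i != l) ->
       (v^T *m invmx (A - l%:M) *m v) 0 0 =
         \sum_i (((X *m v) i 0) ^+ 2 + ((Y *m v) i 0) ^+ 2) / (mu i - l) /\
       (v^T *m invmx (A - l%:M) *m invmx (A - l%:M) *m v) 0 0 =
         \sum_i (((X *m v) i 0) ^+ 2 + ((Y *m v) i 0) ^+ 2) / (mu i - l) ^+ 2].
Proof.
move=> AT uA mu; have [mu0 [X [Y [cA XY res _]]]] := sym_spectral AT.
have [sA szA _] := eigsP AT.
pose t := [tuple mu0 i | i < n].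
have pA : perm_eq (eigs A) t.
  by rewrite (eigs_perm cA) perm_sort /= perm_refl.
pose e : n.-tuple R := tcast szA (in_tuple (eigs A)).
have eE : eigs A = e :> seq R by rewrite val_tcast.
have /tuple_permP[s es] : perm_eq e t by rewrite -eE.
have muE i : mu i = mu0 (s i).
  have -> : mu i = tnth e i by rewrite (tnth_nth 0) -eE.
  have -> : e = [tuple tnth t (s i) | i < n] by exact: val_inj.
  by rewrite !tnth_mktuple.
exists (row_perm s X), (row_perm s Y).
have rpE (Z : 'M[R]_n) (v : 'cV[R]_n) i : (row_perm s Z *m v) i 0 = (Z *m v) (s i) 0.
  by rewrite !mxE; apply: eq_bigr => j _; rewrite mxE.
split.
- move=> i j ij; rewrite /mu lt_neqAle; apply/andP; split; last first.
    by apply: sorted_leq_nth => //; [exact: le_trans|rewrite inE szA|rewrite inE szA|exact: ltnW].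
  by rewrite nth_uniq ?szA // neq_ltn ij.
- by move=> i; have [j Hj] := XY (s i); exists j; rewrite !mxE.
- move=> l v ml.
  have ml0 i : mu0 i != l by have := ml (s^-1%g i); rewrite muE permKV.
  have [h1 h2] := res l v ml0; split.
    rewrite h1 (reindex_inj (@perm_inj _ s)); apply: eq_bigr => i _.
    by rewrite !rpE muE.
  rewrite h2 (reindex_inj (@perm_inj _ s)); apply: eq_bigr => i _.
  by rewrite !rpE muE.
Qed.

Section generic.
Variables (n : nat) (A : 'M[R]_n) (v : 'cV[R]_n) (rho : 'I_n -> R).
Hypotheses (AT : A^T = A) (uA : uniq (eigs A)).
Let mu (i : 'I_n) := nth 0 (eigs A) i.
Hypothesis (rho_gt0 : forall i, 0 < rho i).
Hypothesis (mu_incr : forall i j : 'I_n, (i < j)%N -> mu i < mu j).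
Hypothesis (res1 : forall l, (forall i, mu i != l) ->
  (v^T *m invmx (A - l%:M) *m v) 0 0 = \sum_i rho i / (mu i - l)).
Hypothesis (res2 : forall l, (forall i, mu i != l) ->
  (v^T *m invmx (A - l%:M) *m invmx (A - l%:M) *m v) 0 0 = \sum_i rho i / (mu i - l) ^+ 2).

Lemma char_poly_eigs_neq0 l : ((char_poly A).[l] != 0) = [forall i, mu i != l].
Proof.
have [_ szA ->] := eigsP AT.
rewrite -/(root _ l) root_prod_XsubC; apply/idP/forallP => [lA i|H].
  by apply: contraNneq lA => <-; apply: mem_nth; rewrite szA.
apply/negP => /(nthP 0)[ i ]; rewrite szA => ilt E.
by have := H (Ordinal ilt); rewrite /mu /= E eqxx.
Qed.

Lemma unitmx_sub_scalar l : (A - l%:M \in unitmx) = [forall i, mu i != l].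
Proof.
rewrite -char_poly_eigs_neq0 horner_char_poly -(opprB A) -[- (A - _)]scaleN1r detZ unitmxE unitfE.
by rewrite mulf_eq0 negb_or expf_neq0 // oppr_eq0 oner_eq0.
Qed.

Lemma gapP l : (forall i, mu i != l) -> gap mu (cnt A l) l.
Proof.
have [sA szA _] := eigsP AT.
move=> ml i; rewrite /cnt -sorted_nth_lt ?szA // -/(mu i).
by case: ltP => // h; rewrite lt_neqAle eq_sym ml.
Qed.

(** Strict Cauchy interlacing: each of the [n + 1] gaps contains a solution of the secular equation,
    which is a root of the characteristic polynomial. Consecutive gaps are separated by a point of
    [mu], so these roots are distinct and exhaust the degree. *)
Lemma border_eigs a : exists xs : seq R,
  [/\ eigs (bord a v A) = xs, size xs = n.+1, sorted <%R xs &
      forall k, (k <= n)%N -> gap mu k (nth 0 xs k) /\ secular mu rho (nth 0 xs k) = a].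
Proof.
have /choice[x Hx] : forall k, exists x, (k <= n)%N -> gap mu k x /\ secular mu rho x = a.
  move=> k; case: (leqP k n) => kn; last by exists 0.
  by have [y gy hy] := secular_surj a mu_incr rho_gt0 kn; exists y.
exists (mkseq x n.+1).
have nx k : (k <= n)%N -> nth 0 (mkseq x n.+1) k = x k by move=> kn; rewrite nth_mkseq.
have sx : sorted <%R (mkseq x n.+1).
  apply/(sortedP 0) => i; rewrite size_mkseq ltnS => iltn.
  rewrite !nx ?(ltnW iltn) //.
  have [g1 _] := Hx _ (ltnW iltn); have [g2 _] := Hx _ iltn.
  have := g1 (Ordinal iltn); have := g2 (Ordinal iltn); rewrite /= ltnn ltnSn.
  by move=> h1 h2; exact: lt_trans h1.
split; rewrite ?size_mkseq //; last by move=> k kn; rewrite nx //; exact: Hx.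
apply: eigs_unique; first exact: (sub_sorted (fun x y => @ltW _ _ x y)).
have -> : char_poly (bord a v A) = lead_coef (char_poly (bord a v A)) *: char_poly (bord a v A).
  by rewrite (eqP (char_poly_monic _)) scale1r.
rewrite {2}(@all_roots_prod_XsubC _ (char_poly (bord a v A)) (mkseq x n.+1)).
- by rewrite (eqP (char_poly_monic _)) !scale1r.
- by rewrite size_char_poly size_mkseq.
- apply/allP => y /(nthP 0)[k]; rewrite size_mkseq ltnS => kn <-.
  rewrite nx //; have [gk hk] := Hx _ kn.
  have mk i : mu i != x k by exact: gap_neq gk.
  have uk : A - (x k)%:M \in unitmx by rewrite unitmx_sub_scalar; apply/forallP.
  apply/rootP; rewrite char_poly_border // res1 // -/(secular mu rho (x k)) hk.
  by rewrite subrr mulr0.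
- by rewrite uniq_rootsE; exact: lt_sorted_uniq.
Qed.

Lemma border_simple a : uniq (eigs (bord a v A)).
Proof. by have [xs [-> _ sx _]] := border_eigs a; exact: lt_sorted_uniq. Qed.

(** The secular function is strictly increasing on the gap, so [l] is the very root found there, and
    below it lie the roots of the [k] lower gaps. *)
Lemma cnt_border l k : (k <= n)%N -> gap mu k l ->
  cnt (bord (secular mu rho l) v A) l = k.
Proof.
move=> kn gl; have [xs [exs sz sx Hx]] := border_eigs (secular mu rho l).
have sxle := sub_sorted (fun x y => @ltW _ _ x y) sx.
have xk : nth 0 xs k = l.
  have [gk hk] := Hx _ kn.
  case: (ltgtP (nth 0 xs k) l) => // h; exfalso.
    by have := secular_incr (fun i => ltW (rho_gt0 i)) gk gl h; rewrite hk ltxx.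
  by have := secular_incr (fun i => ltW (rho_gt0 i)) gl gk h; rewrite hk ltxx.
rewrite /cnt exs; apply/eqP; rewrite eqn_leq; apply/andP; split.
  by rewrite leqNgt -sorted_nth_lt ?sz // xk ltxx.
case: k kn gl xk => // k kn gl xk.
rewrite -sorted_nth_lt ?sz //; last exact: ltnW.
rewrite -xk; apply: (sorted_ltn_nth lt_trans) => //; rewrite inE sz //.
exact: ltnW.
Qed.

(* The corner entry for which [l] becomes an eigenvalue of the bordered matrix,
   and its derivative in [l]; [\adj] over [\det] keeps them total and measurable. *)
Definition border_shift (B : 'M[R]_n) (u : 'cV[R]_n) (l : R) : R :=
  l + (u^T *m ((\det (B - l%:M))^-1 *: \adj (B - l%:M) *m u)) 0 0.

Definition border_jac (B : 'M[R]_n) (u : 'cV[R]_n) (l : R) : R :=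
  let w := (\det (B - l%:M))^-1 *: \adj (B - l%:M) *m u in 1 + (w^T *m w) 0 0.

End generic.
End border.

(** * Measurable predicates, null sets and simple spectra *)

Section measurable_bool.
Context d (T : measurableType d) (R : realType).

Lemma measurable_fun_boolr (b : T -> bool) : measurable_fun [set: T] b ->
  measurable_fun [set: T] (fun x => (b x)%:R : R).
Proof.
move=> mb; rewrite (_ : (fun _ => _) = (fun x => if b x then 1 else 0 : R)).
  by apply: measurable_fun_ifT.
by apply/funext => x; case: (b x).
Qed.

Lemma measurable_fun_forall (I : finType) (b : I -> T -> bool) :
  (forall i, measurable_fun [set: T] (b i)) ->
  measurable_fun [set: T] (fun x => [forall i, b i x]).
Proof.
move=> mb.
rewrite (_ : (fun _ => _) = (fun x => (\prod_i (b i x)%:R : R) == 1)).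
  apply: measurable_fun_eqr => //; apply: measurable_prod => i _.
  exact: measurable_fun_boolr.
apply/funext => x; apply/forallP/eqP => [H|H i].
  by rewrite big1 // => i _; rewrite H.
apply: contraT => /negbTE bi; move: H; rewrite (bigD1 i) //= bi mul0r => /eqP.
by rewrite eq_sym oner_eq0.
Qed.

Lemma eq_integral_off_null (mu : {measure set T -> \bar R}) (N : set T) (f g : T -> \bar R) :
  measurable N -> mu N = 0%E ->
  measurable_fun [set: T] f -> measurable_fun [set: T] g ->
  (forall x, 0 <= f x)%E -> (forall x, 0 <= g x)%E ->
  (forall x, ~ N x -> f x = g x) ->
  (\int[mu]_x f x = \int[mu]_x g x)%E.
Proof.
move=> mN N0 mf mg f0 g0 fg; apply: ge0_ae_eq_integral => //.
exists N; split => // x /= fgx; apply: contrapT => Nx; apply: fgx => _.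
exact: fg.
Qed.

End measurable_bool.

Section null_sets.
Variable R : realType.

Lemma hyperplane_null n (u : 'rV[R]_n) (c : R) : u != 0 ->
  vecm R n [set v : 'cV[R]_n | (u *m v) 0 0 = c] = 0%E.
Proof.
have mH m (u' : 'rV[R]_m) (c' : R) : measurable_fun [set: 'cV[R]_m]
    (fun v : 'cV[R]_m => ((((u' *m v) 0 0 == c')%:R : R)%:E)).
  apply/measurable_EFinP; apply: measurable_fun_boolr; apply: measurable_fun_eqr => //.
  by measurable_mx.
have HE m (u' : 'rV[R]_m) (c' : R) :
    vecm R m [set v : 'cV[R]_m | (u' *m v) 0 0 = c'] =
    (\int[vecm R m]_v ((((u' *m v) 0 0 == c')%:R : R)%:E))%E.
  have mS : measurable [set v : 'cV[R]_m | (u' *m v) 0 0 = c'].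
    rewrite (_ : [set _ | _] = [set: 'cV[R]_m] `&` (fun v => (u' *m v) 0 0) @^-1` [set c']).
      have : measurable_fun [set: 'cV[R]_m] (fun v => (u' *m v) 0 0) by measurable_mx.
      by apply.
    by rewrite setTI.
  rewrite -[in LHS](setIT [set v | _]) -integral_indic //.
  apply: eq_integral => v _; rewrite indicE; congr ((nat_of_bool _)%:R%:E).
  by apply/idP/eqP; rewrite inE.
elim: n u c => [|n IH] u c u0.
  by exfalso; move/eqP: u0; apply; apply/rowP => -[].
move: u u0; rewrite -[n.+1]/(1 + n)%N => u u0.
pose u1 := u 0 0; pose u2 : 'rV[R]_n := rsubmx u.
have uE x y : (u *m col_mx x%:M y) 0 0 = u1 * x + (u2 *m y) 0 0.
  rewrite -[u in LHS]hsubmxK mul_row_col mul_mx_scalar !mxE mulrC; congr (_ * _ + _).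
  by rewrite /u1; congr (u _ _); exact/val_inj.
rewrite HE (integral_vecmS (mH _ u c)); last by move=> y; rewrite lee_fin.
(* If [u2] is nonzero, every slice at fixed [x] is a hyperplane of lower dimension. Otherwise only
   the first coordinate is constrained, to a single point. *)
have [u20|u2n0] := eqVneq u2 0; last first.
  apply: integral0_eq => x _.
  under eq_integral do rewrite uE.
  rewrite -[RHS](IH u2 (c - u1 * x) u2n0) HE.
  by apply: eq_integral => y _; congr ((nat_of_bool _)%:R%:E); rewrite -[RHS](inj_eq (addrI (u1 * x))) addrCA subrr addr0.
rewrite (tonelli_swap lebesgue_measure (vecm R n)
  (fun (x : measurableTypeR R) (y : 'cV[R]_n) => (((u *m col_mx x%:M y) 0 0 == c)%:R : R)%:E)); last 2 first.
- apply/measurable_EFinP; apply: measurable_fun_boolr; apply: measurable_fun_eqr => //.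
  by measurable_mx.
- by move=> x y; rewrite lee_fin.
apply: integral0_eq => y _.
have u1n0 : u1 != 0.
  apply: contraNneq u0 => u10; rewrite -[u]hsubmxK -/u2 u20 (_ : lsubmx u = 0) ?row_mx0 //.
  by apply/rowP => i; rewrite !mxE ord1 -[RHS]u10 /u1; congr (u _ _); exact/val_inj.
rewrite -[RHS](lebesgue_measure_set1 (c / u1)) -[in RHS](setIT [set c / u1]) -integral_indic //.
apply: eq_integral => x _; rewrite indicE; congr ((nat_of_bool _)%:R%:E).
rewrite uE u20 mul0mx mxE addr0; apply/eqP/idP => [<-|].
  by rewrite inE /= [u1 * x]mulrC mulfK.
by rewrite inE /= => ->; rewrite mulrC divfK.
Qed.

(** For each [i] some row [i] of [X] or [Y] is nonzero, and the sum of squares can vanish only on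
    the hyperplane it defines. With [X], [Y] from the spectral lemma, this makes all weights [rho i]
    of the secular function positive for almost every [v]. *)
Lemma quadratic_null n (X Y : 'M[R]_n) :
  (forall i, exists j, (X i j != 0) || (Y i j != 0)) ->
  exists N : set 'cV[R]_n, [/\ measurable N, vecm R n N = 0%E &
    forall v, ~ N v -> forall i, 0 < ((X *m v) i 0) ^+ 2 + ((Y *m v) i 0) ^+ 2].
Proof.
move=> XY.
have /choice[u Hu] : forall i : 'I_n, exists u : 'rV[R]_n, u != 0 /\
    forall v : 'cV[R]_n, (u *m v) 0 0 != 0 -> 0 < ((X *m v) i 0) ^+ 2 + ((Y *m v) i 0) ^+ 2.
  move=> i; have rE (Z : 'M[R]_n) (v : 'cV[R]_n) : (row i Z *m v) 0 0 = (Z *m v) i 0.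
    by rewrite -row_mul mxE.
  have rn0 (Z : 'M[R]_n) j : Z i j != 0 -> row i Z != 0.
    by apply: contra_neq => /rowP/(_ j); rewrite !mxE.
  have [j /orP[Hj|Hj]] := XY i.
    exists (row i X); split; first exact: rn0 Hj.
    move=> v; rewrite rE => h; apply: ltr_pwDl; last exact: sqr_ge0.
    by rewrite lt_neqAle sqr_ge0 eq_sym sqrf_eq0 h.
  exists (row i Y); split; first exact: rn0 Hj.
  move=> v; rewrite rE => h; apply: ltr_wpDl; first exact: sqr_ge0.
  by rewrite lt_neqAle sqr_ge0 eq_sym sqrf_eq0 h.
have mS i : measurable [set v : 'cV[R]_n | (u i *m v) 0 0 = 0].
  rewrite (_ : [set _ | _] = [set: 'cV[R]_n] `&` (fun v => (u i *m v) 0 0) @^-1` [set 0]).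
    have : measurable_fun [set: 'cV[R]_n] (fun v => (u i *m v) 0 0) by measurable_mx.
    by apply.
  by rewrite setTI.
(* The finite family of hyperplanes is padded by empty sets to a sequence, to be covered by
   countable subadditivity. *)
pose F (k : nat) : set 'cV[R]_n :=
  if insub k is Some i then [set v : 'cV[R]_n | (u i *m v) 0 0 = 0] else set0.
have mF k : measurable (F k) by rewrite /F; case: insub.
exists (\bigcup_k F k); split.
- exact: bigcup_measurable.
- apply/negligibleP; first exact: bigcup_measurable.
  apply: negligible_bigcup => k; apply/negligibleP => //.
  rewrite /F; case: insub => [i|]; last exact: measure0.
  exact: (hyperplane_null _ (Hu i).1).
- move=> v Nv i; apply: (Hu i).2; apply/eqP => h; apply: Nv.
  by exists (val i) => //; rewrite /F valK.
Qed.

End null_sets.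

Section simple_spectrum.
Variable R : realType.

Lemma measurable_cnt_comp d (T : measurableType d) n (f : T -> 'M[R]_n) (l : T -> R) k :
  measurable_fun [set: T] f -> measurable_fun [set: T] l ->
  measurable_fun [set: T] (fun x => cnt (symz (f x)) (l x) == k).
Proof.
move=> mf ml.
rewrite (_ : (fun _ => _) = (fun x => ((cnt (symz (f x)) (l x))%:R : R) == k%:R)); last first.
  by apply/funext => x; rewrite eqr_nat.
apply: measurable_fun_eqr => //.
apply: (measurableT_comp (@measurable_cnt R n) (g := fun x => (f x, l x))).
exact: measurable_fun_pair.
Qed.

(** Eigenvalue [j] lies below [x] exactly when [j < cnt _ x], so the counting function decides. *)
Lemma measurable_eig n j : (j < n)%N ->
  measurable_fun [set: 'M[R]_n] (fun A => nth 0 (eigs (symz A)) j).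
Proof.
move=> jn _; apply: (measurability _ (RGenInftyO.measurableE R)) => //.
move=> _ [_ [x ->] <-]; rewrite setTI.
have mb : measurable_fun [set: 'M[R]_n] (fun A => (j < cnt (symz A) x)%N).
  rewrite (_ : (fun _ => _) = (fun A => (j%:R : R) < (cnt (symz A) x)%:R)); last first.
    by apply/funext => A; rewrite ltr_nat.
  apply: measurable_fun_ltr => //.
  apply: (measurableT_comp (@measurable_cnt R n) (g := fun A => (A, x))).
  by apply: measurable_fun_pair => //; exact: measurable_id.
rewrite (_ : _ @^-1` _ = [set: 'M[R]_n] `&` (fun A => (j < cnt (symz A) x)%N) @^-1` [set true]).
  exact: mb.
rewrite setTI; apply/seteqP; split => A /=; rewrite in_itv /=;
  have [sA szA _] := eigsP (symz_sym A); by rewrite sorted_nth_lt ?szA.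
Qed.

Lemma uniq_eigsE n (A : 'M[R]_n) : uniq (eigs (symz A)) =
  [forall i : 'I_n, forall j : 'I_n, (i < j)%N ==> (nth 0 (eigs (symz A)) i < nth 0 (eigs (symz A)) j)].
Proof.
have [sA szA _] := eigsP (symz_sym A).
apply/idP/forallP => [uA i|H].
  apply/forallP => j; apply/implyP => ij; rewrite lt_neqAle; apply/andP; split.
    by rewrite nth_uniq ?szA // neq_ltn ij.
  by apply: sorted_leq_nth => //; [exact: le_trans|rewrite inE szA|rewrite inE szA|exact: ltnW].
apply/(uniqP 0) => i j; rewrite !inE szA => ilt jlt E.
case: (ltngtP i j) => // ij.
  by have /forallP/(_ (Ordinal jlt))/implyP/(_ ij) := H (Ordinal ilt); rewrite /= E ltxx.
by have /forallP/(_ (Ordinal ilt))/implyP/(_ ij) := H (Ordinal jlt); rewrite /= E ltxx.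
Qed.

Lemma measurable_uniq_eigs n : measurable_fun [set: 'M[R]_n] (fun A => uniq (eigs (symz A))).
Proof.
under eq_fun do rewrite uniq_eigsE.
apply: (measurable_fun_forall R) => i; apply: (measurable_fun_forall R) => j.
case: (i < j)%N => /=; last exact: measurable_cst.
by apply: measurable_fun_ltr; exact: measurable_eig.
Qed.

Definition nonsimple n : set 'M[R]_n := [set A | ~~ uniq (eigs (symz A))].

Lemma measurable_nonsimple n : measurable (@nonsimple n).
Proof.
rewrite (_ : @nonsimple n = [set: 'M[R]_n] `&` (fun A => uniq (eigs (symz A))) @^-1` [set false]).
  exact: measurable_uniq_eigs.
by rewrite setTI; apply/seteqP; split => A /=; rewrite /nonsimple /=; case: uniq.
Qed.

Lemma eq_integral_symm_simple n (f g : 'M[R]_n -> \bar R) :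
  symm R n (@nonsimple n) = 0%E ->
  measurable_fun [set: 'M[R]_n] f -> measurable_fun [set: 'M[R]_n] g ->
  (forall A, 0 <= f A)%E -> (forall A, 0 <= g A)%E ->
  (forall A, A^T = A -> uniq (eigs A) -> f A = g A) ->
  (\int[symm R n]_A f A = \int[symm R n]_A g A)%E.
Proof.
move=> N0 mf mg f0 g0 fg.
pose c (h : 'M[R]_n -> \bar R) A := if uniq (eigs (symz A)) then h A else 0%E.
have mc h : measurable_fun [set: 'M[R]_n] h -> measurable_fun [set: 'M[R]_n] (c h).
  by move=> mh; apply: measurable_fun_ifT => //; exact: measurable_uniq_eigs.
have c0 h A : (forall A, 0 <= h A)%E -> (0 <= c h A)%E by rewrite /c; case: uniq.
have cE h : measurable_fun [set: 'M[R]_n] h -> (forall A, 0 <= h A)%E ->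
    (\int[symm R n]_A h A = \int[symm R n]_A c h A)%E.
  move=> mh h0; apply: (eq_integral_off_null (@measurable_nonsimple n)) => //; first exact: mc.
    by move=> A; exact: c0.
  by move=> A /negP; rewrite negbK /c => ->.
rewrite cE // [RHS]cE //; apply: eq_integral_symm; [exact: mc|exact: mc| | |].
- by move=> A; exact: c0.
- by move=> A; exact: c0.
- by move=> A AT; rewrite /c (symzE AT); case: ifP => // uA; exact: fg.
Qed.

(** By induction on the size: if [A] has simple spectrum and [v] avoids its exceptional hyperplanes,
    strict interlacing makes the bordered matrix simple for every value of the corner. *)
Lemma nonsimple_null n : symm R n (@nonsimple n) = 0%E.
Proof.
have HE m : symm R m (@nonsimple m) =
    (\int[symm R m]_A ((~~ uniq (eigs (symz A)))%:R : R)%:E)%E.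
  rewrite -[in LHS](setIT (@nonsimple m)) -integral_indic //; last exact: measurable_nonsimple.
  apply: eq_integral => A _; rewrite indicE; congr ((nat_of_bool _)%:R%:E).
  by apply/idP/idP; rewrite inE.
have mE m : measurable_fun [set: 'M[R]_m] (fun A => ((~~ uniq (eigs (symz A)))%:R : R)%:E).
  apply/measurable_EFinP; apply: measurable_fun_boolr; apply: measurable_neg.
  exact: measurable_uniq_eigs.
elim: n => [|n IH].
  rewrite HE; apply: integral0_eq => A _.
  have [_ szA _] := eigsP (symz_sym A); by case: (eigs (symz A)) szA.
rewrite HE (integral_symmS_rev (mE _)); last by move=> A; rewrite lee_fin.
have mpar : measurable_fun [set: 'M[R]_n * 'cV[R]_n] (fun w =>
   (\int[lebesgue_measure]_x ((~~ uniq (eigs (symz (bord x w.2 w.1))))%:R : R)%:E)%E).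
  apply: (measurable_integral_param lebesgue_measure
    (fun (w : 'M[R]_n * 'cV[R]_n) (x : measurableTypeR R) =>
      ((~~ uniq (eigs (symz (bord x w.2 w.1))))%:R : R)%:E)).
    apply: (measurableT_comp (mE (1 + n)%N)
      (g := fun z : ('M[R]_n * 'cV[R]_n) * measurableTypeR R => bord z.2 z.1.2 z.1.1)).
    by rewrite /bord; measurable_mx.
  by move=> w x; rewrite lee_fin.
rewrite (eq_integral_symm_simple (g := cst 0%E) IH) ?integral0 //.
- apply: (measurable_integral_param (vecm R n) (fun A v =>
    (\int[lebesgue_measure]_x ((~~ uniq (eigs (symz (bord x v A))))%:R : R)%:E)%E)) => //.
  by move=> A v; apply: integral_ge0 => x _; rewrite lee_fin.
- by move=> A; apply: integral_ge0 => v _; apply: integral_ge0 => x _; rewrite lee_fin.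
move=> A AT uA; have [X [Y [mui XY res]]] := sym_spectral_sorted AT uA.
have [N [mN N0 HN]] := quadratic_null XY.
rewrite (@eq_integral_off_null _ _ _ (vecm R n) N _ (cst 0%E)) ?integral0 //.
- apply: (measurableT_comp mpar (g := fun v => (A, v))).
  by apply: measurable_fun_pair.
- by move=> v; apply: integral_ge0 => x _; rewrite lee_fin.
move=> v Nv; apply: integral0_eq => x _.
rewrite -/(bord x v A) (symzE (bord_sym _ _ AT)) (border_simple AT (HN v Nv) mui) //.
by move=> l ml; have [] := res l v ml.
Qed.

End simple_spectrum.

(** * Splitting off one eigenvalue *)

Section key_theorem.
Variable R : realType.
Local Open Scope ereal_scope.

Lemma measurable_adj d (T : measurableType d) n (f : T -> 'M[R]_n) :
  measurable_fun [set: T] f -> measurable_fun [set: T] (fun x => \adj (f x))%R.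
Proof.
move=> mf; apply: measurable_mxP => i j; under eq_fun do rewrite mxE /cofactor.
apply: measurable_funM => //; apply: measurable_det; apply: measurable_mxP => a b.
by under eq_fun do rewrite !mxE; exact: measurable_fun_entry.
Qed.

Lemma cnt_prod n (M : 'M[R]_n) s t : char_poly M = (\prod_(x <- s) ('X - x%:P))%R ->
  cnt M t = count (fun x => x < t)%R s.
Proof.
move=> Ms; rewrite /cnt (@eigs_unique _ _ M (sort <=%R s)%R) ?count_sort //.
  exact: sort_le_sorted.
by rewrite Ms; apply: perm_big; rewrite perm_sym perm_sort.
Qed.

Definition dsum n (l : R) (B : 'M[R]_n) : 'M[R]_(1 + n) := block_mx l%:M 0 0 B.

Lemma dsum_sym n l (B : 'M[R]_n) : B^T = B -> (dsum l B)^T = dsum l B.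
Proof. by move=> BT; rewrite /dsum tr_block_mx !trmx0 tr_scalar_mx BT. Qed.

Lemma char_poly_dsum n l (B : 'M[R]_n) :
  char_poly (dsum l B) = (('X - l%:P) * char_poly B)%R.
Proof. by rewrite /dsum char_poly_block_diag char_poly_scalar11. Qed.

Lemma cnt_dsum n l (B : 'M[R]_n) t : B^T = B ->
  cnt (dsum l B) t = ((l < t)%R + cnt B t)%N.
Proof.
move=> BT; have [_ _ cB] := eigsP BT.
by rewrite (@cnt_prod _ _ (l :: eigs B)) // char_poly_dsum big_cons -cB.
Qed.

Section branch.
Variables (n k : nat) (g : 'M[R]_(1 + n) -> \bar R).
Hypotheses (mg : measurable_fun [set: 'M[R]_(1 + n)] g) (g0 : forall M, 0 <= g M).

(** The integrand in the coordinate [l], on the branch where exactly [k] eigenvalues of the bordered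
    matrix lie below [l]. Stating the branch by [cnt] makes it jointly measurable in [(A, v, l)];
    the determinant test discards the poles. *)
Definition branch_fun (A : 'M[R]_n) (v : 'cV[R]_n) (l : R) : \bar R :=
  if (\det (A - l%:M) != 0)%R && (cnt (symz (bord (border_shift A v l) v A)) l == k)
  then (border_jac A v l)%:E * g (bord (border_shift A v l) v A) else 0.

Lemma border_jac_ge0 (A : 'M[R]_n) (v : 'cV[R]_n) (l : R) : (0 <= border_jac A v l)%R.
Proof.
rewrite /border_jac addr_ge0 // mxE; apply: sumr_ge0 => i _.
by rewrite !mxE -expr2 sqr_ge0.
Qed.

Lemma branch_fun_ge0 (A : 'M[R]_n) (v : 'cV[R]_n) (l : R) : 0 <= branch_fun A v l.
Proof.
rewrite /branch_fun; case: ifP => // _; apply: mule_ge0 => //.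
by rewrite lee_fin border_jac_ge0.
Qed.

Lemma measurable_branch_fun d (T : measurableType d) (A : T -> 'M[R]_n)
    (v : T -> 'cV[R]_n) (l : T -> R) :
  measurable_fun [set: T] A -> measurable_fun [set: T] v -> measurable_fun [set: T] l ->
  measurable_fun [set: T] (fun t => branch_fun (A t) (v t) (l t)).
Proof.
move=> mA mv ml.
have mAl : measurable_fun [set: T] (fun t => A t - (l t)%:M)%R by measurable_mx.
have mw : measurable_fun [set: T] (fun t =>
   (\det (A t - (l t)%:M))^-1 *: \adj (A t - (l t)%:M) *m v t)%R.
  apply: measurable_mulmx => //; apply: measurable_scalemx; last exact: measurable_adj.
  by apply: (measurableT_comp (@measurable_invr R)); exact: measurable_det.
have ms : measurable_fun [set: T] (fun t => border_shift (A t) (v t) (l t)).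
  rewrite /border_shift; apply: measurable_funD => //; apply: measurable_fun_entry.
  by apply: measurable_mulmx => //; exact: measurable_trmx.
have mj : measurable_fun [set: T] (fun t => border_jac (A t) (v t) (l t)).
  rewrite /border_jac; apply: measurable_funD => //; apply: measurable_fun_entry.
  by apply: measurable_mulmx => //; exact: measurable_trmx.
have mb : measurable_fun [set: T] (fun t => bord (border_shift (A t) (v t) (l t)) (v t) (A t)).
  rewrite /bord; apply: measurable_block_mx => //; first exact: measurable_scalar_mx.
  exact: measurable_trmx.
apply: measurable_fun_ifT => //.
  apply: measurable_and; last exact: measurable_cnt_comp.
  by apply: measurable_neg; apply: measurable_fun_eqr => //; exact: measurable_det.
by apply: emeasurable_funM; [exact/measurable_EFinP|exact: measurableT_comp].
Qed.

(** The secular function already maps gap [k] alone onto the whole line, so one gap yields the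
    complete integral over the corner, and each [k] gives its own formula. *)
Lemma integral_branch (A : 'M[R]_n) (v : 'cV[R]_n) (rho : 'I_n -> R) :
  (k <= n)%N -> A^T = A ->
  let mu (i : 'I_n) := nth 0%R (eigs A) i in
  (forall i, 0 < rho i)%R ->
  (forall i j : 'I_n, (i < j)%N -> mu i < mu j)%R ->
  (forall l, (forall i, mu i != l) ->
     ((v^T *m invmx (A - l%:M) *m v) 0 0 = \sum_i rho i / (mu i - l))%R /\
     ((v^T *m invmx (A - l%:M) *m invmx (A - l%:M) *m v) 0 0 =
       \sum_i rho i / (mu i - l) ^+ 2)%R) ->
  \int[lebesgue_measure]_a g (bord a v A) = \int[lebesgue_measure]_l branch_fun A v l.
Proof.
move=> kn AT mu r0 mui res.
have res1 l ml := (res l ml).1; have res2 l ml := (res l ml).2.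
have mgb : measurable_fun [set: R] (fun a => g (bord a v A)).
  by apply: (measurableT_comp mg); rewrite /bord; measurable_mx.
have sub := ge0_integral_substitution (@open_gap R n mu k) (@is_interval_gap R n mu k)
  (fun x gx => @is_derive_secular R n mu rho x (fun i => gap_neq i gx))
  (fun x gx => @continuous_dsecular R n mu rho x (fun i => gap_neq i gx))
  (fun x gx => le_trans ler01 (@dsecular_ge1 R n mu rho x (fun i => ltW (r0 i))))
  (fun x y => @secular_incr _ _ mu rho k x y (fun i => ltW (r0 i)))
  (fun y => secular_surj y mui r0 kn) mgb (fun a => g0 (bord a v A)).
rewrite sub integral_mkcond; apply: eq_integral => l _; rewrite patchE.
rewrite /branch_fun; have [/forallP ml|] := boolP [forall i, mu i != l]; last first.
  move=> nl; have := nl; rewrite -(unitmx_sub_scalar AT) unitmxE unitfE negbK => ->.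
  case: ifPn => // /[!inE] gl; move: nl; rewrite negb_forall => /existsP[ i ].
  by rewrite (gap_neq i gl).
have uA : (A - l%:M)%R \in unitmx by rewrite (unitmx_sub_scalar AT); exact/forallP.
have -> : (\det (A - l%:M) != 0)%R by rewrite -unitfE -unitmxE.
have rE : ((\det (A - l%:M))^-1 *: \adj (A - l%:M))%R = invmx (A - l%:M)%R by rewrite /invmx uA.
have sE : border_shift A v l = secular mu rho l.
  by rewrite /border_shift rE mulmxA res1.
have jE : border_jac A v l = dsecular mu rho l.
  rewrite /border_jac rE trmx_mul trmx_inv raddfB /= tr_scalar_mx AT mulmxA.
  by rewrite res2.
have gl := gapP AT ml.
have jn : (cnt A l <= n)%N.
  by have [_ szA _] := eigsP AT; rewrite /cnt -[X in (_ <= X)%N]szA count_size.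
rewrite sE jE symzE ?bord_sym // (cnt_border AT r0 mui res1 jn gl) /=.
(* Gaps of different index are disjoint, and [l] lies in the gap numbered [cnt A l]. *)
have -> : (cnt A l == k) = (l \in gap mu k).
  apply/eqP/idP => [<-|]; first by rewrite inE.
  rewrite inE => gk; case: (ltngtP (cnt A l) k) => // h; exfalso.
    have hn := leq_trans h kn; have := gl (Ordinal hn); have := gk (Ordinal hn).
    by rewrite /= ltnn h => h1 /(lt_trans h1); rewrite ltxx.
  have hn := leq_trans h jn; have := gl (Ordinal hn); have := gk (Ordinal hn).
  by rewrite /= ltnn h => h1 h2; have := lt_trans h1 h2; rewrite ltxx.
by case: ifP.
Qed.

End branch.
End key_theorem.

Section key.
Variable R : realType.
Local Open Scope ereal_scope.

Definition spectral n (g : 'M[R]_n -> \bar R) :=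
  forall M N : 'M[R]_n, M^T = M -> N^T = N -> char_poly M = char_poly N -> g M = g N.

Definition sqnorm n (w : 'cV[R]_n) : R := (w^T *m w)%R 0%R 0%R.

Lemma sqnorm_ge0 n (w : 'cV[R]_n) : (0 <= sqnorm w)%R.
Proof.
by rewrite /sqnorm mxE; apply: sumr_ge0 => i _; rewrite !mxE -expr2 sqr_ge0.
Qed.

Lemma measurable_sqnorm d (T : measurableType d) n (w : T -> 'cV[R]_n) :
  measurable_fun [set: T] w -> measurable_fun [set: T] (fun t => sqnorm (w t)).
Proof. by move=> mw; rewrite /sqnorm; measurable_mx. Qed.

Lemma trmxN m n (A : 'M[R]_(m, n)) : ((- A)^T = - A^T)%R.
Proof. by apply/matrixP => i j; rewrite !mxE. Qed.

Lemma sub_scalar_sym n l (A : 'M[R]_n) : A^T = A -> ((A - l%:M)^T = A - l%:M)%R.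
Proof. by move=> AT; rewrite linearB /= tr_scalar_mx AT. Qed.

(* In the coordinate [w = - (A - l)^-1 v] the bordered matrix minus [l] is
   congruent to [A - l] through a [(1 + n) x n] matrix. *)
Definition inflate n (l : R) (A : 'M[R]_n) (w : 'cV[R]_n) : 'M[R]_(1 + n) :=
  let K : 'M[R]_(1 + n, n) := col_mx (- w^T) 1%:M in
  (l%:M + K *m (A - l%:M) *m K^T)%R.

Lemma measurable_inflate d (T : measurableType d) n (l : T -> R) (A : T -> 'M[R]_n)
    (w : T -> 'cV[R]_n) :
  measurable_fun [set: T] l -> measurable_fun [set: T] A -> measurable_fun [set: T] w ->
  measurable_fun [set: T] (fun t => inflate (l t) (A t) (w t)).
Proof. by move=> ml mA mw; rewrite /inflate; measurable_mx. Qed.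

Lemma inflateE n l (A : 'M[R]_n) (w : 'cV[R]_n) : A^T = A ->
  inflate l A w =
  bord (l + (w^T *m (A - l%:M) *m w) 0 0)%R (- (A - l%:M) *m w)%R A.
Proof.
move=> AT; rewrite /inflate /bord tr_col_mx trmxN trmxK tr_scalar_mx.
rewrite mul_col_mx mul1mx mul_col_row (scalar_mx_block 1 n) add_block_mx !add0r !mulmx1.
congr block_mx.
- by rewrite !mulNmx mulmxN opprK [in LHS](mx11_scalar (_ *m w)) -raddfD.
- by rewrite !mulNmx trmxN trmx_mul (sub_scalar_sym _ AT).
- by rewrite mulmxN mulNmx.
- by rewrite addrC subrK.
Qed.

Lemma inflate_sym n l (A : 'M[R]_n) (w : 'cV[R]_n) : A^T = A ->
  (inflate l A w)^T = inflate l A w.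
Proof. by move=> AT; rewrite inflateE // bord_sym. Qed.

(* The mass of the weight left on the direction of the eigenvector [(1, w)]. *)
Definition cvol n : \bar R :=
  \int[vecm R n]_w ((Num.sqrt (1 + sqnorm w) ^+ n.+1)^-1)%:E.

Section fixed.
Variables (n k : nat) (g : 'M[R]_(1 + n) -> \bar R).
Hypotheses (mg : measurable_fun [set: 'M[R]_(1 + n)] g) (g0 : forall M, 0 <= g M).
Hypothesis (sg : spectral g).

Definition cut (l : R) (M : 'M[R]_(1 + n)) : \bar R :=
  if cnt (symz M) l == k then g M else 0.

Lemma cut_ge0 l M : 0 <= cut l M.
Proof. by rewrite /cut; case: ifP. Qed.

Lemma norm_cut_ge0 (x : R) l M : 0 <= `|x|%:E * cut l M.
Proof. by apply: mule_ge0; [rewrite lee_fin|exact: cut_ge0]. Qed.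

Lemma measurable_cut d (T : measurableType d) (l : T -> R) (M : T -> 'M[R]_(1 + n)) :
  measurable_fun [set: T] l -> measurable_fun [set: T] M ->
  measurable_fun [set: T] (fun t => cut (l t) (M t)).
Proof.
move=> ml mM; apply: measurable_fun_ifT => //; first exact: measurable_cnt_comp.
exact: measurableT_comp.
Qed.

(** In the coordinate [w] the resolvents cancel: [border_jac] becomes [1 + sqnorm w] and the
    bordered matrix becomes polynomial in [A] and [w], so no pole remains. *)
Lemma integral_branch_fun_vec l (A : 'M[R]_n) : A^T = A ->
  \int[vecm R n]_v branch_fun k g A v l =
  `|\det (A - l%:M)|%:E *
    \int[vecm R n]_w ((1 + sqnorm w)%:E * cut l (inflate l A w)).
Proof.
move=> AT; have [d0|d0] := eqVneq (\det (A - l%:M)%R) 0%R.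
  rewrite d0 normr0 mul0e; apply: integral0_eq => v _.
  by rewrite /branch_fun d0 eqxx.
have uA : (A - l%:M)%R \in unitmx by rewrite unitmxE unitfE.
have uP : (- (A - l%:M))%R \in unitmx.
  by rewrite -scaleN1r unitmxE detZ unitrM unitrX ?unitrN1 // -unitmxE.
rewrite (vec_change_unit uP); last 2 first.
- by apply: measurable_branch_fun => //; exact: measurable_cst.
- by move=> v; exact: branch_fun_ge0.
rewrite -[X in `|\det X|%R]scaleN1r detZ normrM normrX normrN1 expr1n mul1r.
congr (_ * _); apply: eq_integral => w _.
have rE : ((\det (A - l%:M))^-1 *: \adj (A - l%:M))%R = invmx (A - l%:M)%R by rewrite /invmx uA.
have uE : (invmx (A - l%:M) *m (- (A - l%:M) *m w) = - w)%R.
  by rewrite mulNmx mulmxN mulKmx.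
rewrite /branch_fun d0 /= /border_jac /border_shift rE uE /cut inflateE //.
have -> : ((- (A - l%:M) *m w)^T *m - w = w^T *m (A - l%:M) *m w)%R.
  by rewrite mulNmx trmxN mulNmx mulmxN opprK trmx_mul (sub_scalar_sym _ AT).
have -> : ((- w)^T *m - w = w^T *m w)%R by rewrite trmxN mulNmx mulmxN opprK.
by case: ifP => // _; rewrite mule0.
Qed.

(** Power count with [d^2 = 1 + sqnorm w]: passing from [det (A - l)] to [det (B - l)] costs [d^-2],
    which cancels the prefactor, and the congruence by [Q] leaves [d^-(n+1)]. The cut is unchanged
    because both matrices have the same characteristic polynomial. *)
Lemma integral_cut_inflate l (w : 'cV[R]_n) :
  (1 + sqnorm w)%:E * \int[symm R n]_A (`|\det (A - l%:M)|%:E * cut l (inflate l A w)) =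
  ((Num.sqrt (1 + sqnorm w) ^+ n.+1)^-1)%:E *
    \int[symm R n]_B (`|\det (B - l%:M)|%:E * cut l (dsum l B)).
Proof.
have [Q [uQ cQ QQ dQ]] := upper_gram_factor w.
pose psi (B : 'M[R]_n) := `|\det (B - l%:M)|%:E * cut l (dsum l B).
have mpsi : measurable_fun [set: 'M[R]_n] psi.
  apply: emeasurable_funM; first by measurable_mx.
  by apply: measurable_cut; [exact: measurable_cst|rewrite /dsum; measurable_mx].
have psi0 B : 0 <= psi B by exact: norm_cut_ge0.
pose d := `|\det Q|%R.
have d_gt0 : (0 < d)%R by rewrite normr_gt0 -unitfE -unitmxE.
have dd : (d ^+ 2 = 1 + sqnorm w)%R by rewrite /d real_normK ?num_real // dQ.
have dsqrt : Num.sqrt (1 + sqnorm w)%R = d by rewrite -dd sqrtr_sqr ger0_norm // ltW.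
have step1 : \int[symm R n]_A (`|\det (A - l%:M)|%:E * cut l (inflate l A w)) =
    \int[symm R n]_A ((d ^- 2)%:E * psi (l%:M + Q *m (A - l%:M) *m Q^T)%R).
  apply: eq_integral_symm.
  - apply: emeasurable_funM; first by measurable_mx.
    apply: measurable_cut; first exact: measurable_cst.
    by apply: measurable_inflate.
  - apply: emeasurable_funM => //; apply: (measurableT_comp mpsi); measurable_mx.
  - by move=> A; exact: norm_cut_ge0.
  - by move=> A; apply: mule_ge0 => //; rewrite lee_fin invr_ge0 exprn_ge0 ?ltW.
  move=> A AT.
  set B := (l%:M + Q *m (A - l%:M) *m Q^T)%R.
  have BT : B^T = B.
    by rewrite /B raddfD /= tr_scalar_mx !trmx_mul trmxK (sub_scalar_sym _ AT) mulmxA.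
  have Bl : (B - l%:M = Q *m (A - l%:M) *m Q^T)%R by rewrite /B addrC addKr.
  have cut_eq : cut l (inflate l A w) = cut l (dsum l B).
    have cp : char_poly (inflate l A w) = char_poly (dsum l B).
      exact: (char_poly_rank_deflation _ _ uQ QQ).
    rewrite /cut !symzE ?inflate_sym ?dsum_sym //.
    rewrite (sg (inflate_sym _ _ AT) (dsum_sym _ BT) cp).
    by rewrite /cnt (eigs_char_poly cp).
  rewrite cut_eq /psi muleA; congr (_ * _).
  rewrite Bl !det_mulmx det_tr !normrM -EFinM; congr (_%:E).
  by rewrite -/d mulrAC -expr2 mulrA mulVf ?mul1r // expf_neq0 // gt_eqF.
rewrite step1 ge0_integralZl //; last 2 first.
- by apply: (measurableT_comp mpsi); measurable_mx.
- by rewrite lee_fin invr_ge0 exprn_ge0 ?ltW.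
have mpsiQ : measurable_fun [set: 'M[R]_n] (fun A => psi (l%:M + A)%R).
  by apply: (measurableT_comp mpsi); measurable_mx.
have -> : \int[symm R n]_A psi (l%:M + Q *m (A - l%:M) *m Q^T)%R =
    \int[symm R n]_A psi (l%:M + Q *m A *m Q^T)%R.
  have mQl : measurable_fun [set: 'M[R]_n] (fun A => psi (l%:M + Q *m (A - l%:M) *m Q^T)%R).
    by apply: (measurableT_comp mpsi); measurable_mx.
  rewrite [LHS](integral_symm_translate l mQl (fun _ => psi0 _)).
  by apply: eq_integral => A _; rewrite addrK.
have psiE : \int[symm R n]_A psi A = (d ^+ n.+1)%:E * \int[symm R n]_A psi (l%:M + Q *m A *m Q^T)%R.
  rewrite -(cQ _ mpsiQ (fun _ => psi0 _)) [LHS](integral_symm_translate l mpsi psi0).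
  by apply: eq_integral => A _; rewrite addrC.
rewrite -/psi psiE dsqrt -dd !muleA -!EFinM; congr (_%:E * _).
by rewrite mulfV ?mulVf // expf_neq0 // gt_eqF.
Qed.

(** Applied with a fixed [k] it isolates one ordered eigenvalue; added up over all [k] and iterated
    it gives the joint density. *)
Theorem integral_symm_deflate : (k <= n)%N ->
  \int[symm R n.+1]_M g M =
  cvol n * \int[lebesgue_measure]_l \int[symm R n]_B
     (`|\det (B - l%:M)|%:E * (if cnt (symz B) l == k then g (dsum l B) else 0)).
Proof.
move=> kn; rewrite (integral_symmS_rev mg g0).
have mb3 : measurable_fun [set: 'M[R]_n * ('cV[R]_n * measurableTypeR R)]
    (fun w => branch_fun k g w.1 w.2.1 w.2.2).
  by apply: measurable_branch_fun => //; measurable_mx.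
have mb2 (A : 'M[R]_n) : measurable_fun [set: 'cV[R]_n]
    (fun v => \int[lebesgue_measure]_l branch_fun k g A v l).
  apply: (measurable_integral_param lebesgue_measure
    (fun (v : 'cV[R]_n) (l : measurableTypeR R) => branch_fun k g A v l)).
    by apply: measurable_branch_fun => //; measurable_mx.
  by move=> v l; exact: branch_fun_ge0.
have mg2 : measurable_fun [set: 'M[R]_n * 'cV[R]_n]
    (fun w => \int[lebesgue_measure]_x g (bord x w.2 w.1)).
  apply: (measurable_integral_param lebesgue_measure
    (fun (w : 'M[R]_n * 'cV[R]_n) (x : measurableTypeR R) => g (bord x w.2 w.1))) => //.
  by apply: (measurableT_comp mg); rewrite /bord; measurable_mx.
(* For [A] with simple spectrum and almost every [v] all weights of the secular function are
   positive, so the corner can be traded for [l]. *)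
transitivity (\int[symm R n]_A \int[vecm R n]_v \int[lebesgue_measure]_l branch_fun k g A v l).
  apply: eq_integral_symm_simple; first exact: nonsimple_null.
  - apply: (measurable_integral_param (vecm R n) (fun A v =>
      \int[lebesgue_measure]_x g (bord x v A))) => //.
    by move=> A v; exact: integral_ge0.
  - apply: (measurable_integral_param (vecm R n) (fun A v =>
      \int[lebesgue_measure]_l branch_fun k g A v l)).
      apply: (measurable_integral_param lebesgue_measure
        (fun (w : 'M[R]_n * 'cV[R]_n) (l : measurableTypeR R) => branch_fun k g w.1 w.2 l)).
        by apply: measurable_branch_fun => //; measurable_mx.
      by move=> w l; exact: branch_fun_ge0.
    by move=> A v; apply: integral_ge0 => l _; exact: branch_fun_ge0.
  - by move=> A; apply: integral_ge0 => v _; exact: integral_ge0.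
  - by move=> A; apply: integral_ge0 => v _; apply: integral_ge0 => l _; exact: branch_fun_ge0.
  move=> A AT uA; have [X [Y [mui XY res]]] := sym_spectral_sorted AT uA.
  have [N [mN N0 HN]] := quadratic_null XY.
  apply: (eq_integral_off_null mN N0).
  - apply: (measurableT_comp mg2 (g := fun v => (A, v))).
    by apply: measurable_fun_pair.
  - exact: mb2.
  - by move=> v; exact: integral_ge0.
  - by move=> v; apply: integral_ge0 => l _; exact: branch_fun_ge0.
  move=> v Nv; apply: (integral_branch mg g0 kn AT (HN v Nv) mui) => l ml.
  exact: res.
rewrite (tonelli_rev3 (symm R n) (vecm R n) lebesgue_measure mb3); last first.
  by move=> A v l; exact: branch_fun_ge0.
have mcut3 : measurable_fun [set: (measurableTypeR R * 'cV[R]_n) * 'M[R]_n]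
    (fun z => `|\det (z.2 - z.1.1%:M)|%:E * cut z.1.1 (inflate z.1.1 z.2 z.1.2)).
  apply: emeasurable_funM; first by measurable_mx.
  by apply: measurable_cut; [measurable_mx|apply: measurable_inflate; measurable_mx].
have mdsum : measurable_fun [set: measurableTypeR R * 'M[R]_n]
    (fun z => `|\det (z.2 - z.1%:M)|%:E * cut z.1 (dsum z.1 z.2)).
  apply: emeasurable_funM; first by measurable_mx.
  by apply: measurable_cut; [measurable_mx|rewrite /dsum; measurable_mx].
have mPsi : measurable_fun [set: measurableTypeR R]
    (fun l => \int[symm R n]_B (`|\det (B - l%:M)|%:E * cut l (dsum l B))).
  apply: (measurable_integral_param (symm R n) (fun (l : measurableTypeR R) B =>
     `|\det (B - l%:M)|%:E * cut l (dsum l B))) => //.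
  by move=> l B; exact: norm_cut_ge0.
have Psi0 l : 0 <= \int[symm R n]_B (`|\det (B - l%:M)|%:E * cut l (dsum l B)).
  by apply: integral_ge0 => B _; exact: norm_cut_ge0.
have sqinv0 w : 0 <= ((Num.sqrt (1 + @sqnorm n w) ^+ n.+1)^-1)%:E.
  by rewrite lee_fin invr_ge0 exprn_ge0 ?sqrtr_ge0.
have cvol0 : 0 <= cvol n by apply: integral_ge0 => w _; exact: sqinv0.
transitivity (\int[lebesgue_measure]_l (cvol n *
   \int[symm R n]_B (`|\det (B - l%:M)|%:E * cut l (dsum l B)))); last first.
  rewrite (ge0_integralZl _ measurableT mPsi (fun l _ => Psi0 l) cvol0).
  apply: (congr1 (fun z => cvol n * z)); apply: eq_integral => l _.
  apply: eq_integral_symm.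
  - by apply: (measurableT_comp mdsum (g := fun B => (l, B))); exact: measurable_fun_pair.
  - apply: emeasurable_funM; first by measurable_mx.
    apply: measurable_fun_ifT => //.
      by apply: measurable_cnt_comp => //; exact: measurable_id.
    by apply: (measurableT_comp mg); rewrite /dsum; measurable_mx.
  - by move=> B; exact: norm_cut_ge0.
  - by move=> B; apply: mule_ge0; [rewrite lee_fin|case: ifP].
  (* The comparison in [cnt] is strict, so the summand [l] does not count itself and the condition
     passes to [B]. *)
  move=> B BT; rewrite /cut !symzE ?dsum_sym //.
  by rewrite cnt_dsum // ltxx add0n.
apply: eq_integral => l _.
transitivity (\int[symm R n]_A \int[vecm R n]_v branch_fun k g A v l).
  rewrite (tonelli_swap (vecm R n) (symm R n) (fun v A => branch_fun k g A v l)) //.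
    by apply: measurable_branch_fun => //; measurable_mx.
  by move=> v A; exact: branch_fun_ge0.
have mw1 : measurable_fun [set: 'M[R]_n * 'cV[R]_n]
    (fun z => (1 + sqnorm z.2)%:E * cut l (inflate l z.1 z.2)).
  apply: emeasurable_funM.
    apply/measurable_EFinP; apply: measurable_funD => //; apply: measurable_sqnorm.
    exact: measurable_snd.
  apply: measurable_cut; first exact: measurable_cst.
  by apply: measurable_inflate; [exact: measurable_cst|exact: measurable_fst|exact: measurable_snd].
have w10 A w : 0 <= (1 + sqnorm w)%:E * cut l (inflate l A w).
  by apply: mule_ge0; [rewrite lee_fin addr_ge0 ?sqnorm_ge0|exact: cut_ge0].
have md : measurable_fun [set: 'M[R]_n] (fun A => `|\det (A - l%:M)|%:E) by measurable_mx.
transitivity (\int[symm R n]_A (`|\det (A - l%:M)|%:E *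
    \int[vecm R n]_w ((1 + sqnorm w)%:E * cut l (inflate l A w)))).
  apply: eq_integral_symm.
  - apply: (measurable_integral_param (vecm R n) (fun A v => branch_fun k g A v l)).
      by apply: measurable_branch_fun => //; measurable_mx.
    by move=> A v; exact: branch_fun_ge0.
  - apply: emeasurable_funM => //.
    exact: (measurable_integral_param (vecm R n) (fun A w =>
      (1 + sqnorm w)%:E * cut l (inflate l A w)) mw1 w10).
  - by move=> A; apply: integral_ge0 => v _; exact: branch_fun_ge0.
  - move=> A; apply: mule_ge0; first by rewrite lee_fin.
    by apply: integral_ge0 => w _.
  by move=> A AT; exact: integral_branch_fun_vec.
transitivity (\int[symm R n]_A \int[vecm R n]_w ((1 + sqnorm w)%:E *
    (`|\det (A - l%:M)|%:E * cut l (inflate l A w)))).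
  apply: eq_integral => A _.
  have mw1A : measurable_fun [set: 'cV[R]_n] (fun w => (1 + sqnorm w)%:E * cut l (inflate l A w)).
    by apply: (measurableT_comp mw1 (g := fun w => (A, w))); exact: measurable_fun_pair.
  have d0 : 0 <= `|\det (A - l%:M)|%:E by rewrite lee_fin.
  rewrite -(ge0_integralZl _ measurableT mw1A (fun w _ => w10 A w) d0).
  by apply: eq_integral => w _; rewrite muleCA.
rewrite (tonelli_swap (symm R n) (vecm R n) (fun A w => (1 + sqnorm w)%:E *
    (`|\det (A - l%:M)|%:E * cut l (inflate l A w)))); last 2 first.
- apply: emeasurable_funM.
    apply/measurable_EFinP; apply: measurable_funD => //; apply: measurable_sqnorm.
    exact: measurable_snd.
  apply: emeasurable_funM; first by measurable_mx.
  apply: measurable_cut; first exact: measurable_cst.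
  by apply: measurable_inflate; [exact: measurable_cst|exact: measurable_fst|exact: measurable_snd].
- move=> A w; apply: mule_ge0; first by rewrite lee_fin addr_ge0 ?sqnorm_ge0.
  by exact: norm_cut_ge0.
transitivity (\int[vecm R n]_w (((Num.sqrt (1 + sqnorm w) ^+ n.+1)^-1)%:E *
    \int[symm R n]_B (`|\det (B - l%:M)|%:E * cut l (dsum l B)))).
  apply: eq_integral => w _; rewrite -integral_cut_inflate.
  have mcw : measurable_fun [set: 'M[R]_n] (fun A => `|\det (A - l%:M)|%:E * cut l (inflate l A w)).
    by apply: (measurableT_comp mcut3 (g := fun A => ((l, w), A))); exact: measurable_fun_pair.
  have w0 : 0 <= (1 + sqnorm w)%:E by rewrite lee_fin addr_ge0 ?sqnorm_ge0.
  by rewrite (ge0_integralZl _ measurableT mcw (fun A _ => norm_cut_ge0 _ _ _) w0).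
have msq : measurable_fun [set: 'cV[R]_n] (fun w => ((Num.sqrt (1 + sqnorm w) ^+ n.+1)^-1)%:E).
  apply/measurable_EFinP; apply: (measurableT_comp (@measurable_invr R)).
  apply: measurable_funX; apply: (measurableT_comp (continuous_measurable_fun (@sqrt_continuous R))).
  by apply: measurable_funD => //; apply: measurable_sqnorm; exact: measurable_id.
by rewrite (ge0_integralZr _ measurableT msq (fun w _ => sqinv0 w) (Psi0 l)).
Qed.

End fixed.
End key.

(** * Joint density of the eigenvalues *)

Section joint_density.
Variable R : realType.
Local Open Scope ereal_scope.

Lemma measurable_det_dsum n (g : 'M[R]_(1 + n) -> \bar R) :
  measurable_fun [set: 'M[R]_(1 + n)] g ->
  measurable_fun [set: measurableTypeR R * 'M[R]_n]
    (fun z => `|\det (z.2 - z.1%:M)|%:E * g (dsum z.1 z.2)).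
Proof.
move=> mg; apply: emeasurable_funM; first by measurable_mx.
by apply: (measurableT_comp mg); rewrite /dsum; measurable_mx.
Qed.

Lemma natmul_sume n (x : \bar R) : 0 <= x -> n%:R%:E * x = \sum_(k < n) x.
Proof.
move=> x0; elim: n => [|n IH]; first by rewrite mul0e big_ord0.
by rewrite big_ord_recr /= -IH -[in LHS]addn1 natrD EFinD ge0_muleDl ?mul1e ?lee_fin.
Qed.

(** Each of the [n + 1] branches computes the same integral, whence the factor on the left; on the
    right the conditions on [cnt] are exclusive and cover every [B]. *)
Lemma integral_symm_deflate_all n (g : 'M[R]_(1 + n) -> \bar R) :
  measurable_fun [set: 'M[R]_(1 + n)] g -> (forall M, 0 <= g M) -> spectral g ->
  n.+1%:R%:E * \int[symm R n.+1]_M g M =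
  cvol R n * \int[lebesgue_measure]_l \int[symm R n]_B
    (`|\det (B - l%:M)|%:E * g (dsum l B)).
Proof.
move=> mg g0 sg.
pose f (k : nat) (l : R) (B : 'M[R]_n) :=
  `|\det (B - l%:M)|%:E * (if cnt (symz B) l == k then g (dsum l B) else 0).
have mf k : measurable_fun [set: measurableTypeR R * 'M[R]_n] (fun z => f k z.1 z.2).
  apply: emeasurable_funM; first by measurable_mx.
  apply: measurable_fun_ifT => //.
    by apply: measurable_cnt_comp; [exact: measurable_snd|exact: measurable_fst].
  by apply: (measurableT_comp mg); rewrite /dsum; measurable_mx.
have f0 k l B : 0 <= f k l B by apply: mule_ge0; [rewrite lee_fin|case: ifP].
have mfl k (l : R) : measurable_fun [set: 'M[R]_n] (f k l).
  by apply: (measurableT_comp (mf k) (g := fun B => (l, B))); exact: measurable_fun_pair.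
have mfi k : measurable_fun [set: measurableTypeR R] (fun l => \int[symm R n]_B f k l B).
  exact: (measurable_integral_param (symm R n) (f k) (mf k) (f0 k)).
transitivity (\sum_(k < n.+1) \int[symm R n.+1]_M g M).
  by rewrite natmul_sume //; apply: integral_ge0 => M _.
rewrite (eq_bigr (fun k : 'I_n.+1 => cvol R n * \int[lebesgue_measure]_l \int[symm R n]_B f k l B)); last first.
  by move=> k _; apply: (integral_symm_deflate mg g0 sg); rewrite -ltnS.
rewrite -ge0_sume_distrr; last first.
  by move=> k _; apply: integral_ge0 => l _; apply: integral_ge0 => B _; exact: f0.
apply: (congr1 (fun z => cvol R n * z)).
rewrite -ge0_integral_sum //; last first.
  by move=> k l _; apply: integral_ge0 => B _; exact: f0.
apply: eq_integral => l _.
rewrite -ge0_integral_sum //.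
apply: eq_integral => B _.
have kn : (cnt (symz B) l < n.+1)%N.
  have [_ szB _] := eigsP (symz_sym B).
  by rewrite ltnS /cnt -[X in (_ <= X)%N]szB count_size.
rewrite (bigD1 (Ordinal kn)) //= big1 ?adde0; first by rewrite /f /= eqxx.
by move=> k kk; rewrite /f ifF ?mule0 //; apply: contraNF kk => /eqP e; apply/eqP/val_inj.
Qed.

Lemma norm_det_sub_scalar n (M : 'M[R]_n) (l : R) :
  `|\det (M - l%:M)|%R = `|(char_poly M).[l]|%R.
Proof.
rewrite horner_char_poly -[X in _ = `|\det X|%R]opprB -[X in _ = `|\det X|%R]scaleN1r.
by rewrite detZ normrM normrX normrN1 expr1n mul1r.
Qed.

Definition diagv n (x : 'cV[R]_n) : 'M[R]_n := diag_mx x^T.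

Definition vdm n (x : 'cV[R]_n) : R :=
  (\prod_(i < n) \prod_(j < n | (i < j)%N) (x j 0 - x i 0))%R.

Lemma cons_col0 n (l : R) (y : 'cV[R]_n) :
  (col_mx l%:M y : 'cV[R]_(1 + n)) ord0 0%R = l.
Proof.
rewrite (_ : ord0 = lshift n (ord0 : 'I_1)); last exact/val_inj.
by rewrite (col_mxEu (l%:M : 'cV[R]_1)) mxE eqxx mulr1n.
Qed.

Lemma cons_colS n (l : R) (y : 'cV[R]_n) (j : 'I_n) :
  (col_mx l%:M y : 'cV[R]_(1 + n)) (lift ord0 j) 0%R = y j 0%R.
Proof.
rewrite (_ : lift ord0 j = rshift 1 j); last exact/val_inj.
by rewrite (col_mxEd (l%:M : 'cV[R]_1)).
Qed.

Lemma vdm_cons n (l : R) (y : 'cV[R]_n) :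
  vdm (col_mx l%:M y) = (\prod_j (y j 0 - l) * vdm y)%R.
Proof.
rewrite /vdm big_ord_recl; congr (_ * _)%R.
  rewrite big_mkcond big_ord_recl /= mul1r; apply: eq_bigr => j _.
  by rewrite cons_col0 cons_colS.
apply: eq_bigr => i _; rewrite big_mkcond big_ord_recl /= mul1r [RHS]big_mkcond.
by apply: eq_bigr => j _; rewrite !cons_colS.
Qed.

Lemma diagv_cons n (l : R) (y : 'cV[R]_n) : diagv (col_mx l%:M y) = dsum l (diagv y).
Proof.
rewrite /diagv /dsum tr_col_mx tr_scalar_mx diag_mx_row.
congr block_mx; apply/matrixP => i j; rewrite !mxE !ord1 eqxx !mulr1n.
by [].
Qed.

Lemma det_diagv_sub n (l : R) (y : 'cV[R]_n) :
  \det (diagv y - l%:M)%R = (\prod_j (y j 0 - l))%R.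
Proof.
have -> : (diagv y - l%:M)%R = diag_mx (\row_j (y j 0 - l))%R.
  apply/matrixP => i j; rewrite !mxE; case: eqP => [->|]; rewrite ?mulr1n //.
  by rewrite !mulr0n subr0.
by rewrite det_diag; apply: eq_bigr => j _; rewrite mxE.
Qed.

Lemma diagv_sym n (x : 'cV[R]_n) : (diagv x)^T = diagv x.
Proof. by rewrite /diagv tr_diag_mx. Qed.

Lemma measurable_diagv d (T : measurableType d) n (x : T -> 'cV[R]_n) :
  measurable_fun [set: T] x -> measurable_fun [set: T] (fun t => diagv (x t)).
Proof.
move=> mx; apply: measurable_mxP => i j; under eq_fun do rewrite !mxE.
by case: (i == j) => /=; [exact: measurable_fun_entry|exact: measurable_cst].
Qed.

Lemma measurable_vdm n : measurable_fun [set: 'cV[R]_n] (@vdm n).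
Proof.
rewrite /vdm; apply: measurable_prod => i _; under eq_fun do rewrite big_mkcond.
apply: measurable_prod => j _ /=; case: (i < j)%N; last exact: measurable_cst.
by apply: measurable_funB; apply: measurable_fun_entry; exact: measurable_id.
Qed.

Fixpoint cprod n : \bar R := if n is m.+1 then cvol R m * cprod m else 1.

Lemma cvol_ge0 n : 0 <= cvol R n.
Proof. by apply: integral_ge0 => w _; rewrite lee_fin invr_ge0 exprn_ge0 ?sqrtr_ge0. Qed.

Lemma cprod_ge0 n : 0 <= cprod n.
Proof. by elim: n => //= n IH; apply: mule_ge0 => //; exact: cvol_ge0. Qed.

(** At [B = diagv y] the factor [|det (B - l)|] is the product of the [|y j - l|], exactly what
    [|vdm|] gains when [l] is put in front of [y]. The factorial collects the branch counts
    [n, n - 1, ..., 1]. *)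
Lemma integral_symm_spectral n (g : 'M[R]_n -> \bar R) :
  measurable_fun [set: 'M[R]_n] g -> (forall M, 0 <= g M) -> spectral g ->
  n`!%:R%:E * \int[symm R n]_M g M =
  cprod n * \int[vecm R n]_x (`|vdm x|%:E * g (diagv x)).
Proof.
elim: n g => [|n IH] g mg g0 sg.
  rewrite fact0 !mul1e integral_symm0 // integral_vecm0; last first.
    by move=> y; apply: mule_ge0; rewrite ?lee_fin.
  rewrite /vdm big_ord0 normr1 mul1e; congr g.
  by rewrite [RHS]flatmx0.
move: g mg g0 sg; rewrite -[n.+1]/(1 + n)%N => g mg g0 sg.
rewrite factS mulnC natrM EFinM -muleA (integral_symm_deflate_all mg g0 sg) muleCA /=.
rewrite -muleA; apply: (congr1 (fun z => cvol R n * z)).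
have mdd := measurable_det_dsum mg.
have dd0 l B : 0 <= `|\det (B - l%:M)|%:E * @g (dsum l B).
  by apply: mule_ge0 => //; rewrite lee_fin.
have mdl (l : R) : measurable_fun [set: 'M[R]_n] (fun B => `|\det (B - l%:M)|%:E * g (dsum l B)).
  by apply: (measurableT_comp mdd (g := fun B => (l, B))); exact: measurable_fun_pair.
have mi := measurable_integral_param (symm R n) (fun (l : measurableTypeR R) (B : 'M[R]_n) =>
  `|\det (B - l%:M)|%:E * g (dsum l B)) mdd dd0.
have mv : measurable_fun [set: 'cV[R]_(1 + n)] (fun x => `|vdm x|%:E * g (diagv x)).
  apply: emeasurable_funM.
    by apply: measurable_EFin_fun; apply: measurable_norm_fun; exact: measurable_vdm.
  by apply: (measurableT_comp mg); apply: measurable_diagv; exact: measurable_id.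
have v0 x : 0 <= `|vdm x|%:E * @g (diagv x) by apply: mule_ge0 => //; rewrite lee_fin.
have f0 : 0 <= n`!%:R%:E :> \bar R by rewrite lee_fin.
rewrite -(ge0_integralZl _ measurableT mi (fun l _ => integral_ge0 _ (fun B _ => dd0 l B)) f0).
rewrite [X in _ = _ * X](integral_vecmS mv v0).
have mv2 : measurable_fun [set: measurableTypeR R * 'cV[R]_n]
    (fun z => `|vdm (col_mx z.1%:M z.2)|%:E * g (diagv (col_mx z.1%:M z.2))).
  by apply: (measurableT_comp mv); measurable_mx.
have mi2 := measurable_integral_param (vecm R n) (fun (x : measurableTypeR R) y =>
  `|vdm (col_mx x%:M y)|%:E * g (diagv (col_mx x%:M y))) mv2 (fun x y => v0 _).
rewrite -(ge0_integralZl _ measurableT mi2 (fun l _ => integral_ge0 _ (fun B _ => v0 _)) (cprod_ge0 n)).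
apply: eq_integral => l _.
rewrite (IH _ (mdl l) (dd0 l)); last first.
  move=> M N MT NT MN.
  have -> : `|\det (M - l%:M)|%R = `|\det (N - l%:M)|%R.
    by rewrite !norm_det_sub_scalar MN.
  congr (_ * _); apply: sg; [exact: dsum_sym|exact: dsum_sym|].
  by rewrite !char_poly_dsum MN.
apply: (congr1 (fun z => cprod n * z)); apply: eq_integral => y _.
rewrite diagv_cons vdm_cons det_diagv_sub muleA -EFinM -normrM.
by rewrite mulrC.
Qed.

End joint_density.

(** * Pfaffians and the sign of the Vandermonde determinant *)

Section pfaffian_sign.
Variable R : realType.

Definition pfterm n (A : 'I_n -> 'I_n -> R) : R :=
  \prod_(i < n | ~~ odd i) \prod_(j < n | val j == (val i).+1) A i j.

(** The Pfaffian before division by [2^m m!], for arbitrary kernels, so that matrix entries and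
    pointwise signs can both be inserted. *)
Definition pfsum n (A : 'I_n -> 'I_n -> R) : R :=
  \sum_(s : 'S_n) (-1) ^+ s * pfterm (fun i j => A (s i) (s j)).

Lemma eq_pfterm n (A B : 'I_n -> 'I_n -> R) :
  (forall i j, A i j = B i j) -> pfterm A = pfterm B.
Proof. by move=> e; apply: eq_bigr => i _; apply: eq_bigr => j _; exact: e. Qed.

Lemma eq_pfsum n (A B : 'I_n -> 'I_n -> R) :
  (forall i j, A i j = B i j) -> pfsum A = pfsum B.
Proof. by move=> e; apply: eq_bigr => s _; congr (_ * _); exact: eq_pfterm. Qed.

Lemma pftermSS n (A : 'I_n.+2 -> 'I_n.+2 -> R) :
  pfterm A = A ord0 (lift ord0 ord0) *
    pfterm (fun i j => A (lift ord0 (lift ord0 i)) (lift ord0 (lift ord0 j))).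
Proof.
rewrite /pfterm big_mkcond big_ord_recl /=; congr (_ * _).
  rewrite big_mkcond big_ord_recl /= mul1r big_ord_recl /= big1 ?mulr1 //.
rewrite big_ord_recl /= mul1r [RHS]big_mkcond /=; apply: eq_bigr => i _.
rewrite !negbK; case: ifP => // _.
rewrite big_mkcond big_ord_recl /= mul1r big_ord_recl /= mul1r [RHS]big_mkcond /=.
by apply: eq_bigr => j _.
Qed.

Lemma sum_lift_perm n (F : 'S_n.+1 -> R) :
  \sum_s F s = \sum_(a < n.+1) \sum_(s : 'S_n) F (lift_perm ord0 a s).
Proof.
rewrite pair_big /= (reindex (fun p : 'I_n.+1 * 'S_n => lift_perm ord0 p.1 p.2)) //.
apply: onW_bij; apply: inj_card_bij; last first.
  by rewrite card_prod card_ord !card_Sn factS.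
move=> [a s] [b t] /= e.
have ab : a = b by move/permP/(_ ord0): e; rewrite !lift_perm_id.
subst b; congr pair; apply/permP => i.
move/permP/(_ (lift ord0 i)): e; rewrite !lift_perm_lift.
exact: lift_inj.
Qed.

Lemma pfsum_perm n (A : 'I_n -> 'I_n -> R) (t : 'S_n) :
  pfsum (fun i j => A (t i) (t j)) = (-1) ^+ t * pfsum A.
Proof.
rewrite /pfsum (reindex_inj (mulIg t^-1%g)) /= big_distrr /=; apply: eq_bigr => s _.
rewrite odd_permM signr_addb odd_permV mulrA [(-1) ^+ t * _]mulrC; congr (_ * _); apply: eq_pfterm => i j.
by rewrite !permM !permKV.
Qed.

(** The kernel [sign (y_j - y_i)] at equally spaced increasing points, the model to which every
    configuration of distinct points is sorted. *)
Definition osg n (i j : 'I_n) : R := Num.sg (j%:R - i%:R).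

Lemma osg_lift n (a : 'I_n.+1) (i j : 'I_n) : osg (lift a i) (lift a j) = osg i j.
Proof.
have sgn (x y : nat) : Num.sg (y%:R - x%:R : R) = if (x < y)%N then 1 else if x == y then 0 else -1.
  case: (ltngtP x y) => [h|h|->]; last by rewrite subrr sgr0.
    by rewrite gtr0_sg // subr_gt0 ltr_nat.
  by rewrite ltr0_sg // subr_lt0 ltr_nat.
rewrite /osg !sgn.
have -> : (lift a i < lift a j)%N = (i < j)%N by rewrite /= /bump; lia.
by have -> : (nat_of_ord (lift a i) == lift a j) = (nat_of_ord i == j) by rewrite /= /bump; lia.
Qed.

Lemma alt_sum_lt n a : (a <= n)%N -> \sum_(b < n | (b < a)%N) (-1) ^+ b = (odd a)%:R :> R.
Proof.
move=> an; rewrite -(big_ord_widen _ (fun b => (-1) ^+ b)) //.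
elim: a {an} => [|a IH]; first by rewrite big_ord0.
rewrite big_ord_recr /= IH -signr_odd; case: (odd a) => /=; rewrite ?expr0 ?expr1; ring.
Qed.

Lemma alt_sum_osg n (a : 'I_n.+2) : ~~ odd n ->
  \sum_(b < n.+1) (-1) ^+ b * osg a (lift a b) = (-1) ^+ a.
Proof.
move=> on.
(* Indices [b < a] stay below [a] after lifting and the others pass above it. Since [n] is even, the
   alternating sum of the constant 1 is 1, and twice the sum over [b < a] removes 2 exactly when [a]
   is odd. *)
have h (b : 'I_n.+1) : osg a (lift a b) = 1 - 2 * (b < a)%N%:R.
  rewrite /osg /= /bump leqNgt; case: ltnP => ba /=.
    by rewrite add0n ltr0_sg ?subr_lt0 ?ltr_nat // mulr1; ring.
  by rewrite gtr0_sg ?subr_gt0 ?ltr_nat ?add1n ?ltnS // mulr0 subr0.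
under eq_bigr do rewrite h mulrBr mulr1 mulrCA.
rewrite sumrB -big_distrr /=.
have -> : \sum_(b < n.+1) (-1) ^+ b * (b < a)%N%:R = (odd a)%:R :> R.
  rewrite -(@alt_sum_lt n.+1 a (ltn_ord a)) [RHS]big_mkcond; apply: eq_bigr => b _.
  by case: (b < a)%N; rewrite ?mulr1 ?mulr0.
have -> : \sum_(b < n.+1) (-1) ^+ b = 1 :> R.
  have := @alt_sum_lt n.+1 n.+1 (leqnn _); rewrite /= on /= => h1.
  transitivity (\sum_(b < n.+1 | (b < n.+1)%N) (-1) ^+ b : R); last exact: h1.
  by apply: eq_bigl => b; rewrite ltn_ord.
by rewrite -signr_odd; case: (odd a) => /=; rewrite ?expr0 ?expr1; ring.
Qed.

(* Splitting off [s 0] and [s 1] of a permutation [s] leaves a permutation of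
   two fewer points with the same relative order. *)
Lemma pfsum_osgSS n : ~~ odd n -> pfsum (@osg n.+2) = n.+2%:R * pfsum (@osg n).
Proof.
move=> on; rewrite /pfsum sum_lift_perm.
transitivity (\sum_(a < n.+2) \sum_(b < n.+1)
   (-1) ^+ a * ((-1) ^+ b * osg a (lift a b)) * pfsum (@osg n)).
  apply: eq_bigr => a _; rewrite sum_lift_perm; apply: eq_bigr => b _.
  rewrite /pfsum big_distrr /=; apply: eq_bigr => s _.
  rewrite !odd_lift_perm /= pftermSS lift_perm_id lift_perm_lift lift_perm_id.
  have -> : pfterm (fun i j => osg
      (lift_perm ord0 a (lift_perm ord0 b s) (lift ord0 (lift ord0 i)))
      (lift_perm ord0 a (lift_perm ord0 b s) (lift ord0 (lift ord0 j)))) =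
      pfterm (fun i j => osg (s i) (s j)).
    apply: eq_pfterm; by move=> i j /=; rewrite !lift_perm_lift !osg_lift.
  rewrite 2!signr_addb (signr_odd _ a) (signr_odd _ b).
  move: (pfterm _) (osg _ _) ((-1) ^+ a : R) ((-1) ^+ b : R) ((-1) ^+ s : R) => u v w x y.
  ring.
under eq_bigr do rewrite -big_distrl -big_distrr /= alt_sum_osg // -expr2 sqrr_sign mul1r.
by rewrite sumr_const card_ord mulr_natl.
Qed.

Lemma pfsum_osg n : ~~ odd n -> pfsum (@osg n) = 2 ^+ n./2 * (n./2)`!%:R.
Proof.
suff h m : pfsum (@osg m.*2) = 2 ^+ m * m`!%:R.
  move=> on; have := h n./2; have -> // : n./2.*2 = n.
  by rewrite -[RHS]odd_double_half (negbTE on).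
elim: m => [|m IH].
  rewrite /pfsum (big_pred1 1%g); last by move=> s; apply/esym/eqP/permP => -[].
  by rewrite odd_perm1 /pfterm big_ord0 !mul1r.
rewrite doubleS pfsum_osgSS ?odd_double // IH factS natrM exprS -doubleS -mul2n natrM; ring.
Qed.

Lemma vdm_det n (x : 'cV[R]_n) : vdm x = \det (Vandermonde n x^T).
Proof.
by rewrite det_Vandermonde /vdm; apply: eq_bigr => i _; apply: eq_bigr => j _; rewrite !mxE.
Qed.

Lemma vdm_perm n (x : 'cV[R]_n) (s : 'S_n) : vdm (row_perm s x) = (-1) ^+ s * vdm x.
Proof.
have e : Vandermonde n (row_perm s x)^T = col_perm s (Vandermonde n x^T).
  by apply/matrixP => i j; rewrite !mxE.
by rewrite !vdm_det e col_permE det_mulmx det_perm odd_permV mulrC.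
Qed.

Lemma vdm_expand n (x : 'cV[R]_n) :
  vdm x = \sum_(s : 'S_n) (-1) ^+ s * \prod_j x (s j) 0 ^+ j.
Proof.
rewrite vdm_det /determinant; apply: eq_bigr => s _; congr (_ * _).
by apply: eq_bigr => j _; rewrite !mxE.
Qed.

Lemma sg_vdm_increasing n (x : 'cV[R]_n) :
  (forall i j : 'I_n, (i < j)%N -> x i 0 < x j 0) -> Num.sg (vdm x) = 1.
Proof.
move=> xi; rewrite gtr0_sg // /vdm; apply: prodr_gt0 => i _; apply: prodr_gt0 => j ij.
by rewrite subr_gt0 xi.
Qed.

Lemma sgr_signb (b : bool) : Num.sg ((-1) ^+ b : R) = (-1) ^+ b.
Proof. by case: b; rewrite ?expr0 ?expr1 ?sgrN sgr1. Qed.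

Lemma sort_column n (x : 'cV[R]_n) : exists s : 'S_n,
  forall i j : 'I_n, (i <= j)%N -> x (s i) 0 <= x (s j) 0.
Proof.
pose t := [tuple x i 0 | i < n].
have /tuple_permP[s es] : perm_eq (sort_tuple <=%R t) t by rewrite perm_sort.
exists s => i j ij.
have key (k : 'I_n) : x (s k) 0 = nth 0 (sort <=%R t) k.
  by rewrite es (nth_map k) ?size_enum_ord // nth_ord_enum /t !tnth_map !tnth_ord_tuple.
rewrite !key; apply: (sorted_leq_nth le_trans lexx) => //.
- exact: sort_le_sorted.
- by rewrite inE size_sort size_tuple.
- by rewrite inE size_sort size_tuple.
Qed.

(** Both sides pick up the sign of a permutation of the entries, so distinct entries may be sorted,
    where the kernel is [osg] and [vdm] is positive. If two entries coincide, exchanging them shows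
    that both sides equal their own negatives. *)
Lemma pfsum_sg_vdm n (x : 'cV[R]_n) : ~~ odd n ->
  pfsum (fun i j => Num.sg (x j 0 - x i 0)) = 2 ^+ n./2 * (n./2)`!%:R * Num.sg (vdm x).
Proof.
move=> on.
have [/existsP[i /existsP[j /andP[ij /eqP xij]]]|inj] :=
    boolP [exists i : 'I_n, exists j : 'I_n, (i != j) && (x i 0 == x j 0)].
  have xt : row_perm (tperm i j) x = x.
    by apply/matrixP => a b; rewrite ord1 mxE; case: tpermP => [->|->|].
  have neg0 (y : R) : y = - y -> y = 0 by move=> e; lra.
  have v0 : vdm x = 0 by apply: neg0; rewrite -{1}xt vdm_perm odd_tperm ij expr1 mulN1r.
  rewrite v0 sgr0 mulr0; apply: neg0.
  have := pfsum_perm (fun i j => Num.sg (x j 0 - x i 0)) (tperm i j).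
  rewrite odd_tperm ij expr1 mulN1r => <-; apply: eq_pfsum => a b.
  by move/matrixP: xt => xt; have := xt a 0; have := xt b 0; rewrite !mxE => -> ->.
have [s xs] := sort_column x.
have xs1 (i j : 'I_n) : (i < j)%N -> x (s i) 0 < x (s j) 0.
  move=> ij; rewrite lt_neqAle xs 1?ltnW // andbT.
  move: inj; rewrite negb_exists => /forallP/(_ (s i)); rewrite negb_exists => /forallP/(_ (s j)).
  by rewrite negb_and negbK (inj_eq perm_inj) -val_eqE /= ltn_eqF.
have sv : Num.sg (vdm (row_perm s x)) = 1.
  by apply: sg_vdm_increasing => i j ij; rewrite !mxE; exact: xs1.
have := pfsum_perm (fun i j => Num.sg (x j 0 - x i 0)) s.
rewrite (@eq_pfsum _ _ (@osg n)) ?pfsum_osg //; last first.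
  move=> i j; rewrite /osg; case: (ltngtP i j) => ij.
  - by rewrite !gtr0_sg ?subr_gt0 ?ltr_nat ?xs1.
  - by rewrite !ltr0_sg ?subr_lt0 ?ltr_nat ?xs1.
  - by rewrite (val_inj ij) !subrr.
move: sv; rewrite vdm_perm sgrM sgr_signb => sv e.
by rewrite e mulrAC sv mul1r.
Qed.

End pfaffian_sign.

(** * Signed integrals over vectors and Fubini for Pfaffian terms *)

Section integral_transfer.
Context d d' (X : measurableType d) (Y : measurableType d') (R : realType).
Variables (mu : {measure set X -> \bar R}) (nu : {measure set Y -> \bar R}) (T : X -> Y).
Local Open Scope ereal_scope.
Hypothesis tr : forall g : Y -> \bar R, measurable_fun [set: Y] g -> (forall y, 0 <= g y) ->
  \int[nu]_y g y = \int[mu]_x g (T x).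

Lemma integral_transfer (f : Y -> \bar R) : measurable_fun [set: Y] f ->
  \int[nu]_y f y = \int[mu]_x f (T x).
Proof.
move=> mf; rewrite [LHS]integralE [RHS]integralE; congr (_ - _).
- by rewrite tr //; [apply: eq_integral => x _; rewrite !funeposE|exact: measurable_funepos].
- by rewrite tr //; [apply: eq_integral => x _; rewrite !funenegE|exact: measurable_funeneg].
Qed.

Lemma integrable_transfer (f : Y -> \bar R) : measurable_fun [set: Y] f ->
  mu.-integrable [set: X] (f \o T) -> nu.-integrable [set: Y] f.
Proof.
move=> mf /integrableP[_ fi]; apply/integrableP; split => //.
by rewrite tr //; exact: measurableT_comp.
Qed.

End integral_transfer.

Section integral_prodm_mul.
Context d d' (X : measurableType d) (Y : measurableType d') (R : realType).
Variables (m1 : {sigma_finite_measure set X -> \bar R})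
  (m2 : {sigma_finite_measure set Y -> \bar R}).
Local Open Scope ereal_scope.

Lemma integrable_prodm_mul (F : X -> R) (G : Y -> R) :
  m1.-integrable [set: X] (EFin \o F) -> m2.-integrable [set: Y] (EFin \o G) ->
  (prodm m1 m2).-integrable [set: X * Y] (fun z => (F z.1 * G z.2)%:E).
Proof.
move=> /integrableP[mF iF] /integrableP[mG iG].
have mFG : measurable_fun [set: X * Y] (fun z => (F z.1 * G z.2)%:E).
  under eq_fun do rewrite EFinM; apply: emeasurable_funM.
    exact: (measurableT_comp mF).
  exact: (measurableT_comp mG).
apply/integrable12ltyP => //=.
have h : \int[m1]_x \int[m2]_y `|(F x * G y)%:E| =
    \int[m1]_x `|(EFin \o F) x| * \int[m2]_y `|(EFin \o G) y|.
  rewrite -ge0_integralZr //; [|exact: measurableT_comp|exact: integral_ge0].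
  apply: eq_integral => x _; rewrite -ge0_integralZl //; last exact: measurableT_comp.
  by apply: eq_integral => y _; rewrite EFinM abseM.
rewrite h; apply: lte_mul_pinfty => //; first exact: integral_ge0.
by rewrite ge0_fin_numE //; exact: integral_ge0.
Qed.

Lemma integral_prodm_mul (F : X -> R) (G : Y -> R) :
  m1.-integrable [set: X] (EFin \o F) -> m2.-integrable [set: Y] (EFin \o G) ->
  \int[prodm m1 m2]_z (F z.1 * G z.2)%:E =
  \int[m1]_x (F x)%:E * \int[m2]_y (G y)%:E.
Proof.
move=> iF iG; have iFG := integrable_prodm_mul iF iG.
rewrite -(integral12_prod_meas1 iFG) /fubini_F /=.
have fG : \int[m2]_y (G y)%:E \is a fin_num by exact: integrable_fin_num.
rewrite -[in RHS](fineK fG) -integralZr //.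
by apply: eq_integral => x _; rewrite fineK // -integralZl.
Qed.

End integral_prodm_mul.

Section vecm_integrals.
Variable R : realType.
Local Open Scope ereal_scope.
Notation leb := (@lebesgue_measure R).

Lemma integral_vecm_perm n (s : 'S_n) (f : 'cV[R]_n -> \bar R) :
  measurable_fun [set: 'cV[R]_n] f ->
  \int[vecm R n]_y f y = \int[vecm R n]_y f (row_perm s y).
Proof.
move=> mf.
have := @integral_transfer _ _ _ _ R (vecm R n) (vecm R n) (fun y => row_perm s y) _ f mf.
apply => g mg g0.
rewrite (vec_change_unit (unitmx_perm R s)) // det_perm normrX normrN1 expr1n mul1e.
by apply: eq_integral => y _; rewrite row_permE.
Qed.

Lemma measurable_row_perm n (s : 'S_n) :
  measurable_fun [set: 'cV[R]_n] (fun y : 'cV[R]_n => row_perm s y).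
Proof.
apply: measurable_mxP => i j; under eq_fun do rewrite mxE.
by apply: measurable_fun_entry; exact: measurable_id.
Qed.

Lemma integrable_vecm_perm n (s : 'S_n) (f : 'cV[R]_n -> \bar R) :
  (vecm R n).-integrable [set: 'cV[R]_n] f ->
  (vecm R n).-integrable [set: 'cV[R]_n] (fun y => f (row_perm s y)).
Proof.
move=> /integrableP[mf fi]; apply/integrableP; split.
  by apply: (measurableT_comp mf); exact: measurable_row_perm.
rewrite -(integral_vecm_perm s (f := fun y => `|f y|)) //.
exact: measurableT_comp.
Qed.

Definition consv2 n (z : (measurableTypeR R * measurableTypeR R) * 'cV[R]_n) : 'cV[R]_(1 + (1 + n)) :=
  col_mx z.1.1%:M (col_mx z.1.2%:M z.2).

Lemma measurable_consv2 n : measurable_fun [set: _] (@consv2 n).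
Proof. by rewrite /consv2; measurable_mx. Qed.

Lemma ge0_integral_vecmSS n (g : 'cV[R]_(1 + (1 + n)) -> \bar R) :
  measurable_fun [set: 'cV[R]_(1 + (1 + n))] g -> (forall y, 0 <= g y) ->
  \int[vecm R n.+2]_y g y =
  \int[prodm (prodm leb leb) (vecm R n)]_z g (consv2 z).
Proof.
move=> mg g0.
have mgc : measurable_fun [set: _] (fun z => g (@consv2 n z)).
  by apply: (measurableT_comp mg); exact: measurable_consv2.
rewrite [LHS](integral_vecmS mg g0) [RHS]fubini_tonelli1 // /fubini_F.
rewrite [RHS]fubini_tonelli1 //; last 2 first.
- exact: (measurable_integral_param (vecm R n)
    (fun (p : measurableTypeR R * measurableTypeR R) (y : 'cV[R]_n) => g (consv2 (p, y)))).
- by move=> z; exact: integral_ge0.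
rewrite /fubini_F; apply: eq_integral => x _.
have mgx : measurable_fun [set: 'cV[R]_(1 + n)] (fun y => g (col_mx x%:M y)).
  by apply: (measurableT_comp mg); measurable_mx.
by rewrite (integral_vecmS mgx (fun y => g0 _)).
Qed.

(** The factors of [pfterm] involve disjoint pairs of coordinates, so Fubini splits off one pair at
    a time. Integrability is carried through the same induction because the integrands are
    signed. *)
Lemma integral_vecm_pfterm n (F : 'I_n -> 'I_n -> R * R -> R) : ~~ odd n ->
  (forall i j, (prodm leb leb).-integrable [set: _] (EFin \o F i j)) ->
  (vecm R n).-integrable [set: _]
    (fun y => (pfterm (fun i j => F i j (y i 0, y j 0)))%:E) /\
  \int[vecm R n]_y (pfterm (fun i j => F i j (y i 0, y j 0)))%:E =
  (pfterm (fun i j => fine (\int[prodm leb leb]_z (F i j z)%:E)))%:E.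
Proof.
move=> on; have [m nm] : exists m, n = m.*2.
  by exists n./2; rewrite -[LHS]odd_double_half (negbTE on).
elim: m n nm on F => [|m IH] n nm on F iF.
  subst n.
  have e (A : 'I_0.*2 -> 'I_0.*2 -> R) : pfterm A = 1%R by rewrite /pfterm big_ord0.
  under eq_fun do rewrite e.
  rewrite e integral_vecm0; last by move=> y; rewrite lee_fin.
  split => //; apply/integrableP; split; first exact: measurable_cst.
  by rewrite integral_vecm0 // ?ltry // => y; rewrite lee_fin.
case: n nm on F iF => [|[|n]] // [nm]; rewrite /= negbK => on F iF.
pose F' i j := F (lift ord0 (lift ord0 i)) (lift ord0 (lift ord0 j)).
have [iP eP] := IH n nm on F' (fun i j => iF _ _).
pose f (y : 'cV[R]_(1 + (1 + n))) := pfterm (fun i j => F i j (y i 0%R, y j 0%R)).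
have fE z : f (consv2 z) = (F ord0 (lift ord0 ord0) z.1 *
    pfterm (fun i j => F' i j (z.2 i 0, z.2 j 0)))%R.
  rewrite /f pftermSS /consv2; congr (_ * _)%R.
    by rewrite (cons_colS _ _ ord0) (cons_col0 z.1.1) (cons_col0 z.1.2); case: z => -[].
  by apply: eq_pfterm => i j; rewrite !cons_colS.
have mf : measurable_fun [set: 'cV[R]_(1 + (1 + n))] (EFin \o f).
  apply: measurable_EFin_fun; rewrite /f /pfterm.
  under eq_fun do rewrite big_mkcond; apply: measurable_prod => i _ /=.
  case: (~~ odd i); last exact: measurable_cst.
  under eq_fun do rewrite big_mkcond; apply: measurable_prod => j _ /=.
  case: (_ == _); last exact: measurable_cst.
  have mF : measurable_fun [set: measurableTypeR R * measurableTypeR R] (F i j).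
    by apply/measurable_EFinP; have /integrableP[] := iF i j.
  by apply: (measurableT_comp mF); apply: measurable_fun_pair;
    apply: measurable_fun_entry; exact: measurable_id.
have ge := @ge0_integral_vecmSS n.
have i01 := iF ord0 (lift ord0 ord0).
split.
  apply: (integrable_transfer ge mf); rewrite /comp /=.
  under eq_fun do rewrite fE.
  exact: (integrable_prodm_mul i01 iP).
rewrite (integral_transfer ge mf) /=.
under eq_integral do rewrite fE.
rewrite (integral_prodm_mul i01 iP) eP pftermSS EFinM fineK //.
exact: integrable_fin_num.
Qed.

End vecm_integrals.

(** * Gaussian weights and the matrix entries as planar integrals *)

Section gaussian_weights.
Variable R : realType.
Local Open Scope ereal_scope.
Notation leb := (@lebesgue_measure R).

Definition gmono (l : R) (i : nat) (x : R) : R := (x ^+ i * (x - l) * expR (- x ^+ 2 / 2))%R.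

Lemma measurable_expR_sq (c : R) :
  measurable_fun [set: measurableTypeR R] (fun x : R => expR (- x ^+ 2 / c)).
Proof.
apply: measurableT_comp; first exact: measurable_expR.
apply: measurable_funM; last exact: measurable_cst.
by apply: measurable_funN; apply: measurable_funX; exact: measurable_id.
Qed.

Lemma measurable_gmono l i : measurable_fun [set: measurableTypeR R] (gmono l i).
Proof.
apply: measurable_funM; last exact: measurable_expR_sq.
apply: measurable_funM; first by apply: measurable_funX; exact: measurable_id.
by apply: measurable_funB; [exact: measurable_id|exact: measurable_cst].
Qed.

Lemma exprn_le_expR (x : R) i : (0 <= x)%R -> (x ^+ i <= i`!%:R * expR x)%R.
Proof.
move=> x0; case: i => [|i]; first by rewrite expr0 mul1r -expR0 ler_expR.
rewrite mulrC -ler_pdivrMr ?ltr0n ?fact_gt0 //.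
by apply: le_trans (expR_ge1Dxn i x0); rewrite lerDr.
Qed.

(** Bound [|x|^i] by [i! exp |x|] and [|x - l|] by [exp (|x| + |l|)]. The remaining inequality
    [2 |x| - x^2 / 2 <= 4 - x^2 / 4] is [(|x| / 2 - 2)^2 >= 0], which is where the 4 comes from. *)
Lemma gmono_le l i x :
  (`|gmono l i x| <= i`!%:R * expR (`|l| + 4) * expR (- x ^+ 2 / 4))%R.
Proof.
rewrite /gmono !normrM normrX (ger0_norm (expR_ge0 _)).
have h1 := exprn_le_expR i (normr_ge0 x).
have h2 : (`|x - l| <= expR (`|x| + `|l|))%R.
  apply: le_trans (ler_normB x l) _.
  by apply: le_trans (expR_ge1Dx _); rewrite lerDr.
apply: (@le_trans _ _ (i`!%:R * expR `|x| * expR (`|x| + `|l|) * expR (- x ^+ 2 / 2))%R).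
  by apply: ler_wpM2r; [exact: expR_ge0|apply: ler_pM => //; exact: exprn_ge0].
rewrite -!mulrA; apply: ler_wpM2l; first exact: ler0n.
rewrite -!expRD ler_expR -[(x ^+ 2)%R]real_normK ?num_real //.
by have := sqr_ge0 (`|x| / 2 - 2)%R; rewrite !expr2; lra.
Qed.

Lemma integrable_gmono l i : leb.-integrable [set: measurableTypeR R] (EFin \o gmono l i).
Proof.
(* A normal density of variance 2 is proportional to [exp (- x^2 / 4)]; [C] rescales it to the bound
   of [gmono_le]. *)
pose C : R := (i`!%:R * expR (`|l| + 4) * (normal_peak (Num.sqrt 2))^-1)%R.
have s0 : Num.sqrt 2 != 0%R :> R by rewrite sqrtr_eq0 -ltNge.
have iC := integrableZl measurableT C (integrable_normal_pdf (0 : R) (Num.sqrt 2)).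
apply: (le_integrable measurableT _ _ iC).
  by apply/measurable_EFinP; exact: measurable_gmono.
move=> x _; rewrite /= lee_fin [leRHS]ger0_norm; last first.
  by rewrite !mulr_ge0 ?normal_pdf_ge0 ?invr_ge0 ?normal_peak_ge0 ?expR_ge0.
apply: le_trans (gmono_le l i x) _.
have p0 : normal_peak (Num.sqrt 2) != 0%R :> R by rewrite gt_eqF // normal_peak_gt0.
rewrite /C normal_pdfE // /normal_fun subr0 sqr_sqrtr // (_ : 2 *+ 2 = 4)%R; last by ring.
by rewrite mulrA mulrVK ?unitfE.
Qed.

Lemma integrable_prodm_kernel (K : R * R -> R) (f g : R -> R) :
  measurable_fun [set: measurableTypeR R * measurableTypeR R] K ->
  (forall z, `|K z| <= 1)%R ->
  leb.-integrable [set: measurableTypeR R] (EFin \o f) ->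
  leb.-integrable [set: measurableTypeR R] (EFin \o g) ->
  (prodm leb leb).-integrable [set: measurableTypeR R * measurableTypeR R]
    (fun z => (K z * (f z.1 * g z.2))%:E).
Proof.
move=> mK K1 i_f ig; have ifg := integrable_prodm_mul i_f ig.
apply: (le_integrable measurableT _ _ ifg).
  have /integrableP[mfg _] := ifg.
  under eq_fun do rewrite EFinM; apply: emeasurable_funM => //.
  exact/measurable_EFinP.
by move=> z _; rewrite /= lee_fin normrM ler_piMl.
Qed.

Lemma measurable_dom_I n (I : {set 'I_n}) i (l : R) : measurable (dom_I I i l).
Proof. by rewrite /dom_I; case: ifP => _; exact: measurable_itv. Qed.

Definition phi n (I : {set 'I_n}) l i x : R := (\1_(dom_I I i l) x * gmono l i x)%R.

Lemma integrable_phi n (I : {set 'I_n}) l i :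
  leb.-integrable [set: measurableTypeR R] (EFin \o phi I l i).
Proof.
apply: (le_integrable measurableT _ _ (integrable_gmono l i)).
  apply/measurable_EFinP; apply: measurable_funM; last exact: measurable_gmono.
  by apply: measurable_indic; exact: measurable_dom_I.
move=> x _; rewrite /= lee_fin normrM ler_piMl // indicE.
by case: (_ \in _); rewrite ?normr1 ?normr0.
Qed.

Lemma phi_patch n (I : {set 'I_n}) l i c (x : R) :
  ((fun x => (c x * gmono l i x)%:E) \_ (dom_I I i l)) x = (c x * phi I l i x)%:E.
Proof.
rewrite patchE /phi indicE; case: (x \in _); first by rewrite mul1r.
by rewrite mul0r mulr0.
Qed.

Lemma b_entE n (I : {set 'I_n}) l i :
  (b_ent 1 I l i)%:E = \int[leb]_x (phi I l i x)%:E.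
Proof.
have fi := integrable_fin_num measurableT (integrable_phi I l i).
rewrite /b_ent /Rintegral integral_mkcond.
have e : \int[leb]_x ((fun x => (x ^+ i * (x - l) ^+ 1 * expR (- x ^+ 2 / 2))%:E) \_ (dom_I I i l)) x =
   \int[leb]_x (phi I l i x)%:E.
  apply: eq_integral => x _; rewrite -[RHS]mul1e -EFinM -(phi_patch I l i (fun=> 1%R)).
  by congr (patch _ _ _ _); apply/funext => y; rewrite mul1r expr1.
by rewrite e fineK.
Qed.

Lemma measurable_sgr : measurable_fun [set: measurableTypeR R] (@Num.sg R).
Proof.
have -> : @Num.sg R = (fun x : R => \1_(`]0, +oo[%classic : set R) x - \1_(`]-oo, 0[%classic : set R) x)%R.
  apply/funext => x; rewrite !indicE !mem_setE /= !in_itv /= andbT.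
  by case: (ltgtP x 0%R) => [h|h|->]; rewrite ?(ltr0_sg h) ?(gtr0_sg h) ?sgr0 ?subr0 ?sub0r ?ltxx ?subrr.
by apply: measurable_funB; apply: measurable_indic; exact: measurable_itv.
Qed.

Lemma normr_sg_le1 (x : R) : (`|Num.sg x| <= 1)%R.
Proof. by case: (ltgtP x 0%R) => [h|h|->]; rewrite ?(ltr0_sg h) ?(gtr0_sg h) ?sgr0 ?normr0 ?normrN1 ?normr1. Qed.

(** The kernel is bounded and the weights are integrable, so the inner and outer integrals are
    finite, the real-valued iterated integral loses nothing, and Fubini applies. *)
Lemma a_entE n (I : {set 'I_n}) l i j :
  (a_ent 1 I l i j)%:E =
  \int[prodm leb leb]_z (Num.sg (z.2 - z.1) * (phi I l i z.1 * phi I l j z.2))%:E.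
Proof.
have iK := @integrable_prodm_kernel (fun z => Num.sg (z.2 - z.1)%R) _ _ _ _
  (integrable_phi I l i) (integrable_phi I l j).
have {}iK : (prodm leb leb).-integrable [set: measurableTypeR R * measurableTypeR R]
    (fun z => (Num.sg (z.2 - z.1) * (phi I l i z.1 * phi I l j z.2))%:E).
  apply: iK; last by move=> z; exact: normr_sg_le1.
  by apply: measurableT_comp; [exact: measurable_sgr|apply: measurable_funB].
have fi := integrable_fin_num measurableT iK.
have ix (x : R) : leb.-integrable [set: measurableTypeR R]
    (fun y => (Num.sg (y - x) * gmono l i x * phi I l j y)%:E).
  have ig := integrableZl measurableT (gmono l i x) (integrable_phi I l j).
  apply: (le_integrable measurableT _ _ ig).
  - apply: measurable_EFin_fun; apply: measurable_funM.
      apply: measurable_funM; last exact: measurable_cst.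
      by apply: measurableT_comp; [exact: measurable_sgr|apply: measurable_funB].
    by apply/measurable_EFinP; have /integrableP[] := integrable_phi I l j.
  - move=> y _; rewrite /= lee_fin !normrM -mulrA ler_piMl ?mulr_ge0 //.
    exact: normr_sg_le1.
rewrite -[RHS](fineK fi); congr EFin; rewrite -(integral12_prod_meas1 iK) /fubini_F /a_ent.
rewrite [LHS]/Rintegral; congr fine; rewrite integral_mkcond.
apply: eq_integral => x _; rewrite patchE; case: ifPn => xD; last first.
  rewrite -[LHS](integral0 leb [set: measurableTypeR R]); apply: eq_integral => y _.
  by rewrite {1}/phi indicE (negbTE xD) mul0r mul0r mulr0.
rewrite /Rintegral integral_mkcond.
have e : \int[leb]_y ((fun y => (Num.sg (y - x) * x ^+ i * y ^+ j * (x - l) ^+ 1 *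
      (y - l) ^+ 1 * expR (- (x ^+ 2 + y ^+ 2) / 2))%:E) \_ (dom_I I j l)) y =
    \int[leb]_y (Num.sg (y - x) * gmono l i x * phi I l j y)%:E.
  apply: eq_integral => y _; rewrite -(phi_patch I l j (fun y => Num.sg (y - x) * gmono l i x)%R).
  congr (patch _ _ _ _); apply/funext => {}y; congr EFin; rewrite /gmono !expr1.
  rewrite (_ : (- (x ^+ 2 + y ^+ 2) / 2 = - x ^+ 2 / 2 + - y ^+ 2 / 2)%R); last by ring.
  by rewrite expRD; ring.
rewrite e fineK; last exact: integrable_fin_num.
apply: eq_integral => y _; rewrite /= [phi I l i x]/phi indicE xD mul1r.
by congr EFin; rewrite -mulrA.
Qed.

End gaussian_weights.

Section pfaffian_integral.
Variable R : realType.
Local Open Scope ereal_scope.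
Notation leb := (@lebesgue_measure R).

Lemma ge0_integral_vecmS_prodm n (g : 'cV[R]_(1 + n) -> \bar R) :
  measurable_fun [set: 'cV[R]_(1 + n)] g -> (forall y, 0 <= g y) ->
  \int[vecm R n.+1]_y g y = \int[prodm leb (vecm R n)]_z g (col_mx z.1%:M z.2).
Proof.
move=> mg g0; rewrite [LHS](integral_vecmS mg g0) [RHS]fubini_tonelli1 //.
by apply: (measurableT_comp mg); measurable_mx.
Qed.

Lemma measurable_prod_entries n (f : 'I_n -> R -> R) :
  (forall i, measurable_fun [set: measurableTypeR R] (f i)) ->
  measurable_fun [set: 'cV[R]_n] (fun y : 'cV[R]_n => \prod_i f i (y i 0))%R.
Proof.
move=> mf; apply: measurable_prod => i _; apply: (measurableT_comp (mf i)).
by apply: measurable_fun_entry; exact: measurable_id.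
Qed.

Lemma integrable_vecm_prod n (f : 'I_n -> R -> R) :
  (forall i, leb.-integrable [set: measurableTypeR R] (EFin \o f i)) ->
  (vecm R n).-integrable [set: 'cV[R]_n] (fun y => (\prod_i f i (y i 0))%:E).
Proof.
elim: n f => [|n IH] f i_f.
  apply/integrableP; split.
    by apply: measurable_EFin_fun; under eq_fun do rewrite big_ord0; exact: measurable_cst.
  by rewrite integral_vecm0 ?big_ord0 ?ltry.
have mf : measurable_fun [set: 'cV[R]_(1 + n)] (fun y : 'cV[R]_(1 + n) => (\prod_i f i (y i 0))%:E).
  apply: measurable_EFin_fun; apply: (@measurable_prod_entries n.+1) => i.
  by apply/measurable_EFinP; have /integrableP[] := i_f i.
apply: (integrable_transfer (@ge0_integral_vecmS_prodm n) mf).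
have -> : (fun y : 'cV[R]_(1 + n) => (\prod_i f i (y i 0))%:E) \o
    (fun z : measurableTypeR R * 'cV[R]_n => col_mx z.1%:M z.2) =
    (fun z => (f ord0 z.1 * \prod_i f (lift ord0 i) (z.2 i 0))%:E).
  apply/funext => z /=; rewrite big_ord_recl cons_col0; congr (_ * _)%:E.
  by apply: eq_bigr => i _; rewrite cons_colS.
exact: (integrable_prodm_mul (i_f ord0) (IH (fun i => f (lift ord0 i)) (fun i => i_f _))).
Qed.

Lemma integrable_bounded_mul n (K f : 'cV[R]_n -> R) :
  measurable_fun [set: 'cV[R]_n] K -> (forall y, `|K y| <= 1)%R ->
  (vecm R n).-integrable [set: 'cV[R]_n] (EFin \o f) ->
  (vecm R n).-integrable [set: 'cV[R]_n] (fun y => (K y * f y)%:E).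
Proof.
move=> mK K1 i_f; apply: (le_integrable measurableT _ _ i_f).
  have /integrableP[mf _] := i_f.
  under eq_fun do rewrite EFinM; apply: emeasurable_funM => //.
  exact: measurable_EFin_fun.
by move=> z _; rewrite /= lee_fin normrM ler_piMl.
Qed.

Lemma measurable_sg_vdm n : measurable_fun [set: 'cV[R]_n] (fun y => Num.sg (vdm y)).
Proof. by apply: measurableT_comp; [exact: measurable_sgr|exact: measurable_vdm]. Qed.

(** For even [n] every index belongs to exactly one pair of [pfterm], so the weights come out as one
    full product. *)
Lemma pfterm_weights n (K : 'I_n -> 'I_n -> R) (a : 'I_n -> R) : ~~ odd n ->
  pfterm (fun i j => K i j * (a i * a j))%R = (pfterm K * \prod_i a i)%R.
Proof.
move=> on; have [m nm] : exists m, n = m.*2.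
  by exists n./2; rewrite -[LHS]odd_double_half (negbTE on).
elim: m n nm on K a => [|m IH] n nm on K a.
  by subst n; rewrite /pfterm !big_ord0 mulr1.
case: n nm on K a => [|[|n]] // [nm]; rewrite /= negbK => on K a.
rewrite !pftermSS (IH n nm on (fun i j => K (lift ord0 (lift ord0 i)) (lift ord0 (lift ord0 j)))
  (fun i => a (lift ord0 (lift ord0 i)))) 2!big_ord_recl.
by ring.
Qed.

Section fixed_domain.
Variables (n : nat) (I : {set 'I_n}) (l : R).

(* For odd [n] the extra index carries a probability density and is ordered
   above all others, so that its integral against [1] borders the matrix. *)
Definition xphi (j : nat) (x : R) : R :=
  if (j < n)%N then phi I l j x else normal_pdf 0 1 x.

Definition xker (i j : nat) (z : R * R) : R :=
  (if (i < n)%N && (j < n)%N then Num.sg (z.2 - z.1)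
   else if (i < n)%N then 1 else if (j < n)%N then -1 else 0)%R.

Lemma integrable_xphi j : leb.-integrable [set: measurableTypeR R] (EFin \o xphi j).
Proof.
rewrite /xphi; case: (j < n)%N; first exact: integrable_phi.
exact: integrable_normal_pdf.
Qed.

Lemma measurable_xker i j :
  measurable_fun [set: measurableTypeR R * measurableTypeR R] (xker i j).
Proof.
rewrite /xker; case: (i < n)%N; case: (j < n)%N => /=; try exact: measurable_cst.
by apply: measurableT_comp; [exact: measurable_sgr|apply: measurable_funB].
Qed.

Lemma xker_le1 i j z : (`|xker i j z| <= 1)%R.
Proof.
rewrite /xker; case: (i < n)%N; case: (j < n)%N => /=; first exact: normr_sg_le1.
all: by rewrite ?normr1 ?normrN1 ?normr0.
Qed.

Lemma integrable_xker i j : (prodm leb leb).-integrable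
  [set: measurableTypeR R * measurableTypeR R]
  (fun z => (xker i j z * (xphi i z.1 * xphi j z.2))%:E).
Proof.
apply: integrable_prodm_kernel; [exact: measurable_xker|exact: xker_le1|
  exact: integrable_xphi|exact: integrable_xphi].
Qed.

Lemma AmatE (i j : 'I_(n + odd n)) : Amat 1 I l i j =
  fine (\int[prodm leb leb]_z (xker i j z * (xphi i z.1 * xphi j z.2))%:E).
Proof.
rewrite mxE /xker /xphi; case: (i < n)%N; case: (j < n)%N => /=.
- by rewrite -a_entE.
- under eq_integral do rewrite mul1r.
  rewrite (integral_prodm_mul (integrable_phi I l i) (integrable_normal_pdf 0 1)).
  by rewrite integral_normal_pdf mule1 -b_entE.
- have iK := integrable_prodm_mul (integrable_normal_pdf 0 1) (integrable_phi I l j).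
  under eq_integral do rewrite EFinM.
  rewrite (integralZl measurableT iK).
  rewrite (integral_prodm_mul (integrable_normal_pdf 0 1) (integrable_phi I l j)).
  by rewrite integral_normal_pdf mul1e -b_entE -EFinM /= mulN1r.
- under eq_integral do rewrite mul0r.
  by rewrite integral0.
Qed.

(** Whatever the extra coordinate holds, it is replaced by a number exceeding every entry, so that
    the border values [1] and [-1] of [xker] are signs of differences too. *)
Definition xext m (y : 'cV[R]_m) : 'cV[R]_m :=
  (\col_i if (i < n)%N then y i 0 else 1 + \sum_j `|y j 0|)%R.

Lemma xker_ext m (y : 'cV[R]_m) (i j : 'I_m) : (m <= n.+1)%N ->
  xker i j (y i 0, y j 0)%R = Num.sg (xext y j 0 - xext y i 0)%R.
Proof.
move=> mn.
have big (k : 'I_m) : (y k 0 < 1 + \sum_j `|y j 0|)%R.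
  apply: le_lt_trans (ler_norm _) _.
  rewrite (bigD1 k) //=.
  have : (0 <= \sum_(j < m | j != k) `|y j 0|)%R by exact: sumr_ge0.
  lra.
rewrite /xker !mxE /=; case: ifPn => [/andP[-> ->]//|].
rewrite negb_and; case: ifPn => /= [ilt|ige] h.
  by rewrite (negbTE h) gtr0_sg // subr_gt0.
case: ifPn => jlt; first by rewrite ltr0_sg // subr_lt0.
by rewrite subrr sgr0.
Qed.

(** In the term of the permutation [s] the coordinates are renamed by [s]. All terms then carry the
    same weight [W], and the sum under the integral is the Pfaffian of a sign kernel, evaluated by
    [pfsum_sg_vdm]. *)
Lemma pfaffian_Amat_xphi : (pfaffian (Amat 1 I l))%:E =
  \int[vecm R (n + odd n)]_y (Num.sg (vdm (xext y)) * \prod_(j < n + odd n) xphi j (y j 0))%:E.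
Proof.
set m := (n + odd n)%N.
have om : ~~ odd m by rewrite /m oddD; case: (odd n).
have mn : (m <= n.+1)%N by rewrite /m; case: (odd n); rewrite ?addn1 ?addn0.
have C0 : (2 ^+ m./2 * (m./2)`!%:R)%R != 0%R :> R.
  by rewrite mulf_neq0 ?expf_neq0 ?pnatr_eq0 // -lt0n fact_gt0.
pose F (i j : 'I_m) (z : R * R) := (xker i j z * (xphi i z.1 * xphi j z.2))%R.
pose W (y : 'cV[R]_m) := (\prod_(j < m) xphi j (y j 0))%R.
have iW : (vecm R m).-integrable [set: 'cV[R]_m] (EFin \o W).
  by apply: (@integrable_vecm_prod m (fun j => xphi j)) => j; exact: integrable_xphi.
have term (s : 'S_m) : let f (y : 'cV[R]_m) := ((-1) ^+ s * pfterm (fun i j => xker (s i) (s j) (y (s i) 0, y (s j) 0)%R) * W y)%:E in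
   (vecm R m).-integrable [set: 'cV[R]_m] f /\
   \int[vecm R m]_y f y = ((-1) ^+ s * pfterm (fun i j => Amat 1 I l (s i) (s j)))%:E.
  have [iT eT] := @integral_vecm_pfterm R m (fun i j => F (s i) (s j)) om
    (fun i j => integrable_xker (s i) (s j)).
  pose h (y : 'cV[R]_m) := (pfterm (fun i j => F (s i) (s j) (y i 0, y j 0)%R))%:E.
  have e (y : 'cV[R]_m) : ((-1) ^+ s * pfterm (fun i j => xker (s i) (s j) (y (s i) 0, y (s j) 0)%R) * W y)%:E =
      ((-1) ^+ s)%:E * h (row_perm s y).
    rewrite -EFinM -mulrA; congr (_ * _)%:E.
    rewrite /W (reindex_inj (@perm_inj _ s)) /= -pfterm_weights //.
    by apply: eq_pfterm => i j; rewrite /F !mxE.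
  have iT' := integrable_vecm_perm s iT.
  split; first by under eq_fun do rewrite e; exact: integrableZl.
  under eq_integral do rewrite e.
  rewrite integralZl //.
  have /integrableP[mh _] := iT.
  rewrite -(integral_vecm_perm s mh) eT -EFinM.
  by congr (_ * _)%:E; apply: eq_pfterm => i j; rewrite AmatE.
rewrite /pfaffian -[X in (X / _)%R]/(pfsum (fun i j => Amat 1 I l i j)).
have e0 : (pfsum (fun i j => Amat 1 I l i j))%:E =
    \int[vecm R m]_y (\sum_(s : 'S_m) ((-1) ^+ s *
      pfterm (fun i j => xker (s i) (s j) (y (s i) 0, y (s j) 0)%R) * W y)%:E).
  rewrite integral_sum //; last by move=> s; have [] := term s.
  by rewrite /pfsum -sumEFin; apply: eq_bigr => s _; have [_ <-] := term s.
have iS : (vecm R m).-integrable [set: 'cV[R]_m] (fun y => \sum_(s : 'S_m) ((-1) ^+ s *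
      pfterm (fun i j => xker (s i) (s j) (y (s i) 0, y (s j) 0)%R) * W y)%:E).
  by apply: integrable_sum => // s _; have [] := term s.
rewrite mulrC EFinM e0 -(integralZl measurableT iS).
apply: eq_integral => y _; rewrite sumEFin -EFinM -big_distrl /=; congr EFin.
rewrite -[X in (_ * (X * _))%R]/(pfsum (fun i j => xker i j (y i 0, y j 0)%R)).
rewrite (eq_pfsum (fun i j => xker_ext y i j mn)) pfsum_sg_vdm //.
by rewrite mulrA mulrA mulVf // mul1r.
Qed.

Lemma xphi_lt (j : 'I_n) : xphi j = phi I l j.
Proof. by rewrite /xphi ltn_ord. Qed.

Lemma integrable_sg_vdm_phi : (vecm R n).-integrable [set: 'cV[R]_n]
  (fun y => (Num.sg (vdm y) * \prod_(j < n) phi I l j (y j 0))%:E).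
Proof.
apply: integrable_bounded_mul; [exact: measurable_sg_vdm|by move=> y; exact: normr_sg_le1|].
by apply: (@integrable_vecm_prod n (fun j => phi I l j)) => j; exact: integrable_phi.
Qed.

Lemma measurable_xext m : measurable_fun [set: 'cV[R]_m] (@xext m).
Proof.
apply: measurable_mxP => i j; under eq_fun do rewrite mxE.
case: (i < n)%N; first by apply: measurable_fun_entry; exact: measurable_id.
apply: measurable_funD; first exact: measurable_cst.
apply: measurable_sum => k; apply: measurable_norm_fun.
by apply: measurable_fun_entry; exact: measurable_id.
Qed.

Lemma integral_xphi_even m : m = n ->
  \int[vecm R m]_y (Num.sg (vdm (xext y)) * \prod_(j < m) xphi j (y j 0))%:E =
  \int[vecm R n]_y (Num.sg (vdm y) * \prod_(j < n) phi I l j (y j 0))%:E.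
Proof.
move=> ->; apply: eq_integral => y _; congr (Num.sg (vdm _) * _)%:E.
  by apply/matrixP => i j; rewrite mxE ord1 ltn_ord.
by apply: eq_bigr => j _; rewrite xphi_lt.
Qed.

Lemma integral_xphi_odd m : m = n.+1 ->
  \int[vecm R m]_y (Num.sg (vdm (xext y)) * \prod_(j < m) xphi j (y j 0))%:E =
  \int[vecm R n]_y (Num.sg (vdm y) * \prod_(j < n) phi I l j (y j 0))%:E.
Proof.
(* [s] exchanges the roles of last and first coordinate, keeping the order of the others, because
   [vecm] splits off a coordinate at the front. The extra coordinate then integrates to 1. *)
move=> ->; pose s : 'S_n.+1 := lift_perm ord_max ord0 1%g.
have s_max : s ord_max = ord0 by rewrite lift_perm_id.
have s_lift (i : 'I_n) : s (lift ord_max i) = lift ord0 i by rewrite lift_perm_lift perm1.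
pose f (y : 'cV[R]_(1 + n)) : \bar R :=
  (Num.sg (vdm (@xext n.+1 y)) * \prod_(j < n.+1) xphi j (y j 0))%:E.
have mf : measurable_fun [set: 'cV[R]_(1 + n)] f.
  apply: measurable_EFin_fun; apply: measurable_funM.
    exact: (measurableT_comp (@measurable_sg_vdm n.+1) (@measurable_xext n.+1)).
  apply: (@measurable_prod_entries n.+1 (fun j => xphi j)) => j.
  by apply/measurable_EFinP; have /integrableP[] := integrable_xphi j.
rewrite -[LHS]/(\int[vecm R n.+1]_y f y) (integral_vecm_perm s mf).
have mfs : measurable_fun [set: 'cV[R]_(1 + n)] (fun y => f (row_perm s y)).
  by apply: (measurableT_comp mf); exact: (@measurable_row_perm R n.+1).
rewrite (integral_transfer (@ge0_integral_vecmS_prodm n) mfs).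
have fE (z : R * 'cV[R]_n) : f (row_perm s (col_mx z.1%:M z.2)) =
    (normal_pdf 0 1 z.1 * (Num.sg (vdm z.2) * \prod_(j < n) phi I l j (z.2 j 0)))%:E.
  case: z => x y; rewrite /f /=; congr EFin.
  rewrite big_ord_recr /= mxE s_max cons_col0 [xphi n x]/xphi ltnn.
  have -> : (\prod_(i < n) xphi (widen_ord (leqnSn n) i) ((row_perm s (col_mx x%:M y)) (widen_ord (leqnSn n) i) 0) =
      \prod_(j < n) phi I l j (y j 0))%R.
    apply: eq_bigr => i _; rewrite xphi_lt mxE.
    rewrite (_ : widen_ord _ i = lift ord_max i); last by apply/val_inj; rewrite /= /bump leqNgt ltn_ord.
    by rewrite s_lift cons_colS.
  suff -> : Num.sg (vdm (@xext n.+1 (row_perm s (col_mx x%:M y)))) = Num.sg (vdm y) by ring.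
  pose M : R := (1 + \sum_(j < n.+1) `|(row_perm s (col_mx x%:M y : 'cV[R]_n.+1)) j 0|)%R.
  have yM (j : 'I_n) : (y j 0 < M)%R.
    rewrite /M (bigD1 (lift ord_max j)) //= mxE s_lift cons_colS.
    apply: le_lt_trans (ler_norm _) _.
    set S := (\sum_(_ < _ | _) _)%R; have : (0 <= S)%R by exact: sumr_ge0.
    lra.
  have -> : @xext n.+1 (row_perm s (col_mx x%:M y)) = row_perm s (col_mx M%:M y).
    apply/matrixP => i j; rewrite ord1 mxE [RHS]mxE.
    case: (unliftP ord_max i) => [k|] ->.
      by rewrite lift_max ltn_ord mxE s_lift !cons_colS.
    by rewrite ltnn s_max cons_col0.
  rewrite vdm_perm vdm_cons odd_lift_perm odd_perm1 addbF /= addbF.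
  have -> : (\prod_j (y j 0 - M) = (-1) ^+ n * \prod_j (M - y j 0))%R.
    rewrite -[n in ((-1) ^+ n)%R]card_ord -prodr_const -big_split /=.
    by apply: eq_bigr => j _; rewrite mulN1r opprB.
  (* The sign [(-1)^n] of [s] cancels the signs of the [n] factors [y j - M], which are negative as
     [M] exceeds every entry. *)
  rewrite signr_odd mulrA mulrA -expr2 sqrr_sign mul1r sgrM gtr0_sg ?mul1r //.
  by apply: prodr_gt0 => j _; rewrite subr_gt0.
under eq_integral do rewrite fE.
rewrite (integral_prodm_mul (integrable_normal_pdf 0 1) integrable_sg_vdm_phi).
by rewrite integral_normal_pdf mul1e.
Qed.

Lemma pfaffian_Amat : (pfaffian (Amat 1 I l))%:E =
  \int[vecm R n]_y (Num.sg (vdm y) * \prod_(j < n) phi I l j (y j 0))%:E.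
Proof.
rewrite pfaffian_Amat_xphi; case: (odd n).
  by apply: integral_xphi_odd; rewrite addn1.
by apply: integral_xphi_even; rewrite addn0.
Qed.

End fixed_domain.
End pfaffian_integral.

(** * Summation over index sets and antisymmetrization *)

Section pfaffian_sum.
Variable R : realType.
Local Open Scope ereal_scope.

Definition nbelow n (l : R) (y : 'cV[R]_n) : nat := (\sum_(j < n) (y j 0%R < l)%R)%N.

Definition gweight n p (l : R) (y : 'cV[R]_n) : R :=
  ((nbelow l y == p)%:R * \prod_(j < n) (`|y j 0 - l| * expR (- y j 0 ^+ 2 / 2)))%R.

Lemma gweight_perm n p (l : R) (y : 'cV[R]_n) (s : 'S_n) :
  gweight p l (row_perm s y) = gweight p l y.
Proof.
rewrite /gweight; congr ((nat_of_bool (_ == p))%:R * _)%R.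
  rewrite /nbelow [RHS](reindex_inj (@perm_inj _ s)) /=.
  by apply: eq_bigr => j _; rewrite mxE.
by rewrite [RHS](reindex_inj (@perm_inj _ s)) /=; apply: eq_bigr => j _; rewrite mxE.
Qed.

Lemma indic_dom_I n (I : {set 'I_n}) (l x : R) (j : 'I_n) :
  \1_(dom_I I j l) x = (if j \in I then (x < l)%R else (l < x)%R)%:R :> R.
Proof.
rewrite indicE /dom_I.
have -> : [exists t in I, nat_of_ord t == j] = (j \in I).
  apply/existsP/idP => [[t /andP[tI /eqP/val_inj <-]]//|jI].
  by exists j; rewrite jI eqxx.
by case: (j \in I); rewrite mem_setE /= in_itv /= ?andbT.
Qed.

(** When no coordinate equals [l], a single set gives a nonzero product, namely the indices [j] with
    [y j < l]. If it has [p] elements, [p] of the factors [y j - l] are negative, and taking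
    absolute values costs [(-1)^p]. *)
Lemma sum_prod_phi n p (l : R) (y : 'cV[R]_n) :
  (\sum_(I : {set 'I_n} | #|I| == p) \prod_(j < n) phi I l j (y j 0) =
   (-1) ^+ p * (\prod_(j < n) y j 0 ^+ j * gweight p l y))%R.
Proof.
(* A coordinate equal to [l] lies in no domain, but both sides vanish through the factor
   [y j - l]. *)
have [/existsP[j /eqP yj]|] := boolP [exists j : 'I_n, y j 0%R == l].
  rewrite big1 => [|I _]; last by rewrite (bigD1 j) //= /phi /gmono yj subrr !(mulr0, mul0r).
  by rewrite /gweight (bigD1 j (F := fun j => (`|_| * _)%R)) //= yj subrr normr0 !(mulr0, mul0r).
rewrite negb_exists => /forallP yl.
pose J : {set 'I_n} := [set j : 'I_n | (y j 0 < l)%R]%SET.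
have cJ : #|J| = nbelow l y.
  by rewrite -sum1_card big_mkcond; apply: eq_bigr => j _; rewrite inE; case: (_ < _)%R.
have ind (I : {set 'I_n}) : (\prod_(j < n) \1_(dom_I I j l) (y j 0) = (I == J)%:R :> R)%R.
  have [->|IJ] := eqVneq I J.
    apply: big1 => j _; rewrite indic_dom_I inE.
    by case: ltgtP (yl j).
  have /existsP[j jIJ] : [exists j, (j \in I) != (j \in J)].
    by apply: contraNT IJ; rewrite negb_exists => /forallP h; apply/eqP/setP => j; apply/eqP/negPn.
  rewrite (bigD1 j) //= indic_dom_I; move: jIJ; rewrite inE.
  by case: (j \in I); case: ltgtP (yl j) => //= *; rewrite mul0r.
under eq_bigr do rewrite /phi big_split /= ind.
have key : (\prod_(j < n) gmono l j (y j 0) = (-1) ^+ nbelow l y *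
    (\prod_(j < n) y j 0 ^+ j * \prod_(j < n) (`|y j 0 - l| * expR (- y j 0 ^+ 2 / 2))))%R.
  rewrite /nbelow -prodrXr -!big_split /=; apply: eq_bigr => j _; rewrite /gmono.
  case: ltgtP (yl j) => // h _ /=.
    by rewrite ltr0_norm ?subr_lt0 // expr1; ring.
  by rewrite gtr0_norm ?subr_gt0 // expr0; ring.
rewrite -big_distrl /= key /gweight.
have -> : (\sum_(I : {set 'I_n} | #|I| == p) (I == J)%:R = (nbelow l y == p)%:R :> R)%R.
  have [e|ne] := eqVneq (nbelow l y) p.
    rewrite (bigD1 J) /= ?cJ ?e ?eqxx // big1 ?addr0 // => I /andP[_ /negbTE ->].
    by [].
  rewrite big1 // => I cI; case: eqP => // IJ; move: cI; rewrite IJ cJ.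
  by rewrite (negbTE ne).
by case: eqP => [->|_]; [ring|rewrite !(mul0r, mulr0)].
Qed.

Lemma integrable_vdm_gweight n p (l : R) : (vecm R n).-integrable [set: 'cV[R]_n]
  (fun y => (Num.sg (vdm y) * (\prod_(j < n) y j 0 ^+ j * gweight p l y))%:E).
Proof.
have -> : (fun y : 'cV[R]_n => (Num.sg (vdm y) * (\prod_(j < n) y j 0 ^+ j * gweight p l y))%:E) =
    (fun y => ((-1) ^+ p)%:E * (\sum_(I : {set 'I_n} | #|I| == p)
      (Num.sg (vdm y) * \prod_(j < n) phi I l j (y j 0))%:E)).
  apply/funext => y; rewrite sumEFin -big_distrr /= sum_prod_phi -EFinM; congr EFin.
  by rewrite [RHS]mulrCA signrMK.
apply: integrableZl => //; apply: integrable_sum => // I _.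
exact: integrable_sg_vdm_phi.
Qed.

Lemma sum_pfaffian_integral n p (l : R) :
  ((-1) ^+ p * \sum_(I : {set 'I_n} | #|I| == p) pfaffian (Amat 1 I l))%:E =
  \int[vecm R n]_y (Num.sg (vdm y) * (\prod_(j < n) y j 0 ^+ j * gweight p l y))%:E.
Proof.
rewrite EFinM -sumEFin; under eq_bigr do rewrite pfaffian_Amat.
rewrite -integral_sum //; last by move=> I; exact: integrable_sg_vdm_phi.
rewrite -integralZl //; last first.
  by apply: integrable_sum => // I _; exact: integrable_sg_vdm_phi.
apply: eq_integral => y _; rewrite sumEFin -big_distrr /= sum_prod_phi -EFinM; congr EFin.
by rewrite [LHS]mulrCA signrMK.
Qed.

(** The factorial is the number of renamings of the coordinates, each leaving the integral and
    [gweight] unchanged. The sign of the Vandermonde determinant contributes the sign of the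
    renaming, so the monomials add up to [vdm y], and sign times value is the modulus. *)
Lemma sum_pfaffian n p (l : R) :
  (n`!%:R * ((-1) ^+ p * \sum_(I : {set 'I_n} | #|I| == p) pfaffian (Amat 1 I l)))%:E =
  \int[vecm R n]_y (`|vdm y| * gweight p l y)%:E.
Proof.
rewrite EFinM sum_pfaffian_integral.
have i_f := integrable_vdm_gweight n p l.
set f := (fun y : 'cV[R]_n => _) in i_f *.
have /integrableP[mf _] := i_f.
rewrite -[in n`!](card_Sn n).
transitivity (\sum_(s : 'S_n) \int[vecm R n]_y f (row_perm s y)).
  under eq_bigr do rewrite -(integral_vecm_perm _ mf).
  rewrite -(fineK (integrable_fin_num measurableT i_f)) sumEFin sumr_const -EFinM.
  by rewrite mulr_natl.
rewrite -integral_sum //; last by move=> s; exact: integrable_vecm_perm.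
apply: eq_integral => y _; rewrite sumEFin; congr EFin.
rewrite [in RHS]normrEsg {2}vdm_expand -mulrA big_distrl big_distrr /=.
apply: eq_bigr => s _; rewrite vdm_perm gweight_perm sgrM sgr_signb.
have -> : (\prod_(j < n) (row_perm s y) j 0 ^+ j = \prod_(j < n) y (s j) 0 ^+ j)%R.
  by apply: eq_bigr => j _; rewrite mxE.
rewrite -[LHS]mulrA [LHS]mulrCA; apply: congr1.
by rewrite mulrA.
Qed.

End pfaffian_sum.

(** * Normalizing constants *)

Section gamma.
Variable R : realType.
Local Open Scope ereal_scope.
Notation leb := (@lebesgue_measure R).

Lemma integral_exp_tail (p dp : R -> R) (c : R) :
  (forall x : R, is_derive x 1%R p (dp x)) -> continuous dp -> (forall x, 0 <= dp x)%R ->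
  (p x @[x --> +oo%R] --> +oo)%R ->
  \int[leb]_(x in `[c, +oo[) (dp x * expR (- p x))%:E = (expR (- p c))%:E.
Proof.
move=> dpE cdp dp0 poo.
have dF (x : R) : is_derive x 1%R (fun x => - expR (- p x))%R (dp x * expR (- p x))%R.
  have dpx := dpE x.
  have h : is_derive x 1%R (expR \o (fun x => - p x))%R (expR (- p x) * - dp x)%R.
    by apply: is_derive1_comp.
  by apply: is_derive_eq; rewrite mulrN opprK mulrC.
have cp : continuous p.
  by move=> x; apply: differentiable_continuous; apply/derivable1_diffP; case: (dpE x).
have cE : continuous (fun x => expR (- p x))%R.
  move=> x; apply: continuous_comp; last exact: continuous_expR.
  by apply: continuousN; exact: cp.
rewrite (@ge0_continuous_FTC2y R _ (fun x => - expR (- p x))%R c 0%R).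
- by rewrite sub0e EFinN oppeK.
- by move=> x _; rewrite mulr_ge0 ?expR_ge0.
- apply: continuous_subspaceT => x; apply: cvgM; [exact: cdp|exact: cE].
- rewrite -[X in _ --> X]oppr0; apply: cvgN.
  exact: (cvg_comp _ _ poo (@cvgr_expR R)).
- by move=> x _; case: (dF x).
- apply: cvg_at_right_filter; apply: cvgN; exact: cE.
- by move=> x _; rewrite derive1E; case: (dF x).
Qed.

Lemma cvgy_expR : (expR x @[x --> +oo%R] --> (+oo : set_system R))%R.
Proof.
apply/cvgryPge => A; near=> x.
apply: (@le_trans _ _ x); last by apply: le_trans (expR_ge1Dx x); rewrite lerDr.
by near: x; apply: nbhs_pinfty_ge; rewrite num_real.
Unshelve. all: by end_near. Qed.

Lemma integral_exp_exp_tail (u : R) :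
  \int[leb]_(v in `[u, +oo[) (expR (v - expR v))%:E = (expR (- expR u))%:E.
Proof.
rewrite -(@integral_exp_tail expR expR) //; first by apply: eq_integral => v _; rewrite expRD.
- exact: continuous_expR.
- exact: cvgy_expR.
Qed.

Lemma integral_exp_linear_tail (a c : R) : (0 < a)%R ->
  \int[leb]_(x in `[c, +oo[) (a * expR (- (a * x)))%:E = (expR (- (a * c)))%:E.
Proof.
move=> a0; apply: (@integral_exp_tail (fun x => a * x)%R (fun=> a)) => //.
- by move=> x; apply: is_derive_eq; rewrite !scaler1 //=.
- by move=> x; exact: cst_continuous.
- by move=> x; exact: ltW.
- by apply: gt0_cvgMry.
Qed.

(* Euler's integral after the substitution [t = exp u]. *)
Definition gammaR (a : R) : \bar R := \int[leb]_u (expR (a * u - expR u))%:E.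

Lemma measurable_expR_lin (a : R) :
  measurable_fun [set: measurableTypeR R] (fun u : R => expR (a * u - expR u)).
Proof.
apply: measurableT_comp; first exact: measurable_expR.
apply: measurable_funB; last exact: measurable_expR.
by apply: measurable_funM; [exact: measurable_cst|exact: measurable_id].
Qed.

Lemma integral_indic_scale (D : set R) (c : R) (f : R -> R) : measurable D ->
  measurable_fun [set: measurableTypeR R] f -> (forall x, 0 <= f x)%R -> (0 <= c)%R ->
  \int[leb]_x (\1_D x * (c * f x))%:E = c%:E * \int[leb]_(x in D) (f x)%:E.
Proof.
move=> mD mf f0 c0.
have mfD : measurable_fun D (fun x => (f x)%:E).
  by apply/measurable_EFinP; apply: measurable_funTS; exact: mf.
have c0' : 0 <= c%:E by rewrite lee_fin.
have f0' x : D x -> 0 <= (f x)%:E by rewrite lee_fin.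
transitivity (\int[leb]_(x in D) (c%:E * (f x)%:E)); last exact: ge0_integralZl.
rewrite [RHS]integral_mkcond.
apply: eq_integral => x _; rewrite patchE indicE.
by case: (x \in D); rewrite ?mul1r ?mul0r // EFinM.
Qed.

(* [exp (- exp u)] is a tail integral; exchanging the order of integration
   replaces an integration by parts. *)
Lemma gammaRS (a : R) : (0 < a)%R -> a%:E * gammaR a = gammaR (a + 1).
Proof.
move=> a0.
pose f (u v : R) := ((u <= v)%R%:R * (a * expR (a * u) * expR (v - expR v)))%:E.
have mle : measurable_fun [set: measurableTypeR R * measurableTypeR R]
    (fun z => ((z.1 <= z.2)%R%:R : R)).
  by apply: measurable_fun_boolr; apply: measurable_fun_ler.
have mf : measurable_fun [set: measurableTypeR R * measurableTypeR R] (fun z => f z.1 z.2).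
  apply: measurable_EFin_fun; apply: measurable_funM => //; apply: measurable_funM.
    apply: measurable_funM; first exact: measurable_cst.
    apply: measurableT_comp; first exact: measurable_expR.
    by apply: measurable_funM; [exact: measurable_cst|exact: measurable_fst].
  apply: measurableT_comp; first exact: measurable_expR.
  apply: measurable_funB; first exact: measurable_snd.
  by apply: measurableT_comp; [exact: measurable_expR|exact: measurable_snd].
have f0 (u v : R) : 0 <= f u v.
  by rewrite lee_fin !mulr_ge0 ?expR_ge0 ?(ltW a0) ?ler0n.
have swap := tonelli_swap leb leb (fun u v : measurableTypeR R => f u v) mf f0.
have tail (u : R) : \int[leb]_v f u v = (a * expR (a * u) * expR (- expR u))%:E.
  transitivity ((a * expR (a * u))%:E * \int[leb]_(v in `[u, +oo[) (expR (v - expR v))%:E).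
    have mE : measurable_fun [set: measurableTypeR R] (fun v : R => expR (v - expR v)).
      have := @measurable_expR_lin 1; congr measurable_fun.
      by apply/funext => v; rewrite mul1r.
    have c0 : (0 <= a * expR (a * u))%R by rewrite mulr_ge0 ?expR_ge0 ?ltW.
    apply: (eq_trans _ (integral_indic_scale (measurable_itv `[u, +oo[) mE (fun v => expR_ge0 _) c0)).
    by apply: eq_integral => v _; rewrite indicE mem_setE /= in_itv /= andbT.
  by rewrite integral_exp_exp_tail -EFinM.
have tail2 (v : R) : \int[leb]_u f u v = (expR (a * v) * expR (v - expR v))%:E.
  have m1 : measurable_fun [set: measurableTypeR R] (fun u : measurableTypeR R => f u v).
    apply: (measurableT_comp mf (g := fun u : measurableTypeR R => (u, v : measurableTypeR R))).
    exact: measurable_fun_pair.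
  have N1 : (-1 : R)%R != 0%R by rewrite oppr_eq0 oner_eq0.
  rewrite (ge0_integral_affine 0%R N1 m1 (fun u => f0 u v)) normrN1 mul1e.
  transitivity ((expR (v - expR v))%:E * \int[leb]_(x in `[(- v)%R, +oo[) (a * expR (- (a * x)))%:E).
    have mE : measurable_fun [set: measurableTypeR R] (fun x : R => a * expR (- (a * x)))%R.
      apply: measurable_funM; first exact: measurable_cst.
      apply: measurableT_comp; first exact: measurable_expR.
      by apply: measurable_funN; apply: measurable_funM; [exact: measurable_cst|exact: measurable_id].
    have E0 (x : R) : (0 <= a * expR (- (a * x)))%R by rewrite mulr_ge0 ?expR_ge0 ?ltW.
    apply: (eq_trans _ (integral_indic_scale (measurable_itv `[(- v)%R, +oo[) mE E0 (expR_ge0 _))).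
    apply: eq_integral => x _; rewrite indicE mem_setE /= in_itv /= andbT /f addr0 mulN1r lerNl.
    by rewrite mulrN [(expR _ * _)%R]mulrC.
  by rewrite (integral_exp_linear_tail (- v) a0) -EFinM mulrN opprK [in RHS]mulrC.
transitivity (\int[leb]_u \int[leb]_v f u v).
  have mE : measurable_fun [set: measurableTypeR R] (fun u => (expR (a * u - expR u))%:E).
    by apply: measurable_EFin_fun; exact: measurable_expR_lin.
  have E0 (u : measurableTypeR R) : [set: measurableTypeR R] u -> 0 <= (expR (a * u - expR u))%:E.
    by rewrite lee_fin expR_ge0.
  have a0' : 0 <= a%:E by rewrite lee_fin ltW.
  apply: (eq_trans (esym (ge0_integralZl leb measurableT mE E0 a0'))).
  by apply: eq_integral => u _; rewrite tail -EFinM expRD mulrA.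
rewrite swap; apply: eq_integral => v _; rewrite tail2 -expRD; congr (expR _)%:E; ring.
Qed.

(** With [c = 1] it turns [gammaR] into Euler's integral, with [c = 2] into an absolute Gaussian
    moment. *)
Lemma ln_substitution (c : R) (g : R -> \bar R) : (0 < c)%R ->
  measurable_fun [set: measurableTypeR R] g -> (forall y, 0 <= g y) ->
  \int[leb]_y g y = \int[leb]_(x in `]0%R, +oo[) ((c / x)%:E * g (c * ln x)%R).
Proof.
move=> c0 mg g0.
have pos (x : R) : [set` `]0%R, +oo[] x -> (0 < x)%R by rewrite /= in_itv /= andbT.
apply: (@ge0_integral_substitution R _ (fun x => c * ln x)%R (fun x => c / x)%R) => //.
- by move=> x y /pos x0 _ z /andP[xz _]; rewrite /= in_itv /= andbT (lt_le_trans x0).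
- move=> x /pos x0; have := is_derive1_ln x0 => dl.
  by apply: is_derive_eq.
- move=> x /pos x0; apply: cvgM; first exact: cvg_cst.
  by apply: cvgV; rewrite ?gt_eqF //; exact: cvg_id.
- by move=> x /pos x0; rewrite divr_ge0 ?ltW.
- by move=> x y /pos x0 /pos y0 xy; rewrite ltr_pM2l // ltr_ln ?posrE.
- move=> y; exists (expR (y / c)); first by rewrite /= in_itv /= expR_gt0.
  by rewrite expRK mulrC divfK ?gt_eqF.
Qed.

Lemma gammaR_Gamma (a : R) :
  \int[leb]_(t in `]0%R, +oo[) (t `^ (a - 1) * expR (- t))%:E = gammaR a.
Proof.
rewrite /gammaR (ln_substitution ltr01); last 2 first.
- by apply: measurable_EFin_fun; exact: measurable_expR_lin.
- by move=> y; rewrite lee_fin expR_ge0.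
apply: eq_integral => x; rewrite inE /= in_itv /= andbT => x0.
rewrite -EFinM !mul1r lnK ?posrE // expRD mulrA; congr (_ * _)%:E.
rewrite /powR gt_eqF // mulrBl mul1r expRD expRN lnK ?posrE //.
by rewrite mulrC.
Qed.

(** The factor 2 of the substitution [u = 2 ln x] is the factor between the half-line and the whole
    line for an even integrand. *)
Lemma gammaR_gauss n : gammaR (n.+1%:R / 2) = \int[leb]_x (`|x| ^+ n * expR (- x ^+ 2))%:E.
Proof.
have mE : measurable_fun [set: measurableTypeR R]
    (fun u : R => (expR (n.+1%:R / 2 * u - expR u))%:E).
  by apply: measurable_EFin_fun; exact: measurable_expR_lin.
have E0 (u : R) : 0 <= (expR (n.+1%:R / 2 * u - expR u))%:E by rewrite lee_fin expR_ge0.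
have two : (0 < 2 :> R)%R by [].
rewrite /gammaR (ln_substitution two mE E0).
rewrite ge0_symfun_integralT; last 3 first.
- by move=> x; rewrite mulr_ge0 ?expR_ge0 ?exprn_ge0.
- move=> x; apply: cvgM; last exact: continuous_gauss_fun.
  apply: (continuous_comp (f := fun x : R => `|x|%R) (g := fun x : R => (x ^+ n)%R)).
    exact: norm_continuous.
  exact: exprn_continuous.
- by move=> x; rewrite /= normrN sqrrN.
rewrite (_ : [set x : R | (0 <= x)%R] = `[0%R, +oo[%classic); last first.
  by apply/seteqP; split => x /=; rewrite in_itv /= andbT.
have mx : measurable_fun [set: measurableTypeR R] (fun x : R => (`|x| ^+ n * expR (- x ^+ 2))%R).
  apply: measurable_funM; last exact: measurable_gauss_fun.
  by apply: measurable_funX; exact: measurable_norm_fun.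
rewrite -integral_itv_obnd_cbnd; last first.
  by apply/measurable_EFinP; apply: measurable_funTS; exact: mx.
have two' : 0 <= 2%:E :> \bar R by rewrite lee_fin.
have mxD : measurable_fun (`]0%R, +oo[%classic : set (measurableTypeR R))
    (fun x => (`|x| ^+ n * expR (- x ^+ 2))%:E).
  by apply/measurable_EFinP; apply: measurable_funTS; exact: mx.
have x0D (x : measurableTypeR R) : `]0%R, +oo[%classic x -> 0 <= (`|x| ^+ n * expR (- x ^+ 2))%:E.
  by move=> _; rewrite lee_fin mulr_ge0 ?expR_ge0 ?exprn_ge0.
apply: (eq_trans _ (ge0_integralZl leb (measurable_itv _) mxD x0D two')).
apply: eq_integral => x; rewrite inE /= in_itv /= andbT => x0.
rewrite -!EFinM; congr EFin; rewrite gtr0_norm // expRD.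
rewrite -[X in expR (- X)](_ : (x ^+ 2)%R = _); last first.
  by rewrite -[in LHS](lnK x0) -expRM_natl.
rewrite (_ : (n.+1%:R / 2 * (2 * ln x) = n.+1%:R * ln x)%R); last by field.
rewrite expRM_natl lnK ?posrE // exprS; field.
by rewrite gt_eqF.
Qed.

End gamma.

Section constants.
Variable R : realType.
Local Open Scope ereal_scope.
Notation leb := (@lebesgue_measure R).

Lemma sqnorm_cons n (x : R) (y : 'cV[R]_n) : sqnorm (col_mx x%:M y) = (x ^+ 2 + sqnorm y)%R.
Proof.
rewrite /sqnorm tr_col_mx mul_row_col mxE tr_scalar_mx -scalar_mxM mxE eqxx mulr1n.
by rewrite expr2.
Qed.

Lemma sqnormZ n (t : R) (y : 'cV[R]_n) : sqnorm (t *: y) = (t ^+ 2 * sqnorm y)%R.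
Proof. by rewrite /sqnorm trmxZ -scalemxAl -scalemxAr scalerA mxE expr2. Qed.

Lemma measurable_expR_sqnorm n (c : R) :
  measurable_fun [set: 'cV[R]_n] (fun y : 'cV[R]_n => (expR (- (c * sqnorm y)))%:E).
Proof.
apply: measurable_EFin_fun; apply: measurableT_comp; first exact: measurable_expR.
apply: measurable_funN; apply: measurable_funM; first exact: measurable_cst.
by apply: measurable_sqnorm; exact: measurable_id.
Qed.

Lemma integral_vecm_gauss n :
  \int[vecm R n]_x (expR (- sqnorm x))%:E = (Num.sqrt pi ^+ n)%:E.
Proof.
elim: n => [|n IH].
  rewrite integral_vecm0; last by move=> y; rewrite lee_fin expR_ge0.
  by rewrite /sqnorm mulmx0 mxE oppr0 expR0.
have mg m : measurable_fun [set: 'cV[R]_m] (fun x : 'cV[R]_m => (expR (- sqnorm x))%:E).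
  by have := @measurable_expR_sqnorm m 1; under eq_fun do rewrite mul1r.
have g0 m (x : 'cV[R]_m) : 0 <= (expR (- sqnorm x))%:E by rewrite lee_fin expR_ge0.
rewrite (integral_vecmS (mg (1 + n)%N) (g0 _)).
have mG : measurable_fun [set: measurableTypeR R] (fun x => (gauss_fun x)%:E).
  by apply: measurable_EFin_fun; exact: measurable_gauss_fun.
have G0 (x : measurableTypeR R) : [set: measurableTypeR R] x -> 0 <= (gauss_fun x)%:E.
  by rewrite lee_fin gauss_fun_ge0.
have s0 : 0 <= (Num.sqrt pi ^+ n)%:E :> \bar R by rewrite lee_fin exprn_ge0.
transitivity (\int[leb]_x ((Num.sqrt pi ^+ n)%:E * (gauss_fun x)%:E)).
  apply: eq_integral => x _; rewrite muleC -IH.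
  rewrite -(ge0_integralZl _ measurableT (mg n) (fun y _ => g0 n y) (G0 x I)).
  by apply: eq_integral => y _; rewrite sqnorm_cons opprD expRD EFinM.
rewrite (ge0_integralZl _ measurableT mG G0 s0) integralT_gauss -EFinM.
by rewrite exprSr.
Qed.

(* Both sides are the Gaussian integral over [R^(1+n)], in the coordinates
   [(t, t w)] on the left. *)
Lemma cvol_gamma n : cvol R n * gammaR (n.+1%:R / 2) = (Num.sqrt pi ^+ n.+1)%:E.
Proof.
have mg : measurable_fun [set: 'cV[R]_(1 + n)] (fun x : 'cV[R]_(1 + n) => (expR (- sqnorm x))%:E).
  by have := @measurable_expR_sqnorm (1 + n) 1; under eq_fun do rewrite mul1r.
rewrite -integral_vecm_gauss (integral_vecmS mg); last by move=> y; rewrite lee_fin expR_ge0.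
pose f (t : R) (w : 'cV[R]_n) := (`|t| ^+ n * expR (- (t ^+ 2 * (1 + sqnorm w))))%:E.
have mf : measurable_fun [set: measurableTypeR R * 'cV[R]_n] (fun z => f z.1 z.2).
  apply: measurable_EFin_fun; apply: measurable_funM.
    by apply: measurable_funX; apply: measurable_norm_fun; exact: measurable_fst.
  apply: measurableT_comp; first exact: measurable_expR.
  apply: measurable_funN; apply: measurable_funM; first by apply: measurable_funX; exact: measurable_fst.
  apply: measurable_funD; first exact: measurable_cst.
  by apply: measurable_sqnorm; exact: measurable_snd.
have f0 (t : R) (w : 'cV[R]_n) : 0 <= f t w by rewrite lee_fin mulr_ge0 ?exprn_ge0 ?expR_ge0.
have swap := tonelli_swap leb (vecm R n) (fun (t : measurableTypeR R) (w : 'cV[R]_n) => f t w) mf f0.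
have mh : measurable_fun [set: measurableTypeR R * 'cV[R]_n]
    (fun z => (expR (- sqnorm (col_mx z.1%:M z.2)))%:E).
  by apply: (measurableT_comp mg); measurable_mx.
have e : \int[leb]_t \int[vecm R n]_y (expR (- sqnorm (col_mx t%:M y)))%:E =
    \int[leb]_t \int[vecm R n]_w f t w.
  (* Scaling by [t] is invertible only for [t != 0]; the excluded point is null. *)
  apply: (@eq_integral_off_null _ _ _ leb [set 0%R : measurableTypeR R]).
  - exact: measurable_set1.
  - exact: lebesgue_measure_set1.
  - exact: (measurable_integral_param (vecm R n) (fun (t : measurableTypeR R) (w : 'cV[R]_n) =>
      (expR (- sqnorm (col_mx t%:M w)))%:E) mh).
  - exact: (measurable_integral_param (vecm R n) (fun (t : measurableTypeR R) (w : 'cV[R]_n) => f t w) mf).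
  - by move=> t; apply: integral_ge0 => y _; rewrite lee_fin expR_ge0.
  - by move=> t; apply: integral_ge0 => y _; exact: f0.
  move=> t /eqP t0.
  have ut : (t%:M : 'M[R]_n) \in unitmx by rewrite unitmxE det_scalar unitfE expf_neq0.
  have mt : measurable_fun [set: 'cV[R]_n] (fun y : 'cV[R]_n => (expR (- sqnorm (col_mx t%:M y)))%:E).
    by apply: (measurableT_comp mh (g := fun y => (t, y))); exact: measurable_fun_pair.
  have t00 (y : 'cV[R]_n) : 0 <= (expR (- sqnorm (col_mx t%:M y)))%:E by rewrite lee_fin expR_ge0.
  rewrite (vec_change_unit ut mt t00) det_scalar normrX.
  have mt2 : measurable_fun [set: 'cV[R]_n]
      (fun y : 'cV[R]_n => (expR (- sqnorm (col_mx t%:M (t%:M *m y))))%:E).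
    by apply: (measurableT_comp mt); measurable_mx.
  have tn0 : 0 <= (`|t| ^+ n)%:E by rewrite lee_fin exprn_ge0.
  rewrite -(ge0_integralZl _ measurableT mt2 (fun y _ => t00 _) tn0).
  apply: eq_integral => w _; rewrite -EFinM mul_scalar_mx sqnorm_cons sqnormZ.
  by congr (_ * expR (- _))%:E; rewrite mulrDr mulr1.
rewrite e swap.
have mc : measurable_fun [set: 'cV[R]_n] (fun w : 'cV[R]_n => ((Num.sqrt (1 + sqnorm w) ^+ n.+1)^-1)%:E).
  apply/measurable_EFinP; apply: (measurableT_comp (@measurable_invr R)).
  apply: measurable_funX; apply: (measurableT_comp (continuous_measurable_fun (@sqrt_continuous R))).
  by apply: measurable_funD => //; apply: measurable_sqnorm; exact: measurable_id.
have c0 (w : 'cV[R]_n) : [set: 'cV[R]_n] w -> 0 <= ((Num.sqrt (1 + sqnorm w) ^+ n.+1)^-1)%:E.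
  by rewrite lee_fin invr_ge0 exprn_ge0 ?sqrtr_ge0.
have g0 : 0 <= gammaR (n.+1%:R / 2 : R).
  by apply: integral_ge0 => u _; rewrite lee_fin expR_ge0.
rewrite muleC /cvol -(ge0_integralZl _ measurableT mc c0 g0).
apply: eq_integral => w _.
(* Rescaling the Gaussian moment by [q] produces [q^(n+1)], the reciprocal of the integrand of
   [cvol]. *)
set q := Num.sqrt (1 + sqnorm w).
have q0 : (0 < q)%R by rewrite sqrtr_gt0 ltr_pwDl // sqnorm_ge0.
have q2 : (q ^+ 2 = 1 + sqnorm w)%R by rewrite sqr_sqrtr // addr_ge0 // sqnorm_ge0.
have mG : measurable_fun [set: measurableTypeR R] (fun x : R => (`|x| ^+ n * expR (- x ^+ 2))%:E).
  apply: measurable_EFin_fun; apply: measurable_funM; last exact: measurable_gauss_fun.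
  by apply: measurable_funX; exact: measurable_norm_fun.
have G0 (x : R) : 0 <= (`|x| ^+ n * expR (- x ^+ 2))%:E by rewrite lee_fin mulr_ge0 ?exprn_ge0 ?expR_ge0.
have qn0 : q != 0%R by rewrite gt_eqF.
rewrite gammaR_gauss (ge0_integral_affine 0%R qn0 mG G0).
have mfw : measurable_fun [set: measurableTypeR R] (fun t : measurableTypeR R => f t w).
  by apply: (measurableT_comp mf (g := fun t : measurableTypeR R => (t, w))); exact: measurable_fun_pair.
have -> : \int[leb]_x (`|q * x + 0| ^+ n * expR (- (q * x + 0) ^+ 2))%:E = (q ^+ n)%:E * \int[leb]_t f t w.
  have qn : 0 <= (q ^+ n)%:E by rewrite lee_fin exprn_ge0 // ltW.
  apply: (eq_trans _ (ge0_integralZl leb measurableT mfw (fun t _ => f0 t w) qn)).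
  apply: eq_integral => t _; rewrite /f -EFinM addr0 normrM exprMn gtr0_norm //.
  by rewrite -q2 -mulrA; congr (_ * (_ * expR (- _)))%:E; rewrite exprMn mulrC.
rewrite [LHS]muleC !muleA -!EFinM gtr0_norm // -mulrA -exprS mulVf ?mul1e //.
by rewrite expf_neq0.
Qed.

Lemma gammaR_ge0 (a : R) : 0 <= gammaR a.
Proof. by apply: integral_ge0 => u _; rewrite lee_fin expR_ge0. Qed.

(** Finiteness of Euler's integral follows from [cvol_gamma]: if a product of nonnegative factors is
    finite and nonzero, no factor is infinite. Hence the real-valued [Gammaf] loses nothing. *)
Lemma gammaR_Gammaf n : gammaR (n.+1%:R / 2 : R) = (Gammaf (n.+1%:R / 2))%:E.
Proof.
rewrite /Gammaf /Rintegral gammaR_Gamma.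
have := cvol_gamma n; have := gammaR_ge0 (n.+1%:R / 2).
case: (gammaR _) => [r||] // _.
have s0 : (0 < Num.sqrt pi ^+ n.+1 :> R)%R by rewrite exprn_gt0 // sqrtr_gt0 pi_gt0.
have := cvol_ge0 R n; case: (cvol R n) => [c||] // c0.
rewrite lee_fin in c0; move: c0; rewrite le_eqVlt => /orP[/eqP <-|c0].
  by rewrite mul0e => -[] s; rewrite -s ltxx in s0.
by rewrite gt0_muley.
Qed.

Lemma cvolE n : cvol R n = (Num.sqrt pi ^+ n.+1 / Gammaf (n.+1%:R / 2))%:E.
Proof.
have := cvol_gamma n; rewrite gammaR_Gammaf.
have s0 : (Num.sqrt pi ^+ n.+1 != 0 :> R)%R.
  by rewrite expf_neq0 // gt_eqF // sqrtr_gt0 pi_gt0.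
have := cvol_ge0 R n; case: (cvol R n) => [c||] // c0.
  by rewrite -EFinM => -[e]; rewrite -e mulfK //; apply: contraNneq s0 => g0; rewrite -e g0 mulr0.
have G0 := gammaR_ge0 (n.+1%:R / 2); rewrite gammaR_Gammaf lee_fin in G0.
move: G0; rewrite le_eqVlt => /orP[/eqP <-|G0].
  by rewrite mule0 => -[] s; rewrite -s eqxx in s0.
by rewrite gt0_mulye.
Qed.

Lemma Gammaf_neq0 n : Gammaf (n.+1%:R / 2) != 0%R :> R.
Proof.
have := cvol_gamma n; rewrite gammaR_Gammaf cvolE -EFinM => -[].
have s0 : (Num.sqrt pi ^+ n.+1 != 0 :> R)%R.
  by rewrite expf_neq0 // gt_eqF // sqrtr_gt0 pi_gt0.
by move=> e; apply: contraNneq s0 => g0; rewrite -e g0 mulr0.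
Qed.

Lemma Gammaf_halfS n : Gammaf (1 + n.+1%:R / 2) = (n.+1%:R / 2 * Gammaf (n.+1%:R / 2))%R :> R.
Proof.
have n0 : (0 < n.+1%:R / 2 :> R)%R by rewrite divr_gt0.
have e : (1 + n.+1%:R / 2 = n.+3%:R / 2 :> R)%R by rewrite -[n.+3]addn2 natrD; field.
apply: EFin_inj; rewrite EFinM -(gammaR_Gammaf n) (gammaRS n0) [(_ + 1)%R]addrC e.
by rewrite (gammaR_Gammaf n.+2).
Qed.

Lemma Gammaf_half : Gammaf (1%:R / 2) = Num.sqrt pi :> R.
Proof.
apply: EFin_inj; rewrite -(gammaR_Gammaf 0) gammaR_gauss -integralT_gauss.
by apply: eq_integral => x _; rewrite expr0 mul1r.
Qed.

(** The value of the GOE density at the zero matrix; bordering a matrix of size [m] adds one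
    diagonal and [m] independent off-diagonal entries. *)
Fixpoint gnorm n : R :=
  (if n is m.+1 then normal_peak 1 * normal_peak (Num.sqrt (1 / 2)) ^+ m * gnorm m else 1)%R.

(** The origin of [kN]. The step from [n] to [n + 1] multiplies the left side by
    [(2 pi)^(-1/2) sqrt pi / Gamma ((n+1)/2)], as all other powers of [pi] cancel. By
    [Gamma (3/2) = sqrt pi / 2] and the functional equation this is [(2 pi)^(-1/2) Gamma (3/2) (n+1)
    / Gamma (1 + (n+1)/2)]. *)
Lemma gnorm_cprod n : (gnorm n)%:E * cprod R n = (kN R n * n`!%:R)%:E.
Proof.
have g32 : Gammaf (3 / 2) = (Num.sqrt pi / 2)%R :> R.
  rewrite (_ : 3 / 2 = 1 + 1%:R / 2 :> R)%R; last by field.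
  by rewrite (Gammaf_halfS 0) Gammaf_half; field.
have p2 : normal_peak (Num.sqrt (1 / 2)) = (Num.sqrt pi)^-1%R :> R.
  rewrite /normal_peak sqr_sqrtr ?divr_ge0 //; congr (Num.sqrt _)^-1%R.
  by rewrite -mulr_natr; field.
have pi0 : (0 < pi :> R)%R := pi_gt0 R.
have s0 : Num.sqrt pi != 0%R :> R by rewrite gt_eqF // sqrtr_gt0.
elim: n => [|n IH].
  by rewrite /= mul1e /kN big_geq // expr0 divr1 mulr1 fact0 mulr1 mul0r oppr0 powRr0.
rewrite /= EFinM muleACA IH cvolE -!EFinM; congr EFin.
rewrite /kN [in RHS]big_nat_recr //= (Gammaf_halfS n) factS natrM g32 p2.
have -> : ((2 * pi) `^ (- (n.+1%:R / 2)) = (2 * pi) `^ (- (n%:R / 2)) * normal_peak 1 :> R)%R.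
  have tp0 : (2 * pi != 0 :> R)%R by rewrite mulf_neq0 // gt_eqF.
  have e2 : (- (n.+1%:R / 2) = - (n%:R / 2) + - 2^-1 :> R)%R by rewrite -natr1; field.
  rewrite e2 powRD; last by rewrite tp0 implybT.
  congr (_ * _)%R; rewrite /normal_peak expr1n mul1r -[(pi *+ 2)%R]mulr_natl powRN.
  by rewrite powR12_sqrt // mulr_ge0 // ltW.
set P := (\prod_(1 <= i < _) _)%R.
have P0 : P != 0%R.
  rewrite /P prodf_seq_neq0; apply/allP => i; rewrite mem_index_iota => /andP[i1 _] /=.
  case: i i1 => // i _; rewrite (Gammaf_halfS i).
  by apply: mulf_neq0; [rewrite mulf_neq0 // ?invr_eq0 pnatr_eq0|exact: Gammaf_neq0].
have n1 : (1 + n%:R != 0 :> R)%R by rewrite addrC natr1 pnatr_eq0.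
rewrite exprVn !exprS -natr1 [(n%:R + 1)%R]addrC; field.
by rewrite P0 n1 expf_neq0 // addrC natr1 Gammaf_neq0.
Qed.

End constants.

(** * Iterated integrals over the matrix entries *)

Section iterated_integrals.
Variable R : realType.
Local Open Scope ereal_scope.

Lemma eq_iint (T : eqType) (s : seq T) (f g : (T -> R) -> \bar R) :
  (forall v, f v = g v) -> iint s f = iint s g.
Proof. by move=> fg; congr iint; apply/funext. Qed.

Lemma iint_cat (T : eqType) (s1 s2 : seq T) (f : (T -> R) -> \bar R) :
  iint (s1 ++ s2) f =
  iint s1 (fun v1 => iint s2 (fun v2 => f (fun u => if u \in s1 then v1 u else v2 u))).
Proof.
elim: s1 f => [|t s1 IH] f /=; first exact: eq_iint.
apply: eq_integral => x _; rewrite IH; apply: eq_iint => v1; apply: eq_iint => v2.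
congr f; apply/funext => u; rewrite inE.
by case: (u == t).
Qed.

(** [hinv] is the partial inverse of [h]. Indices outside its image receive 0, the value [iint]
    gives to coordinates that are not listed. *)
Lemma iint_map (T T' : eqType) (h : T -> T') (hinv : T' -> option T) (s : seq T)
    (f : (T' -> R) -> \bar R) :
  (forall t, hinv (h t) = Some t) -> (forall u t, hinv u = Some t -> u = h t) ->
  iint (map h s) f = iint s (fun v => f (fun u => oapp v 0%R (hinv u))).
Proof.
move=> hK hV; elim: s f => [|t s IH] f /=.
  by congr f; apply/funext => u; case: (hinv u).
apply: eq_integral => x _; rewrite IH; apply: eq_iint => v.
congr f; apply/funext => u; case e : (hinv u) => [w|] /=.
  rewrite (hV _ _ e); congr (if _ then _ else _).
  by apply/eqP/eqP => [/(congr1 hinv)|->//]; rewrite !hK => -[].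
by case: eqP => // ut; rewrite ut hK in e.
Qed.

Lemma iint_enum_ord n (g : 'cV[R]_n -> \bar R) :
  measurable_fun [set: 'cV[R]_n] g -> (forall y, 0 <= g y) ->
  iint (enum 'I_n) (fun v => g (\col_j v j)%R) = \int[vecm R n]_y g y.
Proof.
elim: n g => [|n IH] g mg g0.
  rewrite integral_vecm0 //.
  have -> /= : enum 'I_0 = [::] by apply/nilP; rewrite /nilp size_enum_ord.
  by congr g; apply/matrixP => -[].
move: g mg g0; rewrite -[n.+1]/(1 + n)%N => g mg g0.
rewrite (integral_vecmS mg g0) enum_ordSl /=; apply: eq_integral => x _.
rewrite (@iint_map _ _ (lift ord0) (unlift ord0)); last 2 first.
- by move=> t; rewrite liftK.
- by move=> u t; case: unliftP => // j -> [->].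
have mgx : measurable_fun [set: 'cV[R]_n] (fun y => g (col_mx x%:M y)).
  by apply: (measurableT_comp mg); measurable_mx.
rewrite -(IH _ mgx (fun y => g0 _)); apply: eq_iint => v; congr g.
apply/matrixP => i j; rewrite ord1 [LHS]mxE.
case: (unliftP ord0 i) => [k|] -> /=.
  by rewrite (cons_colS x) mxE.
by rewrite (cons_col0 x).
Qed.

Lemma goe_idxS n : goe_idx n.+1 = (ord0, ord0) ::
  [seq (ord0, lift ord0 j) | j <- enum 'I_n] ++
  [seq (lift ord0 p.1, lift ord0 p.2) | p <- goe_idx n].
Proof.
rewrite /goe_idx; have en m : enum {: 'I_m * 'I_m} = [seq (i, j) | i <- enum 'I_m, j <- enum 'I_m].
  by rewrite enumT unlock.
rewrite !en enum_ordSl; move: (enum 'I_n) => s /=; rewrite filter_cat /= -cat_cons; congr (_ :: _ ++ _).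
  rewrite -map_comp filter_map /=; congr map.
  by apply/all_filterP/allP.
rewrite filter_flatten -!map_comp.
rewrite [in RHS]filter_flatten map_flatten -!map_comp; congr flatten.
apply: eq_map => i /=.
by rewrite -map_comp !filter_map -map_comp; congr map; apply: eq_filter.
Qed.

Lemma goe_mat_cons n (x : R) (w : 'I_n -> R) (w2 : 'I_n * 'I_n -> R) :
  goe_mat (fun u : 'I_n.+1 * 'I_n.+1 => if u == (ord0, ord0) then x else
    if u \in [seq (ord0, lift ord0 j) | j <- enum 'I_n]
    then oapp w 0%R (if u.1 == ord0 then unlift ord0 u.2 else None)
    else oapp w2 0%R (if unlift ord0 u.1 is Some a then
                      if unlift ord0 u.2 is Some b then Some (a, b) else None else None)) =
  block_mx x%:M (\col_j w j)^T (\col_j w j) (goe_mat w2) :> 'M[R]_(1 + n).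
Proof.
have lr (j : 'I_n) : (ord0, lift ord0 j) \in [seq (ord0, lift ord0 j) | j <- enum 'I_n].
  by apply/mapP; exists j; rewrite ?mem_enum.
have e0 : (ord0 : 'I_(1 + n)) = lshift n (ord0 : 'I_1) by exact/val_inj.
have eS (j : 'I_n) : lift ord0 j = rshift 1 j by exact/val_inj.
apply/matrixP => i j; rewrite [LHS]mxE.
case: (unliftP ord0 i) => [i'|] ->; case: (unliftP ord0 j) => [j'|] -> /=.
- rewrite [in RHS]eS [in RHS]eS block_mxEdr mxE /bump /= !add1n ltnS.
  have nin (a b : 'I_n) : (lift ord0 a, lift ord0 b) \notin [seq (ord0 : 'I_n.+1, lift ord0 j) | j <- enum 'I_n].
    by apply/mapP => -[k _ []].
  by case: ifP => _; rewrite (negbTE (nin _ _)).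
- rewrite [in RHS]eS [in RHS]e0 block_mxEdl mxE lr.
  by [].
- rewrite [in RHS]eS [in RHS]e0 block_mxEur !mxE lr.
  by [].
- by rewrite [in RHS]e0 block_mxEul mxE eqxx mulr1n.
Qed.

(** The row-by-row order of [goe_idx] is also the order in which [symm] splits off the corner, the
    first row and the remaining block, so the iterated integrals correspond one to one. *)
Lemma iint_goe_symm n (g : 'M[R]_n -> \bar R) :
  measurable_fun [set: 'M[R]_n] g -> (forall M, 0 <= g M) ->
  iint (goe_idx n) (fun v => g (goe_mat v)) = \int[symm R n]_M g M.
Proof.
elim: n g => [|n IH] g mg g0.
  rewrite integral_symm0 //.
  have -> /= : goe_idx 0 = [::].
    by rewrite /goe_idx; case: (enum _) => // -[[]].
  by congr g; apply/matrixP => -[].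
move: g mg g0; rewrite -[n.+1]/(1 + n)%N => g mg g0.
rewrite (integral_symmS mg g0) goe_idxS /=; apply: eq_integral => x _.
rewrite iint_cat (@iint_map _ _ (fun j : 'I_n => (ord0 : 'I_n.+1, lift ord0 j))
  (fun u => if u.1 == ord0 then unlift ord0 u.2 else None)); last 2 first.
- by move=> t /=; rewrite liftK.
- by move=> [u1 u2] t /=; case: eqP => // ->; case: unliftP => // j -> [->].
have mb : measurable_fun [set: 'cV[R]_n * 'M[R]_n]
    (fun z => g (block_mx x%:M z.1^T z.1 z.2)).
  by apply: (measurableT_comp mg); measurable_mx.
have mi := measurable_integral_param (symm R n)
  (fun (v : 'cV[R]_n) (A : 'M[R]_n) => g (block_mx x%:M v^T v A)) mb (fun v A => g0 _).
rewrite -(iint_enum_ord mi (fun v => integral_ge0 _ (fun A _ => g0 _))).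
apply: eq_iint => w.
rewrite (@iint_map _ _ (fun p : 'I_n * 'I_n => (lift ord0 p.1, lift ord0 p.2))
  (fun u : 'I_n.+1 * 'I_n.+1 => if unlift ord0 u.1 is Some a then
     if unlift ord0 u.2 is Some b then Some (a, b) else None else None)); last 2 first.
- by move=> [a b] /=; rewrite !liftK.
- by move=> [u1 u2] t /=; case: unliftP => // a ->; case: unliftP => // b -> [<-].
have mw : measurable_fun [set: 'M[R]_n] (fun A => g (block_mx x%:M (\col_j w j)^T (\col_j w j)%R A)).
  by apply: (measurableT_comp mg); measurable_mx.
rewrite -(IH _ mw (fun A => g0 _)); apply: eq_iint => w2; congr g.
by rewrite -goe_mat_cons.
Qed.

End iterated_integrals.

Section density.
Variable R : realType.

Lemma gnormE n : gnorm R n = \prod_(i < n) \prod_(j < n | (i <= j)%N)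
  (if val i == val j then normal_peak 1 else normal_peak (Num.sqrt (1 / 2))).
Proof.
elim: n => [|n IH] /=; first by rewrite big_ord0.
rewrite big_ord_recl; congr (_ * _).
  rewrite big_ord_recl /=; congr (_ * _).
  by rewrite big_const card_ord iter_mulr_1.
rewrite IH; apply: eq_bigr => i _; rewrite [RHS]big_mkcond big_ord_recl /= [RHS]mul1r [LHS]big_mkcond.
by apply: eq_bigr => j _.
Qed.

Lemma mxtrace_goe_sq n (v : 'I_n * 'I_n -> R) :
  \tr (goe_mat v *m goe_mat v) =
  2 * \sum_(i < n) \sum_(j < n | (i <= j)%N)
    (if val i == val j then v (i, j) ^+ 2 / 2 else v (i, j) ^+ 2).
Proof.
transitivity (\sum_(i < n) \sum_(j < n) goe_mat v i j ^+ 2).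
  apply: eq_bigr => i _; rewrite mxE; apply: eq_bigr => j _; rewrite expr2 !mxE.
  by case: ltngtP => // ij; rewrite (val_inj ij).
transitivity (\sum_(i < n) \sum_(j < n | (i <= j)%N) v (i, j) ^+ 2 +
              \sum_(i < n) \sum_(j < n | (j < i)%N) v (j, i) ^+ 2).
  rewrite -big_split /=; apply: eq_bigr => i _.
  rewrite (bigID (fun j : 'I_n => (i <= j)%N)) /=; congr (_ + _).
    by apply: eq_bigr => j ij; rewrite mxE ij.
  by apply: eq_big => [j|j ij]; rewrite ?ltnNge // mxE (negbTE ij).
rewrite [X in _ + X = _](exchange_big_dep xpredT) //= -big_split big_distrr /=; apply: eq_bigr => i _.
rewrite big_distrr /= [X in X + _ = _]big_mkcond [X in _ + X = _]big_mkcond [RHS]big_mkcond /=.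
rewrite -big_split; apply: eq_bigr => j _ /=.
by case: ltngtP => // _; rewrite ?addr0; field.
Qed.

(** An off-diagonal entry occurs twice in [tr M^2], which its variance 1/2 exactly matches; the
    density is therefore a function of the spectrum. *)
Lemma goe_densityE n (v : 'I_n * 'I_n -> R) :
  goe_density v = gnorm R n * expR (- \tr (goe_mat v *m goe_mat v) / 2).
Proof.
rewrite mxtrace_goe_sq mulNr mulrAC divff // mul1r gnormE /goe_density /goe_idx.
rewrite big_filter big_enum_cond /=.
transitivity (\prod_(i < n) \prod_(j < n | (i <= j)%N)
    (if val i == val j then normal_pdf 0 1 (v (i, j))
     else normal_pdf 0 (Num.sqrt (1 / 2)) (v (i, j)))).
  by rewrite pair_big_dep /=; apply: eq_bigr => -[i j].
rewrite -sumrN (big_morph _ (@expRD R) (@expR0 R)) -big_split /=; apply: eq_bigr => i _.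
rewrite -sumrN (big_morph _ (@expRD R) (@expR0 R)) -big_split /=; apply: eq_bigr => j _.
have s0 : Num.sqrt (1 / 2) != 0 :> R by rewrite sqrtr_eq0 -ltNge divr_gt0.
case: ifP => _; rewrite normal_pdfE ?oner_eq0 // /normal_fun subr0 ?sqr_sqrtr ?divr_ge0 //.
  by congr (_ * expR _); rewrite expr1n mulNr.
by congr (_ * expR _); rewrite -mulr_natr mulfVK ?divr1.
Qed.

End density.

(** * The law of an ordered eigenvalue *)

Section eigenvalue_law.
Variable R : realType.
Local Open Scope ereal_scope.
Notation leb := (@lebesgue_measure R).

Lemma mxtrace_sqr_eigs n (M : 'M[R]_n) : M^T = M ->
  (\tr (M *m M) = \sum_(x <- eigs M) x ^+ 2)%R.
Proof.
move=> MT; have [mu [_ [_ [cM _ _ trM]]]] := sym_spectral MT.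
rewrite -[LHS]/(\tr (M ^+ 2))%R (mxtrace_sqr trM) (eigs_perm cM).
rewrite (perm_big [seq mu i | i <- enum 'I_n]); last by rewrite perm_sort.
by rewrite big_map big_enum.
Qed.

Lemma mxtrace_sqr_spectral n (M N : 'M[R]_n) : M^T = M -> N^T = N ->
  char_poly M = char_poly N -> (\tr (M *m M) = \tr (N *m N))%R.
Proof. by move=> MT NT MN; rewrite !mxtrace_sqr_eigs // (eigs_char_poly MN). Qed.

Lemma mxtrace_sqr_dsum n (l : R) (A : 'M[R]_n) :
  (\tr (dsum l A *m dsum l A) = l ^+ 2 + \tr (A *m A))%R.
Proof.
rewrite /dsum mulmx_block !mulmx0 !mul0mx !addr0 add0r mxtrace_block -scalar_mxM.
by rewrite mxtrace_scalar mulr1n expr2.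
Qed.

(** As the comparison in [cnt] is strict, [cnt A l] is the 0-based position of the first occurrence
    of [l] in the sorted spectrum, even when [l] is also an eigenvalue of [A]. *)
Lemma nth_eigs_dsum n (l : R) (A : 'M[R]_n) : A^T = A ->
  nth 0%R (eigs (dsum l A)) (cnt A l) = l.
Proof.
move=> AT; have [sD szD cD] := eigsP (dsum_sym l AT).
have [_ szA cA] := eigsP AT.
have pD : perm_eq (eigs (dsum l A)) (l :: eigs A).
  rewrite (@eigs_unique _ _ (dsum l A) (sort <=%R (l :: eigs A))%R).
  - by rewrite perm_sort.
  - exact: sort_le_sorted.
  rewrite char_poly_dsum cA [RHS](perm_big (l :: eigs A)) /=; last by rewrite perm_sort.
  by rewrite big_cons.
have kn : (cnt A l < n.+1)%N by rewrite ltnS /cnt -[X in (_ <= X)%N]szA count_size.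
have szD' : size (eigs (dsum l A)) = n.+1 by [].
have cl : count (fun x => x < l)%R (eigs (dsum l A)) = cnt A l.
  by rewrite (seq.permP pD) /= ltxx.
apply/eqP; rewrite eq_le; apply/andP; split; last first.
  by rewrite leNgt sorted_nth_lt ?szD' // cl ltnn.
rewrite leNgt; apply/negP => ll.
have lD : l \in eigs (dsum l A) by rewrite (perm_mem pD) mem_head.
have isz : (index l (eigs (dsum l A)) < n.+1)%N by rewrite -szD' index_mem.
have := sorted_nth_lt l sD; rewrite szD' => /(_ _ isz); rewrite nth_index // ltxx cl => /esym/negbT.
rewrite -leqNgt => ki; have := sorted_leq_nth le_trans lexx 0%R sD.
move=> /(_ (cnt A l) (index l (eigs (dsum l A)))); rewrite !inE szD' => /(_ kn isz ki).
by rewrite nth_index // leNgt ll.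
Qed.

End eigenvalue_law.

Section density_formula.
Variable R : realType.
Local Open Scope ereal_scope.
Notation leb := (@lebesgue_measure R).

(** What deflation leaves on the smaller matrix once the Gaussian factor of [l] has been taken
    out. *)
Definition level_weight n p (l : R) (M : 'M[R]_n) : R :=
  (`|\det (M - l%:M)| * ((cnt (symz M) l == p)%:R * expR (- \tr (M *m M) / 2)))%R.

Lemma level_weight_ge0 n p (l : R) (M : 'M[R]_n) : (0 <= level_weight p l M)%R.
Proof. by rewrite !mulr_ge0 ?expR_ge0. Qed.

Lemma measurable_expR_mxtrace d (T : measurableType d) n (M : T -> 'M[R]_n) :
  measurable_fun [set: T] M ->
  measurable_fun [set: T] (fun t => expR (- \tr (M t *m M t) / 2)).
Proof.
move=> mM; apply: measurableT_comp; first exact: measurable_expR.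
apply: measurable_funM; last exact: measurable_cst.
by apply: measurable_funN; apply: measurable_mxtrace; exact: measurable_mulmx.
Qed.

Lemma measurable_level_weight n p : measurable_fun [set: measurableTypeR R * 'M[R]_n]
  (fun z => level_weight p z.1 z.2).
Proof.
apply: measurable_funM; first by measurable_mx.
apply: measurable_funM; last by apply: measurable_expR_mxtrace; exact: measurable_snd.
apply: measurable_fun_boolr.
by apply: measurable_cnt_comp; [exact: measurable_snd|exact: measurable_fst].
Qed.

Lemma char_poly_diagv n (x : 'cV[R]_n) :
  char_poly (diagv x) = (\prod_(y <- [seq x j 0 | j <- enum 'I_n]) ('X - y%:P))%R.
Proof.
rewrite char_poly_trig ?diag_mx_is_trig // big_map big_enum /=.
by apply: eq_bigr => j _; rewrite !mxE eqxx mulr1n.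
Qed.

Lemma level_weight_diagv n p (l : R) (x : 'cV[R]_n) :
  level_weight p l (diagv x) = gweight p l x.
Proof.
rewrite /level_weight /gweight det_diagv_sub normr_prod mulrCA; congr (_ * _)%R.
  rewrite symzE ?diagv_sym // (cnt_prod _ (char_poly_diagv x)) count_map -sum1_count.
  congr (nat_of_bool (_ == p))%:R; rewrite big_enum_cond /nbelow big_mkcond /=.
  by apply: eq_bigr => j _; case: (_ < _)%R.
rewrite big_split /=; congr (_ * _)%R.
have -> : (\prod_(j < n) expR (- x j 0 ^+ 2 / 2) = expR (\sum_(j < n) (- x j 0 ^+ 2 / 2)))%R.
  by rewrite (big_morph expR (@expRD R) (@expR0 R)).
congr expR; rewrite /diagv mulmx_diag mxtrace_diag mulNr mulr_suml -sumrN.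
by apply: eq_bigr => j _; rewrite !mxE expr2 mulNr.
Qed.

(** The factorial from the unordered eigenvalues cancels the one from antisymmetrization, so it
    leaves no trace here. *)
Lemma integral_level_weight n p (l : R) :
  \int[symm R n]_M (level_weight p l M)%:E =
  cprod R n * ((-1) ^+ p * \sum_(I : {set 'I_n} | #|I| == p) pfaffian (Amat 1 I l))%:E.
Proof.
set S := (_ * \sum_(I | _) _)%R.
have mh : measurable_fun [set: 'M[R]_n] (fun M => (level_weight p l M)%:E).
  apply: measurable_EFin_fun.
  apply: (measurableT_comp (@measurable_level_weight n p) (g := fun M => (l, M))).
  exact: measurable_fun_pair.
have h0 (M : 'M[R]_n) : 0 <= (level_weight p l M)%:E by rewrite lee_fin level_weight_ge0.
have sh : spectral (fun M : 'M[R]_n => (level_weight p l M)%:E).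
  move=> M N MT NT MN; rewrite /level_weight (mxtrace_sqr_spectral MT NT MN).
  rewrite (symzE MT) (symzE NT) /cnt (eigs_char_poly MN); congr ((_ * _)%R%:E).
  by rewrite !norm_det_sub_scalar MN.
have := integral_symm_spectral mh h0 sh.
rewrite (eq_integral (fun x => (`|vdm x| * gweight p l x)%:E)); last first.
  by move=> x _; rewrite level_weight_diagv EFinM.
rewrite -sum_pfaffian -/S EFinM muleCA => e.
have f0 : (n`!%:R != 0 :> R)%R by rewrite pnatr_eq0 -lt0n fact_gt0.
have := congr1 (fun z => (n`!%:R^-1)%:E * z) e.
by rewrite !muleA -!EFinM mulVf // !mul1e.
Qed.

Lemma goe_mat_sym n (v : 'I_n * 'I_n -> R) : (goe_mat v)^T = goe_mat v.
Proof. by apply/matrixP => i j; rewrite !mxE; case: ltngtP => // /val_inj ->. Qed.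

Lemma eigenvalue_density (n p : nat) (B : set R) : (p <= n)%N -> measurable B ->
  goe_prob (fun M : 'M[R]_n.+1 => B (Lk p.+1 M)) =
  \int[leb]_(l in B) (qNk n.+1 p.+1 l)%:E.
Proof.
move=> pn mB.
(* The density without its constant, on the event that the eigenvalue in 0-based position [p] lies
   in [B]; [symz] makes it measurable on all matrices and agrees with the identity on GOE
   samples. *)
pose G (M : 'M[R]_(1 + n)) : \bar R :=
  (\1_B (nth 0 (eigs (symz M)) p) * expR (- \tr (M *m M) / 2))%:E.
have mG : measurable_fun [set: 'M[R]_(1 + n)] G.
  apply: measurable_EFin_fun; apply: measurable_funM; last first.
    by apply: measurable_expR_mxtrace; exact: measurable_id.
  have mI : measurable_fun [set: measurableTypeR R] (\1_B : R -> R) by apply: measurable_indic.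
  by apply: (measurableT_comp mI); apply: measurable_eig; rewrite ltnS.
have G0 M : 0 <= G M by rewrite lee_fin mulr_ge0 ?expR_ge0.
have sG : spectral G.
  move=> M N MT NT MN; rewrite /G (symzE MT) (symzE NT) (eigs_char_poly MN).
  by rewrite (mxtrace_sqr_spectral MT NT MN).
have gn0 : 0 <= (gnorm R n.+1)%:E.
  elim: (n.+1) => [|m IH] /=; first by rewrite lee_fin.
  by rewrite lee_fin !mulr_ge0 ?exprn_ge0 ?normal_peak_ge0.
have mGc : measurable_fun [set: 'M[R]_(1 + n)] (fun M => (gnorm R n.+1)%:E * G M).
  by apply: emeasurable_funM => //; exact: measurable_cst.
transitivity (\int[symm R n.+1]_M ((gnorm R n.+1)%:E * G M)).
  rewrite -(iint_goe_symm mGc); last by move=> M; rewrite mule_ge0.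
  apply: eq_iint => v; rewrite /G symzE ?goe_mat_sym // -EFinM goe_densityE indicE; congr EFin.
  case: asboolP => [Bv|nBv]; first by rewrite mem_set // mul1r.
  by rewrite memNset // mul0r mulr0.
rewrite (ge0_integralZl _ measurableT mG (fun M _ => G0 M) gn0).
rewrite (integral_symm_deflate mG G0 sG pn).
pose e (l : R) : R := (\1_B l * expR (- l ^+ 2 / 2))%R.
have e0 l : (0 <= e l)%R by rewrite mulr_ge0 ?expR_ge0.
have mw (l : R) : measurable_fun [set: 'M[R]_n] (fun A => (level_weight p l A)%:E).
  apply: measurable_EFin_fun.
  apply: (measurableT_comp (@measurable_level_weight n p) (g := fun M => (l, M))).
  exact: measurable_fun_pair.
have inner (l : R) : \int[symm R n]_A (`|\det (A - l%:M)|%:E *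
     (if cnt (symz A) l == p then G (dsum l A) else 0)) =
   (e l)%:E * \int[symm R n]_A (level_weight p l A)%:E.
  have el0 : 0 <= (e l)%:E by rewrite lee_fin.
  have w0 (A : 'M[R]_n) : 0 <= (level_weight p l A)%:E by rewrite lee_fin level_weight_ge0.
  rewrite -(ge0_integralZl _ measurableT (mw l) (fun A _ => w0 A) el0).
  apply: eq_integral_symm.
  - apply: emeasurable_funM; first by measurable_mx.
    apply: measurable_fun_ifT => //.
      by apply: measurable_cnt_comp; [exact: measurable_id|exact: measurable_cst].
    by apply: (measurableT_comp mG); rewrite /dsum; measurable_mx.
  - by apply: emeasurable_funM => //; exact: measurable_cst.
  - by move=> A; apply: mule_ge0; [rewrite lee_fin|case: ifP].
  - by move=> A; apply: mule_ge0.
  move=> A AT; rewrite /level_weight; case: ifPn => [/eqP cA|_]; last first.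
    by rewrite mule0 mul0r mulr0 mule0.
  rewrite mul1r /G symzE ?dsum_sym // mxtrace_sqr_dsum.
  have -> : nth 0%R (eigs (dsum l A)) p = l.
    by rewrite -cA symzE // nth_eigs_dsum.
  rewrite -!EFinM /e opprD mulrDl expRD; congr EFin; ring.
transitivity (\int[leb]_l ((gnorm R n.+1)%:E * (cvol R n * ((e l)%:E *
    \int[symm R n]_A (level_weight p l A)%:E)))).
  have mi := measurable_integral_param (symm R n)
    (fun (l : measurableTypeR R) (A : 'M[R]_n) => (level_weight p l A)%:E).
  have me : measurable_fun [set: measurableTypeR R]
      (fun l : R => (e l)%:E * \int[symm R n]_A (level_weight p l A)%:E).
    apply: emeasurable_funM.
      apply: measurable_EFin_fun; apply: measurable_funM; first exact: measurable_indic.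
      exact: measurable_expR_sq.
    apply: mi; first by apply: measurable_EFin_fun; exact: measurable_level_weight.
    by move=> l A; rewrite lee_fin level_weight_ge0.
  have ef0 (l : R) : 0 <= (e l)%:E * \int[symm R n]_A (level_weight p l A)%:E.
    by apply: mule_ge0; [rewrite lee_fin|apply: integral_ge0 => A _; rewrite lee_fin level_weight_ge0].
  have mce : measurable_fun [set: measurableTypeR R]
      (fun l : R => cvol R n * ((e l)%:E * \int[symm R n]_A (level_weight p l A)%:E)).
    by apply: emeasurable_funM => //; exact: measurable_cst.
  rewrite [RHS](ge0_integralZl _ measurableT mce (fun l _ => mule_ge0 (cvol_ge0 R n) (ef0 l)) gn0).
  apply: (congr1 (fun z => (gnorm R n.+1)%:E * z)).
  rewrite [RHS](ge0_integralZl _ measurableT me (fun l _ => ef0 l) (cvol_ge0 R n)).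
  by apply: (congr1 (fun z => cvol R n * z)); apply: eq_integral => l _; exact: inner.
rewrite [RHS]integral_mkcond; apply: eq_integral => l _.
(* [cvol n * cprod n] is [cprod n.+1] by definition: the one ordered deflation supplies the constant
   missing for size [n + 1], which accounts for [kN] and the factorial at [N = n + 1]. *)
have gc : (gnorm R n.+1)%:E * (cvol R n * cprod R n) = (kN R n.+1 * n.+1`!%:R)%:E.
  exact: (gnorm_cprod R n.+1).
rewrite integral_level_weight (muleCA (e l)%:E) (muleA (cvol R n)) (muleA (gnorm _ _)%:E) gc.
rewrite -!EFinM patchE /e indicE /qNk; case: (l \in B); last by rewrite !mul0r mulr0.
by congr EFin; rewrite mul1r /=; set S := (\sum_(I | _) _)%R; ring.
Qed.

End density_formula.

(** qNk N k is a probability density of the k-th smallest eigenvalue L_k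
    of an N-GOE matrix: P(L_k in B) = int_B qNk N k for all Borel B. *)
Theorem theorem1 (R : realType) (N k : nat) :
  (1 <= N)%N -> (1 <= k <= N)%N ->
  forall B : set R, measurable B ->
  goe_prob (fun M : 'M[R]_N => B (Lk k M)) =
  (\int[lebesgue_measure]_(l in B) (qNk N k l)%:E)%E.
Proof.
case: N => // n _; case: k => // p; rewrite ltnS => pn B mB.
exact: eigenvalue_density.
Qed.
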